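(* Let $\Gamma$ be a countable virtually solvable group. Then the space of left-orderings $\mathcal{LO}(\Gamma)$ is either finite or homeomorphic to a Cantor set.
   Context: A left-ordering on a group $G$ is a total order $\preceq$ on $G$ such that $f\preceq g$ implies $hf\preceq hg$ for all $f,g,h\in G$. The space $\mathcal{LO}(G)$ is the set of all left-orderings of $G$, with the topology having as a basis the sets $V_{f_1,\dots,f_k}=\{\preceq \;\mid\; id\preceq f_1,\dots, id\preceq f_k\}$, where $\{f_1,\dots,f_k\}$ runs over the finite subsets of $G$ (so $\mathcal{LO}(G)$ is empty, hence finite, when $G$ is not left-orderable). A group is virtually solvable if it has a solvable subgroup of finite index. *)

(* Defs.v *)
From HB Require Import structures.
From mathcomp Require Import all_boot finmap.
From mathcomp Require Import all_classical topology cantor.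

Set Implicit Arguments.
Unset Strict Implicit.
Unset Printing Implicit Defensive.

Local Open Scope classical_set_scope.
Local Open Scope group_scope.

Definition is_left_ordering (G : groupType) (le : rel G) : Prop :=
  [/\ reflexive le, antisymmetric le, transitive le, total le &
      forall f g h : G, le f g -> le (h * f) (h * g)].

Record left_ordering (G : groupType) := LeftOrdering {
  lo_le :> rel G;
  lo_leP : is_left_ordering lo_le
}.

Lemma left_ordering_inj (G : groupType) : injective (@lo_le G).
Proof.
move=> [r rP] [s sP] /= rs; rewrite {}rs in rP *.
by congr LeftOrdering; exact: Prop_irrelevance.
Qed.

(* The equality structure compares whole records; by the lemma above this is
   equality of the underlying relations. *)
HB.instance Definition _ (G : groupType) := gen_eqMixin (left_ordering G).
HB.instance Definition _ (G : groupType) := gen_choiceMixin (left_ordering G).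

Section LeftOrderingTopology.
Variable G : groupType.

Definition lo_basic (F : {fset G}) : set (left_ordering G) :=
  [set o : left_ordering G | forall f, f \in F -> o 1 f].

Let lo_basic_cover : \bigcup_(F in [set: {fset G}]) lo_basic F = setT.
Proof. by rewrite -subTset => o _; exists fset0 => // f; rewrite in_fset0. Qed.

Let lo_basic_join (E F : {fset G}) (o : left_ordering G) :
  [set: {fset G}] E -> [set: {fset G}] F -> lo_basic E o -> lo_basic F o ->
  exists K : {fset G},
    [/\ [set: {fset G}] K, lo_basic K o &
        lo_basic K `<=` lo_basic E `&` lo_basic F].
Proof.
move=> _ _ Eo Fo; exists (E `|` F)%fset; split=> //.
  by move=> f /fsetUP[/Eo|/Fo].
by move=> p Kp; split=> f fin; apply: Kp; rewrite in_fsetU fin ?orbT.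
Qed.

HB.instance Definition _ := isBaseTopological.Build (left_ordering G)
  lo_basic_cover lo_basic_join.

End LeftOrderingTopology.

Definition subgroup (G : groupType) (H : set G) : Prop :=
  [/\ H 1, forall x y, H x -> H y -> H (x * y) & forall x, H x -> H x^-1].

Definition derived_subgroup (G : groupType) (H : set G) : set G :=
  smallest (@subgroup G) [set [~ x, y] | x in H & y in H].

Definition solvable (G : groupType) (H : set G) : Prop :=
  exists n, iter n (@derived_subgroup G) H = [set 1].

Definition finite_index (G : groupType) (H : set G) : Prop :=
  finite_set (range (fun x : G => [set x * h | h in H])).

Definition virtually_solvable (G : groupType) : Prop :=
  exists H : set G, [/\ subgroup H, solvable H & finite_index H].

Definition homeomorphic (T U : topologicalType) : Prop :=
  exists (f : T -> U) (g : U -> T),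
    [/\ continuous f, continuous g, cancel f g & cancel g f].

(* Main.v *)
From HB Require Import structures.
Require Import Defs.
From mathcomp Require Import all_boot finmap all_classical topology cantor.

Set Implicit Arguments.
Unset Strict Implicit.
Unset Printing Implicit Defensive.

Local Open Scope classical_set_scope.
Local Open Scope group_scope.

(** A left order of G is given by its cone of elements above 1. The sets of orders
    that make a given element positive are clopen and separate points, and the
    space of orders is compact. If G is countable there are countably many such
    sets, so when no order is isolated the space is a Cantor set
    ([homeomorphic_cantor]). It remains to show that a virtually solvable group
    with an isolated order P has only finitely many orders ([determined_tame]).

    An order P is isolated when a finite set F of positive elements determines it.
    The idea is to use F against left-invariant preorders, represented by
    precones: multiplicatively closed sets Q such that g or g^-1 is in Q for each g.
    Breaking the ties of Q by P gives an order; so every precone that contains F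
    contains P, and then its residue, the subgroup of the g with g and g^-1 in Q,
    is convex for P. The proof constructs various precones containing F (by
    changing the base point of an action, by cutting an ordered set, from a fixed
    point of an affine action) and uses that they contain P, mostly through the
    convexity of the residue.

    The order inside a convex subgroup can be changed freely. Therefore F meets
    every gap between two convex subgroups, there is a largest proper convex
    subgroup D, and the order of D is determined by the elements of F in D, which
    are fewer. The induction on the size of F shows that every order of G is
    conjugate, by one of finitely many elements, to P or its reverse; that the
    convex subgroups are normal; and that the topmost factor is abelian of rank
    one. The induction step is as follows.

    - D is normal ([maxconvex_normal]). G acts on the ordered set G/D, and solvability
      provides a normal subgroup A that acts through an abelian group. Its elements
      act without fixed points or trivially, and either A is central with a least
      positive element or its orbits are dense. In the dense case small
      elements of A normalize D, because a small change of base point leaves F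
      positive, and this forces D to act trivially. In the central case one repeats the
      argument one step higher in the solvable series.
    - G/D is abelian ([quotient_abelian], after Hoelder) and of rank one
      ([rank_one]), since orders of abelian groups of higher rank are not isolated.
    - Let D/N be the topmost factor of D. Some t in G reverses its order
      ([exists_inverting]). If not, G acts on D/N by scaling. A trivial action would
      make G/N abelian of rank one. In a nontrivial one some t has a fixed point on
      the line spanned by D/N, and the preorder based at a suitable conjugate of this
      fixed point contains F and has a residue that is not convex.
    - An element that reverses D/N lies above or below the whole of D, in any order R
      of G. So D is convex for R ([order_convex]), and R is known from its restriction
      to D and its sign on G/D, which leaves finitely many possibilities. *)

(** * Preorder cones and convex subgroups *)

Section Cones.
Variable G : groupType.
Implicit Types (f g h x y z : G) (P Q C D N : set G) (F : seq G).

(** Rewriting with [gE] cancels adjacent inverse letters in a group word. *)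
Definition gE := (@invgM G, @invgK G, @invg1 G, @mulgA G, @mulgK G, @mulgVK G,
  @mulgV G, @mulVg G, @mul1g G, @mulg1 G).

(** The elements at or above 1 for a left-invariant total preorder of G. *)
Definition precone Q :=
  (forall g h, Q g -> Q h -> Q (g * h)) /\ (forall g, Q g \/ Q g^-1).

Definition order_cone P := precone P /\ forall g, P g -> P g^-1 -> g = 1.

(** The subgroup of the elements equivalent to 1; the preorder is an order of
    its left cosets. *)
Definition residue Q : set G := [set g | Q g /\ Q g^-1].

(** Compares by Q first, and by P when Q does not decide. *)
Definition tiebreak Q P : set G := [set g | Q g /\ (Q g^-1 -> P g)].

(** For a subgroup it suffices to test intervals that start at 1. *)
Definition convex P C :=
  subgroup C /\ (forall x y, P x -> P (x^-1 * y) -> C y -> C x).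

Definition normal C := forall g x, C x -> C (g * x * g^-1).

(** Isolation of P in the space of orders gives the second clause for order
    cones. Asking it of all precones costs nothing, since ties can be broken by
    P, and it is what makes residues convex. *)
Definition determines F P :=
  (forall f, f \in F -> P f) /\
  (forall Q, precone Q -> (forall f, f \in F -> Q f) -> P `<=` Q).

Definition le Q g h := Q (g^-1 * h).
Definition lt Q g h := ~ le Q h g.

Lemma precone1 Q : precone Q -> Q 1.
Proof. by move=> [_ /(_ 1)]; rewrite invg1 => -[]. Qed.

Lemma preconeX Q g n : precone Q -> Q g -> Q (g ^+ n).
Proof.
move=> cQ Qg; elim: n => [|n IH]; first by rewrite expg0; exact: precone1.
by rewrite expgS; apply: cQ.1.
Qed.

Lemma precone_residue Q : precone Q -> subgroup (residue Q).
Proof.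
move=> cQ; split.
- by split; rewrite ?invg1; exact: precone1.
- move=> x y [Qx Qx'] [Qy Qy']; split; first exact: cQ.1.
  by rewrite invgM; apply: cQ.1.
- by move=> x [Qx Qx']; split=> //; rewrite invgK.
Qed.

Lemma tiebreak_order_cone Q P :
  precone Q -> order_cone P -> order_cone (tiebreak Q P).
Proof.
move=> cQ [cP aP]; split; first split.
- move=> g h [Qg Pg] [Qh Ph]; split=> [|Qgh]; first exact: cQ.1.
  apply: cP.1.
    apply: Pg; have -> : g^-1 = h * (g * h)^-1 by rewrite !gE.
    exact: cQ.1.
  apply: Ph; have -> : h^-1 = (g * h)^-1 * g by rewrite !gE.
  exact: cQ.1.
- move=> g; have [Qg|nQg] := pselect (Q g); last first.
    by right; split; [case: (cQ.2 g)|rewrite invgK].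
  have [Qg'|nQg'] := pselect (Q g^-1); last by left; split.
  by have [Pg|Pg] := cP.2 g; [left|right]; split; rewrite ?invgK.
- by move=> g [Qg Pg] [Qg' Pg']; apply: aP; [exact: Pg|apply: Pg'; rewrite invgK].
Qed.

(** A precone that contains a determining set of P contains P; this lemma then
    turns its residue into a convex subgroup, which is how isolation is mostly
    used. *)
Lemma residue_convex Q P : precone Q -> P `<=` Q -> convex P (residue Q).
Proof.
move=> cQ PQ; split; first exact: precone_residue.
move=> x y Px Pxy [Qy Qy']; split; first exact: PQ.
have -> : x^-1 = x^-1 * y * y^-1 by rewrite !gE.
by apply: cQ.1 => //; apply: PQ.
Qed.

Lemma subgroup1 C : subgroup C -> C 1. Proof. by case. Qed.
Lemma subgroupM C x y : subgroup C -> C x -> C y -> C (x * y).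
Proof. by case=> _ + _; exact. Qed.
Lemma subgroupV C x : subgroup C -> C x -> C x^-1.
Proof. by case=> _ _; exact. Qed.
Lemma subgroupVE C x : subgroup C -> C x^-1 -> C x.
Proof. by move=> sC /(subgroupV sC); rewrite invgK. Qed.
Lemma subgroupX C x n : subgroup C -> C x -> C (x ^+ n).
Proof.
move=> sC Cx; elim: n => [|n IH]; first by rewrite expg0; exact: subgroup1.
by rewrite expgS; apply: subgroupM.
Qed.
Lemma subgroupMl C x y : subgroup C -> C x -> C (x * y) -> C y.
Proof.
move=> sC Cx Cxy; have -> : y = x^-1 * (x * y) by rewrite !gE.
by apply: subgroupM => //; apply: subgroupV.
Qed.
Lemma subgroupMr C x y : subgroup C -> C y -> C (x * y) -> C x.
Proof.
move=> sC Cx Cxy; have -> : x = x * y * y^-1 by rewrite !gE.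
by apply: subgroupM => //; apply: subgroupV.
Qed.

Lemma conj_expg g x n : (g * x * g^-1) ^+ n = g * x ^+ n * g^-1.
Proof. by elim: n => [|n IH]; rewrite ?expg0 ?expgS ?IH !gE. Qed.

Lemma normalV C g x : normal C -> C x -> C (g^-1 * x * g).
Proof. by move=> nC /(nC g^-1); rewrite invgK. Qed.

Section Order.
Variable Q : set G.
Hypothesis cQ : precone Q.

Lemma le_refl g : le Q g g.
Proof. by rewrite /le !gE; exact: precone1. Qed.

Lemma le_trans h g k : le Q g h -> le Q h k -> le Q g k.
Proof.
rewrite /le => Qgh Qhk; have -> : g^-1 * k = g^-1 * h * (h^-1 * k) by rewrite !gE.
exact: cQ.1.
Qed.

Lemma le_total g h : le Q g h \/ le Q h g.
Proof. by have := cQ.2 (g^-1 * h); rewrite /le !gE. Qed.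

Lemma leM k g h : le Q (k * g) (k * h) = le Q g h.
Proof. by rewrite /le !gE. Qed.

Lemma ltW g h : lt Q g h -> le Q g h.
Proof. by case: (le_total g h). Qed.

Lemma ltM k g h : lt Q (k * g) (k * h) = lt Q g h.
Proof. by rewrite /lt leM. Qed.

Lemma lt_le_trans h g k : lt Q g h -> le Q h k -> lt Q g k.
Proof. by move=> gh hk kg; apply: gh; exact: le_trans kg. Qed.

Lemma le_lt_trans h g k : le Q g h -> lt Q h k -> lt Q g k.
Proof. by move=> gh hk kg; apply: hk; exact: le_trans gh. Qed.

Lemma lt_nle g h : ~ le Q g h -> lt Q h g. Proof. by []. Qed.

End Order.

Lemma convex_between P C a x b :
  convex P C -> le P a x -> le P x b -> C a -> C b -> C x.
Proof.
move=> [sC cC] ax xb Ca Cb; rewrite -[x](mulVKg a); apply: subgroupM => //.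
apply: (cC _ (a^-1 * b)) => //; first by move: xb; rewrite /le !gE.
by apply: subgroupM => //; apply: subgroupV.
Qed.

Lemma convex_sub P C D : precone P -> convex P C -> convex P D ->
  C `<=` D \/ D `<=` C.
Proof.
move=> cP cC cD; have [?|/existsNP[x /not_implyP[Cx nDx]]] := pselect (C `<=` D).
  by left.
right=> y Dy.
have [x' [Px' Cx' nDx']] : exists x, [/\ P x, C x & ~ D x].
  have [Px|Px] := cP.2 x; first by exists x.
  exists x^-1; split=> //; first exact: subgroupV cC.1 Cx.
  by move=> /(subgroupVE cD.1).
suff main z : P z -> D z -> C z.
  have [Py|Py] := cP.2 y; first exact: main.
  by apply: (subgroupVE cC.1); apply: main => //; exact: subgroupV cD.1 Dy.
move=> Pz Dz; have [zx|xz] := le_total cP z x'; first exact: cC.2 zx Cx'.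
by case: nDx'; exact: cD.2 xz Dz.
Qed.

Lemma convex_root P C x n : precone P -> convex P C -> C (x ^+ n.+1) -> C x.
Proof.
move=> cP cC; suff pos y : P y -> C (y ^+ n.+1) -> C y.
  move=> Cx; have [Px|Px] := cP.2 x; first exact: pos.
  apply: (subgroupVE cC.1); apply: pos => //.
  by rewrite expVgn; exact: subgroupV cC.1 Cx.
by move=> Py; apply: cC.2 => //; rewrite expgS mulKg; exact: preconeX.
Qed.

(** Collapsing the cosets of C to points. *)
Lemma convex_precone P C : precone P -> convex P C -> precone (P `|` C).
Proof.
move=> cP cC; have sC := cC.1; split=> [g h|g]; last first.
  by case: (cP.2 g); [left; left|right; left].
move=> [Pg|Cg] [Ph|Ch]; first by left; exact: cP.1.
- have [Pgh|Pgh] := cP.2 (g * h); first by left.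
  right; apply: (subgroupVE sC); apply: (cC.2 _ h^-1) => //.
    by rewrite !gE.
  exact: subgroupV.
- have [Pgh|Pgh] := cP.2 (g * h); first by left.
  right; apply: subgroupM => //; apply: (cC.2 _ g^-1) => //.
    by move: Pgh; rewrite !gE.
  exact: subgroupV.
- by right; exact: subgroupM.
Qed.

Lemma convex_residue P C : order_cone P -> convex P C -> residue (P `|` C) = C.
Proof.
move=> [cP aP] cC; rewrite predeqE => g; split=> [[[Pg|//] [Pg'|]]|Cg].
- by rewrite (aP g) //; exact: subgroup1 cC.1.
- exact: subgroupVE cC.1.
- by split; right=> //; exact: subgroupV cC.1 Cg.
Qed.

Lemma convex1 P : order_cone P -> convex P [set 1].
Proof.
move=> [cP aP]; split; first split=> //.
- by move=> x y -> ->; rewrite mulg1.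
- by move=> x ->; rewrite invg1.
- by move=> x y Px + yE; rewrite yE mulg1 => Px'; exact: aP.
Qed.

Definition precone_on C R :=
  (forall g h, C g -> C h -> R g -> R h -> R (g * h)) /\
  (forall g, C g -> R g \/ R g^-1).

Lemma precone_onT Q C : precone Q -> precone_on C Q.
Proof. by move=> cQ; split=> [g h _ _|g _]; [exact: cQ.1|exact: cQ.2]. Qed.

(** The order inside a convex subgroup C can be replaced without affecting the
    order of the cosets of C. *)
Lemma graft_precone P C R : precone P -> convex P C -> precone_on C R ->
  precone [set g | (C g /\ R g) \/ (~ C g /\ P g)].
Proof.
move=> cP cC [clR totR]; have sC := cC.1; have [clPC _] := convex_precone cP cC.
split=> [g h|g /=]; last first.
  have [Cg|nCg] := pselect (C g); last first.
    have nCg' : ~ C g^-1 by move=> /(subgroupVE sC).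
    by case: (cP.2 g); [left|right]; right.
  by case: (totR _ Cg) => Rg; [left|right]; left; split=> //; exact: subgroupV.
move=> [[Cg Rg]|[nCg Pg]] [[Ch Rh]|[nCh Ph]].
- by left; split; [exact: subgroupM|exact: clR].
- right; have nCgh : ~ C (g * h) by move=> /(subgroupMl sC Cg).
  by split=> //; case: (clPC g h) => //; [right|left].
- right; have nCgh : ~ C (g * h) by move=> /(subgroupMr sC Ch).
  by split=> //; case: (clPC g h) => //; [left|right].
- right; split; last exact: cP.1.
  by move=> Cgh; apply: nCg; apply: (cC.2 _ (g * h)) => //; rewrite !gE.
Qed.

(** By grafting, the part of F in a convex subgroup C determines the order that
    P induces on C. *)
Lemma determines_on F P C R : precone P -> determines F P -> convex P C ->
  precone_on C R -> (forall f, f \in F -> C f -> R f) ->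
  forall x, C x -> P x -> R x.
Proof.
move=> cP [FP dF] cC cR FR x Cx Px.
have [] := dF _ (graft_precone cP cC cR) _ x Px; last by case.
  move=> f fF; have [Cf|nCf] := pselect (C f); [left|right]; split=> //.
    exact: FR.
  exact: FP.
by case.
Qed.

(** If F had no element in the gap between C and a larger C', then reversing the
    order in that gap would give a second precone containing F. *)
Lemma determines_gap F P C C' : order_cone P -> determines F P ->
  convex P C -> convex P C' -> (exists2 g, C' g & ~ C g) ->
  exists2 f, f \in F & C' f /\ ~ C f.
Proof.
move=> oP dF cC cC' [g C'g nCg]; apply: contrapT => noF.
have FC f : f \in F -> C' f -> C f.
  by move=> fF C'f; apply: contrapT => nCf; apply: noF; exists f.
pose Q : set G := [set g | C g \/ P g^-1].
have cP := oP.1; have sC := cC.1.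
have cQ : precone Q.
  have [clQ totQ] := convex_precone cP cC; split=> [x y Qx Qy|x].
  - have PCV z : Q z -> (P `|` C) z^-1.
      by case=> ?; [right; exact: subgroupV|left].
    have := clQ _ _ (PCV _ Qy) (PCV _ Qx); rewrite -invgM => -[|Cyx]; first by right.
    by left; exact: (subgroupVE sC).
  - by case: (cP.2 x); [right; right; rewrite invgK|left; right].
have PQ := determines_on cP dF cC' (precone_onT C' cQ)
  (fun f fF C'f => or_introl (FC f fF C'f)).
have PC x : C' x -> P x -> C x.
  move=> Cx' Px; case: (PQ _ Cx' Px) => // Px'.
  by rewrite (oP.2 x) //; exact: subgroup1.
apply: nCg; case: (cP.2 g) => Pg; first exact: PC.
by apply: (subgroupVE sC); apply: PC => //; exact: subgroupV cC'.1 C'g.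
Qed.

Lemma convexT P : convex P setT. Proof. by do 2!split. Qed.

Lemma determines_proper F P C : order_cone P -> determines F P ->
  convex P C -> (exists g, ~ C g) -> exists2 f, f \in F & ~ C f.
Proof.
move=> oP dF cC [g nCg]; have [|f fF []] := determines_gap oP dF cC (@convexT P).
  by exists g.
by exists f.
Qed.

(** Each strict step of a descending chain loses an element of F. *)
Lemma no_decreasing_convex F P (C : nat -> set G) :
  order_cone P -> determines F P -> (forall n, convex P (C n)) ->
  (forall n, C n.+1 `<=` C n) -> ~ (forall n, exists2 x, C n x & ~ C n.+1 x).
Proof.
move=> oP dF cC sC strict; pose c n := count (fun f => `[< C n f >]) F.
have lec n : (c n.+1 < c n)%N.
  have [f fF [Cf nCf]] := determines_gap oP dF (cC n.+1) (cC n) (strict n).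
  rewrite /c; elim: (F) fF => [//|x s IH]; rewrite inE /= => /orP[/eqP <-|fs].
    rewrite (asboolT Cf) (asboolF nCf) add0n add1n ltnS.
    by apply: sub_count => y /asboolP Cy; apply/asboolP/sC.
  have := IH fs; have [Cx|nCx] := pselect (C n.+1 x).
    by rewrite (asboolT Cx) (asboolT (sC _ _ Cx)) ltn_add2l.
  by rewrite (asboolF nCx) add0n => /leq_trans; apply; exact: leq_addl.
have lecn n : (c n + n <= c 0)%N.
  elim: n => [|n IH]; first by rewrite addn0.
  by apply: leq_trans IH; rewrite addnS -addSn leq_add2r.
by have := lecn (c 0).+1; rewrite addnS ltnNge leq_addl.
Qed.

Definition maxconvex P D :=
  [/\ convex P D, exists g, ~ D g &
      forall C, convex P C -> C `<=` D \/ C = setT].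

(** The union of the proper convex subgroups is proper: these subgroups form a
    chain, so if their union were G, one of them would contain the finite set F.
    *)
Lemma exists_maxconvex F P : order_cone P -> determines F P ->
  (exists g : G, g <> 1) -> exists D, maxconvex P D.
Proof.
move=> oP dF [g0 g01]; have cP := oP.1.
pose proper C := convex P C /\ exists g, ~ C g.
have prop1 : proper [set 1] by split; [exact: convex1|exists g0].
pose U : set G := [set x | exists2 C, proper C & C x].
have two C D : proper C -> proper D -> exists2 E, proper E & C `<=` E /\ D `<=` E.
  move=> pC pD; have [CD|DC] := convex_sub cP pC.1 pD.1.
    by exists D => //; split=> // x.
  by exists C => //; split=> // x.
exists U; split.
- split; first split.
  + by exists [set 1].
  + move=> x y [C pC Cx] [D pD Dy]; have [E pE [CE DE]] := two _ _ pC pD.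
    by exists E; [exact: pE|exact: subgroupM pE.1.1 (CE _ Cx) (DE _ Dy)].
  + by move=> x [C pC Cx]; exists C => //; exact: subgroupV pC.1.1 Cx.
  + by move=> x y Px Pxy [C pC Cy]; exists C => //; exact: pC.1.2 Pxy Cy.
- apply: contrapT => /forallNP UT.
  have [C pC FC] : exists2 C, proper C & forall f, f \in F -> C f.
    have : forall f, f \in F -> U f by move=> f _; apply: contrapT; exact: UT.
    elim: (F) => [|f F' IH] FU; first by exists [set 1].
    have [|C pC CF'] := IH; first by move=> x xF; apply: FU; rewrite inE xF orbT.
    have [D pD Df] := FU f (mem_head _ _).
    have [E pE [CE DE]] := two _ _ pC pD; exists E => // x.
    by rewrite inE => /orP[/eqP->|/CF' /CE//]; exact: DE.
  by have [f /FC] := determines_proper oP dF pC.1 pC.2.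
- move=> C cC; have [[g nCg]|/forallNP CT] := pselect (exists g, ~ C g).
    by left=> x Cx; exists C => //; split=> //; exists g.
  by right; rewrite predeqE => x; split=> // _; apply: contrapT; exact: CT.
Qed.

Section Max.
Variables (P D : set G).
Hypotheses (oP : order_cone P) (mD : maxconvex P D).

Lemma maxconvex_full C x : convex P C -> C x -> ~ D x -> forall g, C g.
Proof.
move=> cC Cx nDx g; have [_ _ /(_ _ cC) [CD|->//]] := mD.
by case: nDx; exact: CD.
Qed.

(** The elements g for which T contains both the interval from 1 to g and the
    interval from 1 to g^-1 form a convex subgroup. It contains s, which is not
    in D, so it is G. *)
Lemma interval_full (T : set G) s : subgroup T -> P s -> ~ D s ->
  (forall u, P u -> le P u s -> T u) -> forall g, T g.
Proof.
move=> sT Ps nDs Ts; have cP := oP.1.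
pose W g := forall u, P u -> le P u g -> T u.
pose V : set G := [set g | W g /\ W g^-1].
have VT g : V g -> T g.
  move=> [Wg Wg']; have [Pg|Pg] := cP.2 g; first by apply: Wg => //; exact: le_refl.
  by apply: (subgroupVE sT); apply: Wg' => //; exact: le_refl.
have WM g h : V g -> W h -> W (g * h).
  move=> Vg Wh u Pu ugh; have [ug|gu] := le_total cP u g; first exact: Vg.1.
  rewrite -[u](mulVKg g); apply: subgroupM => //; first exact: VT.
  by apply: Wh => //; move: ugh; rewrite /le !gE.
have small g u : P g -> P u -> le P u g^-1 -> u = 1 /\ g = 1.
  rewrite /le => Pg Pu; rewrite -invgM => Pgu.
  have gu1 : g * u = 1 by apply: oP.2 => //; exact: cP.1.
  have ug : g^-1 = u by rewrite -[u](mulKg g) gu1 mulg1.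
  have g1 : g = 1 by apply: oP.2; rewrite // ug.
  by rewrite -ug g1 invg1.
have cV : convex P V.
  split; first split.
  - have W1 : W 1.
      by move=> u Pu; rewrite /le mulg1 => Pu'; rewrite (oP.2 u) //; exact: subgroup1.
    by split; rewrite ?invg1.
  - move=> x y Vx Vy; split; first by apply: WM Vx Vy.1.
    rewrite invgM; apply: WM Vx.2; split; first exact: Vy.2.
    by rewrite invgK; exact: Vy.1.
  - by move=> x [Wx Wx']; split; rewrite ?invgK.
  - move=> x y Px xy Vy; split=> u Pu; first by move=> ux; apply: Vy.1 => //; exact: le_trans ux xy.
    by move=> /(small _ _ Px Pu)[-> _]; exact: subgroup1.
have Vs : V s.
  split; first exact: Ts.
  by move=> u Pu /(small _ _ Ps Pu)[-> _]; exact: subgroup1.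
by move=> g; apply: VT; exact: maxconvex_full cV Vs nDs g.
Qed.

End Max.

(** The elements f with L contained in f L. Two translates of a lower set are
    always comparable, hence totality. *)
Lemma cut_precone Q (L : set G) : precone Q ->
  (forall g h, L h -> le Q g h -> L g) ->
  precone [set f | forall g, L g -> L (f^-1 * g)].
Proof.
move=> cQ lowL; split=> [f h Lf Lh g Lg /=|f].
  by rewrite invgM -mulgA; apply/Lh/Lf.
have [?|/existsNP[g /not_implyP[Lg nLg]]] :=
  pselect (forall g, L g -> L (f^-1 * g)); first by left.
right=> k Lk; rewrite invgK; apply: contrapT => nLfk; apply: nLg.
apply: (lowL _ k) => //; have [|gfk] := le_total cQ (f * k) g.
  by move=> /(lowL _ _ Lg).
by move: gfk; rewrite /le !gE.
Qed.

(** The same preorder seen from the point y instead of 1. *)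
Lemma point_precone Q y : precone Q -> precone [set f | le Q y (f * y)].
Proof.
move=> cQ; split=> [f h Qf Qh /=|f /=].
  apply: (le_trans cQ Qf); by rewrite -mulgA leM.
by have := le_total cQ y (f * y); rewrite -[le Q (f * y) y](leM _ f^-1) !gE.
Qed.

End Cones.

(** * Abelian normal subgroups acting on an ordered coset space *)

(** What virtual solvability says about each quotient of G: it is a torsion
    group or has a nontrivial abelian normal subgroup. *)
Definition has_abelian_layers (G : groupType) := 
  forall K : set G, subgroup K -> normal K ->
  (forall g, exists m, K (g ^+ m.+1)) \/
  exists A, [/\ subgroup A, normal A, exists2 a, A a & ~ K a &
                forall x y, A x -> A y -> K [~ x, y]].

Section Action.
Variables (G : groupType) (Q : set G).
Hypothesis cQ : precone Q.
Implicit Types (g h x y z a b c : G) (A : set G).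
Let D := residue Q.
Let sD : subgroup D := precone_residue cQ.

Local Notation "g <~ h" := (le Q g h) (at level 70).
Local Notation "g <! h" := (lt Q g h) (at level 70).

Let le_trans := @le_trans G Q cQ.
Let le_lt_trans := @le_lt_trans G Q cQ.
Let lt_le_trans := @lt_le_trans G Q cQ.
Let ltW := @ltW G Q cQ.

(** Throughout, elements of G stand for points of the ordered set G/D, on which
    G acts by left translation; this is equality of points. *)
Definition same g h := g <~ h /\ h <~ g.

Lemma same_residue g h : same g h <-> D (g^-1 * h).
Proof. by rewrite /same /le /D /residue /= invgM invgK. Qed.

Lemma same_refl g : same g g. Proof. by split; exact: le_refl. Qed.
Lemma same_sym g h : same g h -> same h g. Proof. by case. Qed.
Lemma same_trans h g k : same g h -> same h k -> same g k.
Proof. by move=> [gh hg] [hk kh]; split; [exact: le_trans hk|exact: le_trans hg]. Qed.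
Lemma sameM k g h : same (k * g) (k * h) <-> same g h.
Proof. by rewrite /same !leM. Qed.
Lemma same_leL g h k : same g h -> g <~ k -> h <~ k.
Proof. by move=> [_ hg] gk; exact: le_trans gk. Qed.
Lemma same_leR g h k : same g h -> k <~ g -> k <~ h.
Proof. by move=> [gh _] kg; exact: le_trans gh. Qed.

Lemma lt_total g h : ~ same g h -> g <! h \/ h <! g.
Proof.
move=> ngh; have [gh|hg] := pselect (h <~ g); last by left.
by right=> hg; apply: ngh; split.
Qed.

Lemma posX a n m : 1 <~ a -> a ^+ n <~ a ^+ (n + m).
Proof.
by move=> a1; rewrite expgnDr /le !gE; apply: preconeX => //; move: a1; rewrite /le !gE.
Qed.

Lemma posX_le a n m : 1 <~ a -> (n <= m)%N -> a ^+ n <~ a ^+ m.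
Proof. by move=> a1 nm; rewrite -(subnKC nm); exact: posX. Qed.

Lemma posX1 a n : 1 <~ a -> 1 <~ a ^+ n.
Proof. by move=> a1; rewrite -[1](expg0 a); exact: posX_le. Qed.

Lemma posXS a n : 1 <! a -> a ^+ n <! a ^+ n.+1.
Proof. by move=> a1; rewrite expgSr -{1}[a ^+ n]mulg1 ltM. Qed.

Lemma neg_pos a : 1 <~ a -> a^-1 <~ 1.
Proof. by rewrite /le !gE. Qed.

Lemma negXS a n : 1 <! a -> a ^- n.+1 <! a ^- n.
Proof. by move=> a1; rewrite expgS invgM /lt /le !gE; move: a1; rewrite /lt /le !gE. Qed.

Lemma negX_le a n m : 1 <~ a -> (n <= m)%N -> a ^- m <~ a ^- n.
Proof.
move=> a1 nm; rewrite -(subnK nm) expgnDr invgM /le !gE.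
by apply: preconeX => //; move: a1; rewrite /le !gE.
Qed.

Lemma negX1 a n : 1 <~ a -> a ^- n <~ 1.
Proof. by move=> a1; have := negX_le a1 (leq0n n); rewrite expg0 invg1. Qed.

(** A acts on G/D through an abelian group; one inequality is enough as a and b
    can be exchanged. *)
Definition abelian_action A :=
  forall a b, A a -> A b -> forall y, a * b * y <~ b * a * y.

Definition positive A a := A a /\ 1 <! a.

Section Abelian.
Variable A : set G.
Hypotheses (sA : subgroup A) (abA : abelian_action A).

Lemma ab_same a b y : A a -> A b -> same (a * b * y) (b * a * y).
Proof. by move=> Aa Ab; split; exact: abA. Qed.

Lemma ab_same1 a b : A a -> A b -> same (a * b) (b * a).
Proof. by move=> Aa Ab; have := ab_same 1 Aa Ab; rewrite !mulg1. Qed.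

Lemma ab_leMr a b c : A a -> A b -> A c -> a <~ b -> a * c <~ b * c.
Proof.
move=> Aa Ab Ac ab; apply: same_leL (ab_same1 Ac Aa) _.
by apply: same_leR (ab_same1 Ac Ab) _; rewrite leM.
Qed.

Lemma ab_leV a b : A a -> A b -> a <~ b -> b^-1 <~ a^-1.
Proof.
move=> Aa Ab ab; have Aa' := subgroupV sA Aa; have Ab' := subgroupV sA Ab.
have := ab_leMr Aa Ab (subgroupM sA Aa' Ab') ab.
rewrite !gE => /same_leR; apply.
by rewrite -mulgA -[X in same _ X](mulVKg b) !sameM; exact: ab_same1.
Qed.

Lemma ab_leX a b n : A a -> A b -> a <~ b -> a ^+ n <~ b ^+ n.
Proof.
move=> Aa Ab ab; elim: n => [|n IH]; first exact: le_refl.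
rewrite !expgSr; apply: (@le_trans (a ^+ n * b)); first by rewrite leM.
by apply: ab_leMr; rewrite //; exact: subgroupX.
Qed.

Lemma ab_XM b c n y : A b -> A c -> same ((b * c) ^+ n * y) (b ^+ n * c ^+ n * y).
Proof.
move=> Ab Ac; elim: n => [|n IH]; first by rewrite !expg0 !mul1g; exact: same_refl.
rewrite !expgS -!mulgA sameM.
apply: (@same_trans (c * (b ^+ n * (c ^+ n * y)))); first by rewrite sameM mulgA.
rewrite !mulgA -mulgA; apply: same_trans; last first.
  by apply: same_sym; rewrite -mulgA; exact: (same_refl (b ^+ n * c * (c ^+ n * y))).
by apply: ab_same => //; exact: subgroupX.
Qed.

Lemma ab_pos_cases a : A a -> [\/ positive A a, positive A a^-1 | D a].
Proof.
move=> Aa; have [Da|nDa] := pselect (D a); first by constructor 3.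
have [|a1|a1] := @lt_total 1 a; first by rewrite same_residue !gE.
  by constructor 1.
constructor 2; split; first exact: subgroupV.
by move: a1; rewrite /lt /le !gE.
Qed.

Lemma exists_positive : (exists2 a, A a & ~ D a) -> exists b, positive A b.
Proof.
move=> [a Aa nDa]; have [pa|pa|//] := ab_pos_cases Aa; first by exists a.
by exists a^-1.
Qed.

End Abelian.

(** D is the largest proper convex subgroup, in a form that mentions only the
    preorder. *)
Hypothesis maxD : forall V, subgroup V ->
  (forall x y, 1 <~ x -> x <~ y -> V y -> V x) ->
  forall x, V x -> ~ D x -> forall g, V g.

Definition bounded a := exists h, forall n, a ^+ n <~ h.
Definition archimedean A := forall b, positive A b ->
  forall h, exists n, h <! b ^+ n /\ b ^- n <! h.

Section NormalAbelian.
Variable A : set G.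
Hypotheses (sA : subgroup A) (nA : normal A) (abA : abelian_action A).
Hypothesis AnD : exists2 a, A a & ~ D a.

(** As A is normal, the convex hull of the A-orbit of 1 is a subgroup; it is
    convex and not contained in D. *)
Lemma hull_full h : exists a b, [/\ A a, A b, a <~ h & h <~ b].
Proof.
have [a0 Aa0 nDa0] := AnD.
pose V : set G := [set h | exists a b, [/\ A a, A b, a <~ h & h <~ b]].
have VA a : A a -> V a by move=> Aa; exists a, a; split=> //; exact: le_refl.
have transl g h' : V g -> V h' -> V (g * h').
  move=> [a [b [Aa Ab ag gb]]] [a' [b' [Aa' Ab' ah hb]]].
  exists (g * a' * g^-1 * a), (g * b' * g^-1 * b).
  split; [exact: subgroupM (nA _ _) _|exact: subgroupM (nA _ _) _| |].
    apply: (@le_trans (g * a' * g^-1 * g)); first by rewrite leM.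
    by rewrite mulgVK leM.
  apply: (@le_trans (g * b' * g^-1 * g)); last by rewrite leM.
  by rewrite mulgVK leM.
apply: (maxD _ _ (VA _ Aa0) nDa0) => [|x y x1 xy [a [b [Aa Ab ay yb]]]]; last first.
  by exists 1, b; split=> //; [exact: subgroup1|exact: le_trans xy yb].
split=> // [|g [a [b [Aa Ab ag gb]]]]; first by apply: VA; exact: subgroup1.
exists (g^-1 * b^-1 * g), (g^-1 * a^-1 * g).
by split; [apply: normalV => //; exact: subgroupV|apply: normalV => //; exact: subgroupV| |];
  [move: gb|move: ag]; rewrite /le !gE.
Qed.


Lemma unbounded_cofinal a : positive A a -> ~ bounded a ->
  forall h, exists n, h <~ a ^+ n /\ a ^- n <~ h.
Proof.
move=> [Aa a1] nba h; have a1' := ltW a1.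
have up g : exists n, g <~ a ^+ n.
  apply: contrapT => /forallNP na; apply: nba; exists g => n.
  exact/ltW/na.
have [b [_ [Ab _ bh _]]] := hull_full h.
have [n hn] := up h; have [m bm] := up b^-1; exists (n + m).
split; first exact: le_trans hn (posX _ _ a1').
apply: (@le_trans (a ^- m)); first by apply: negX_le => //; exact: leq_addl.
apply: le_trans bh; have := ab_leV sA abA (subgroupV sA Ab) (subgroupX _ sA Aa) bm.
by rewrite invgK.
Qed.

(** Supplied by isolation of the order, see [exists_unbounded]. *)
Hypothesis unb : forall B, subgroup B -> normal B -> abelian_action B ->
  (exists2 a, B a & ~ D a) -> exists2 b, positive B b & ~ bounded b.

(** The elements of A whose powers stay bounded form a normal subgroup B of G.
    It has no unbounded element, hence lies in D by [unb]. *)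
Lemma bounded_part b h : A b -> (forall n, b ^+ n <~ h /\ b ^- n <~ h) ->
  forall g, D (g * b * g^-1).
Proof.
have [a pa /(unbounded_cofinal pa) cof] := unb sA nA abA AnD.
have [Aa a1] := pa; have a1' := ltW a1.
pose B : set G := [set b | A b /\
  exists n, forall k, b ^+ k <~ a ^+ n /\ b ^- k <~ a ^+ n].
have key x y n m k : A x -> A y -> (x ^+ k <~ a ^+ n) -> (y ^+ k <~ a ^+ m) ->
    (x * y) ^+ k <~ a ^+ (n + m).
  move=> Ax Ay xn ym; have := ab_XM sA abA k 1 Ax Ay; rewrite !mulg1 => e.
  apply: same_leL (same_sym e) _.
  apply: (@le_trans (x ^+ k * a ^+ m)); first by rewrite leM.
  by rewrite expgnDr; apply: (ab_leMr abA); rewrite //; exact: subgroupX.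
have sB : subgroup B.
  split.
  - split; first exact: subgroup1.
    by exists 0 => k; rewrite expg1n invg1 expg0; split; exact: le_refl.
  - move=> x y [Ax [n xn]] [Ay [m ym]]; split; first exact: subgroupM.
    exists (n + m) => k; split; first exact: key (xn k).1 (ym k).1.
    have Ax' := subgroupV sA Ax; have Ay' := subgroupV sA Ay.
    rewrite -expVgn invgM addnC; apply: key => //; rewrite expVgn.
      exact: (ym k).2.
    exact: (xn k).2.
  - move=> x [Ax [n xn]]; split; first exact: subgroupV.
    by exists n => k; rewrite expVgn invgK; split; have [] := xn k.
have nB : normal B.
  move=> g x [Ax [n xn]]; split; first exact: nA.
  have [i [gi _]] := cof g^-1; have [j [gj _]] := cof (g * a ^+ (i + n)).
  have bd y : A y -> y <~ a ^+ n -> g * y * g^-1 <~ a ^+ j.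
    move=> Ay yn; apply: le_trans gj; rewrite -mulgA leM.
    apply: (@le_trans (y * a ^+ i)); first by rewrite leM.
    rewrite addnC expgnDr; apply: (ab_leMr abA) => //; exact: subgroupX.
  exists j => k; rewrite conj_expg; split; first by apply: bd; [exact: subgroupX|exact: (xn k).1].
  have -> : (g * x ^+ k * g^-1)^-1 = g * x ^- k * g^-1 by rewrite !gE.
  by apply: bd; [exact: subgroupV sA (subgroupX _ sA Ax)|exact: (xn k).2].
have BD : B `<=` D.
  apply: contrapT => /existsNP[c /not_implyP[Bc nDc]].
  have [] := unb sB nB _ _; first by move=> x y [Ax _] [Ay _]; exact: abA.
    by exists c.
  move=> d [[Ad [n dn]] _]; apply; exists (a ^+ n) => k; exact: (dn k).1.
move=> Ab bh g; apply/BD/nB; split=> //; have [n [hn _]] := cof h; exists n => k.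
by have [b1 b2] := bh k; split; exact: le_trans hn.
Qed.

Lemma abelian_trivial b : A b -> D b -> forall g, D (g * b * g^-1).
Proof.
move=> Ab Db; apply: (@bounded_part _ 1) => // n.
have /same_residue : D (1^-1 * b ^+ n) by rewrite !gE; exact: subgroupX.
have /same_residue : D (1^-1 * b ^- n) by rewrite !gE; exact: subgroupV sD (subgroupX _ sD Db).
by move=> [_ ?] [_ ?].
Qed.

(** A positive element with bounded powers would be in D by [bounded_part]. *)
Lemma abelian_archimedean : archimedean A.
Proof.
move=> b pb h; have [Ab b1] := pb; have b1' := ltW b1.
have nb : ~ bounded b.
  move=> [k bk]; have := bounded_part (h := k) Ab _ 1; rewrite !gE => Db.
  apply: (b1); have /same_residue [_ //] : D (1^-1 * b).
  rewrite !gE; apply: Db => n; split=> //.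
  by apply: le_trans (bk 0); rewrite expg0; exact: negX1.
have [n [hn nh]] := unbounded_cofinal pb nb h; exists n.+1; split.
  exact: le_lt_trans hn (posXS b1).
exact: lt_le_trans (negXS b1) nh.
Qed.

(** If a moved the point g^-1 down, all its powers would keep that point down,
    whereas the powers of a are cofinal. *)
Lemma positive_conj a g : positive A a -> positive A (g * a * g^-1).
Proof.
move=> pa; have [Aa a1] := pa; have a1' := ltW a1.
split; first exact: nA.
move=> ga; have {}ga : a * g^-1 <~ g^-1 by rewrite -(leM _ g) !gE.
have down n : a ^+ n * g^-1 <~ g^-1.
  elim: n => [|n IH]; first by rewrite expg0 mul1g; exact: le_refl.
  by rewrite expgSr; apply: le_trans IH; rewrite -mulgA leM.
have [m [_ gm]] := abelian_archimedean pa g^-1.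
have [n [gn _]] := abelian_archimedean pa g^-1.
apply: (gn); apply: le_trans (down (n + m)).
rewrite expgnDr -mulgA -{1}[a ^+ n]mulg1 leM.
by rewrite -(leM _ (a ^- m)) mulKg mulg1; exact/ltW.
Qed.

Definition center_action : set G :=
  [set z | forall g y, same (g * z * y) (z * g * y)].

Lemma center_subgroup : subgroup center_action.
Proof.
split.
- by move=> g y; rewrite !gE; exact: same_refl.
- move=> x z cx cz g y /=; have := cx g (z * y); have := cz g y.
  rewrite -!mulgA => e1; rewrite !mulgA => e2; apply: same_trans e2 _.
  by rewrite -!mulgA sameM !mulgA -mulgA in e1 *.
- move=> x cx g y /=; have := cx g (x^-1 * y); rewrite -!mulgA mulVKg => e.
  by rewrite -(sameM x) !gE; apply: same_sym; rewrite -!mulgA.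
Qed.


(** For a above 1: no element of U lies strictly between a^-1 and a. *)
Definition avoids (U : seq G) a := forall u, u \in U -> (1 <~ u -> a <~ u) /\ (u <~ 1 -> u <~ a^-1).

(** The A-orbit of 1 meets every interval between a^-1 y and y: descend along
    the powers of a from an orbit point above y. *)
Lemma straddle a y : positive A a ->
  exists c, [/\ A c, c <~ y & y <! a * c].
Proof.
move=> pa; have [Aa a1] := pa.
have [n [_ /ltW ny]] := abelian_archimedean pa y.
have [m [my _]] := abelian_archimedean pa y.
have {my} : y <! a ^+ (n + m) * a ^- n.
  suff -> : a ^+ (n + m) * a ^- n = a ^+ m by [].
  by rewrite addnC expgnDr !gE.
elim: (n + m) => [|k IH].
  by rewrite expg0 mul1g => h; case: (h); exact: ny.
have [le_y|/lt_nle y_lt] := pselect (a ^+ k * a ^- n <~ y); last by move=> _; exact: IH.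
exists (a ^+ k * a ^- n); split=> //.
  exact: (subgroupM sA (subgroupX _ sA Aa) (subgroupV sA (subgroupX _ sA Aa))).
by rewrite mulgA -expgS.
Qed.

Section Dense.
Hypothesis dense : forall a, positive A a -> exists2 c, positive A c & c <! a.

Lemma dense_half a : positive A a -> exists2 c, positive A c & c * c <~ a.
Proof.
move=> pa; have [c pc ca] := dense pa; have [Aa _] := pa; have [Ac c1] := pc.
have [cca|acc] := le_total cQ (c * c) a; first by exists c.
have pc' : positive A (c^-1 * a).
  split; first exact: subgroupM (subgroupV sA Ac) Aa.
  by rewrite -(ltM _ c) mulg1 mulVKg.
exists (c^-1 * a) => //.
have c'c : c^-1 * a <~ c by rewrite -(leM _ c) mulVKg.
have [Ac' _] := pc'.
apply: (@le_trans (c^-1 * a * c)); first by rewrite leM.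
have := (@ab_same1 A abA c (c^-1 * a) Ac Ac').
by rewrite mulVKg => -[].
Qed.

(** The elements that are infinitesimal with respect to A form a convex
    subgroup, by [dense_half] and [positive_conj]. It is proper, so it lies in
    D. *)
Lemma dense_small u : ~ D u ->
  exists2 a, positive A a & (1 <~ u -> a <~ u) /\ (u <~ 1 -> u <~ a^-1).
Proof.
move=> nDu; pose W : set G :=
  [set g | forall a, positive A a -> g <! a /\ a^-1 <! g].
have [a0 pa0 _] := unb sA nA abA AnD.
have nWa g : ~ (forall h, W h).
  by move=> /(_ a0 _ pa0)[+ _]; apply; exact: le_refl.
have cW : ~ W u.
  move=> Wu; apply: (nWa 1); apply: (maxD _ _ Wu nDu).
    split.
    - move=> a [Aa a1]; split=> //; move: a1; by rewrite /lt /le !gE.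
    - move=> g h Wg Wh a pa; have [c pc cca] := dense_half pa.
      have pc' : positive A (g^-1 * c * g) by have := positive_conj g^-1 pc; rewrite invgK.
      have [gc cg] := Wg _ pc; have [hc ch] := Wh _ pc'; split.
        apply: (lt_le_trans _ cca); apply: (@le_lt_trans (c * g)); last by rewrite ltM.
        by have := ltW hc; rewrite -(leM _ g) -!mulgA mulVKg.
      apply: (@le_lt_trans (c^-1 * c^-1)).
        rewrite -invgM; exact: (ab_leV sA abA (subgroupM sA pc.1 pc.1) pa.1 cca).
      apply: (@lt_le_trans (c^-1 * g)); first by rewrite ltM.
      have := ltW ch; rewrite -(leM _ g) => h1; apply: le_trans h1.
      by rewrite !invgM !invgK !mulgA mulgV mul1g; exact: le_refl.
    - move=> g Wg a pa; have [gc cg] := Wg _ (positive_conj g pa); split.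
        move: cg; rewrite -(ltM _ (a * g^-1)) /lt /le !gE.
        by [].
      move: gc; rewrite -(ltM _ (a^-1 * g^-1)) /lt /le !gE.
      by [].
  move=> x y x1 xy Wy a pa; have [ya ay] := Wy _ pa; split; first exact: le_lt_trans xy ya.
  apply: lt_le_trans x1; have [_] := pa; by rewrite /lt /le !gE.
have /existsNP[a /not_implyP[pa /not_andP na]] := cW.
have [_ a1] := pa; exists a => //; case: na => /contrapT ua; split=> // u1.
  by case: (a1); exact: le_trans ua u1.
by case: (a1); have := le_trans u1 ua; rewrite /le !gE.
Qed.

Lemma dense_avoids (U : seq G) : (forall u, u \in U -> ~ D u) ->
  exists2 s, positive A s & avoids U s.
Proof.
elim: U => [|u U IH] UD.
  by have [a pa _] := unb sA nA abA AnD; exists a.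
have [|s ps sU] := IH; first by move=> v vU; apply: UD; rewrite inE vU orbT.
have [a pa [ua au]] := dense_small (UD u (mem_head _ _)).
have [As s1] := ps; have [Aa a1] := pa.
have [sa|as_] := le_total cQ s a.
  exists s => // v; rewrite inE => /orP[/eqP ->|/sU //].
  split=> [/ua|/au] H; first exact: le_trans sa H.
  exact: le_trans H (ab_leV sA abA As Aa sa).
exists a => // v; rewrite inE => /orP[/eqP -> //|/sU[H1 H2]].
split=> [/H1|/H2] H; first exact: le_trans as_ H.
exact: le_trans H (ab_leV sA abA Aa As as_).
Qed.

(** Small elements of A normalize D by assumption, and they generate A by
    [abelian_archimedean]. So D fixes each point of the A-orbit of 1. This orbit
    is dense in G/D, and an order-preserving map that fixes a dense set is the
    identity. *)
Lemma dense_trivial (U : seq G) : (forall u, u \in U -> ~ D u) ->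
  (forall a, A a -> 1 <~ a -> avoids U a ->
     forall d, D d -> D (a^-1 * d * a) /\ D (a * d * a^-1)) ->
  forall d, D d -> forall g, D (g * d * g^-1).
Proof.
move=> UD fixU; have [s ps sU] := dense_avoids UD; have [As s1] := ps.
pose T a := A a /\ forall d, D d -> D (a^-1 * d * a) /\ D (a * d * a^-1).
have TM a b : T a -> T b -> T (a * b).
  move=> [Aa Ta] [Ab Tb]; split=> [|d Dd]; first exact: subgroupM.
  have [/Tb[D1 _] _] := Ta d Dd; have [_ /Ta[_ D2]] := Tb d Dd.
  by move: D1 D2; rewrite !gE.
have TV a : T a -> T a^-1.
  move=> [Aa Ta]; split=> [|d /Ta[]]; first exact: subgroupV.
  by rewrite invgK.
have Tsmall a : positive A a -> a <~ s -> T a.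
  move=> [Aa a1] as_; split=> //; apply: fixU => //; first exact: ltW.
  move=> u /sU[H1 H2]; split=> [/H1|/H2] H; first exact: le_trans as_ H.
  exact: le_trans H (ab_leV sA abA Aa As as_).
have Tpow n a : positive A a -> a <~ s ^+ n -> T a.
  elim: n a => [|n IH] a pa; first by rewrite expg0; case: pa => _ a1 /a1.
  have [as_ _|/lt_nle sa] := pselect (a <~ s); first exact: Tsmall.
  move=> an; rewrite -[a](mulVKg s); apply: TM; first by apply: Tsmall => //; exact: le_refl.
  apply: IH; last by rewrite -(leM _ s) mulVKg -expgS.
  have [Aa _] := pa; split; first exact: subgroupM (subgroupV sA As) Aa.
  by rewrite -(ltM _ s) mulVKg mulg1.
have Tpos a : positive A a -> T a.
  by move=> pa; have [n [/ltW an _]] := abelian_archimedean ps a; exact: Tpow an.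
have TA a : A a -> T a.
  move=> Aa; have [pa|pa|Da] := ab_pos_cases sA Aa; first exact: Tpos.
    by rewrite -[a]invgK; apply/TV/Tpos.
  split=> // d Dd; split; apply: subgroupM => //; try exact: subgroupV;
    apply: subgroupM => //; exact: subgroupV.
move=> d Dd g; rewrite -[g]invgK; move: g^-1 => {}g; rewrite invgK.
have main e : D e -> g <! e * g -> False.
  move=> De ge; pose u := g^-1 * (e * g).
  have u1 : 1 <! u by rewrite -(ltM _ g) mulg1 mulVKg.
  have nDu : ~ D u by move=> [_]; move: u1; rewrite /lt /le !gE.
  have [a pa [/(_ (ltW u1)) au _]] := dense_small nDu.
  have pb := positive_conj g pa; have [Ab _] := pb.
  have [c [Ac cg gc]] := straddle g pb.
  have bg : g * a * g^-1 * c <~ e * g.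
    apply: (@le_trans (g * a * g^-1 * g)); first by rewrite leM.
    by rewrite mulgVK; move: au; rewrite -(leM _ g) mulVKg.
  have [_ /(_ _ (subgroupV sD De))[De' _]] := TA _ (subgroupM sA Ab Ac).
  set w := g * a * g^-1 * c in De' bg gc.
  apply: (gc); have {}bg : e^-1 * w <~ g by rewrite -(leM _ e) mulVKg.
  apply: le_trans bg; have [] // : same w (e^-1 * w) by rewrite same_residue mulgA.
have [/same_residue|/lt_total[|lt]] := pselect (same g (d * g)).
- by rewrite mulgA.
- by move=> /main [].
- case: (@main d^-1); first exact: subgroupV.
  by rewrite -(ltM _ d) mulVKg.
Qed.

End Dense.

(** Conjugation preserves positivity in A, so it fixes the least positive
    element a0 up to elements acting trivially; and up to such elements A is
    generated by a0. *)
Lemma discrete_central a0 : positive A a0 -> (forall c, positive A c -> a0 <~ c) ->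
  forall a, A a -> forall g y, same (g * a * y) (a * g * y).
Proof.
move=> p0 min0; have [A0 a01] := p0.
have triv k g y : A k -> D k -> same (g * k * y) (g * y).
  move=> Ak Dk; rewrite -mulgA sameM; apply/same_sym; rewrite same_residue mulgA.
  by have := abelian_trivial Ak Dk y^-1; rewrite invgK.
have c0 g y : same (g * a0 * y) (a0 * g * y).
  pose k := a0^-1 * (g * a0 * g^-1).
  have Ak : A k by apply: (subgroupM sA); [exact: subgroupV|exact: nA].
  have Dk : D k.
    apply/same_residue; split; first exact: min0 (positive_conj g p0).
    apply: contrapT => /lt_nle lt0.
    have pk : positive A k by split=> //; rewrite -(ltM _ a0) mulg1 mulVKg.
    have [Ak' k1] := positive_conj g^-1 pk.
    have /min0 := positive_conj g^-1 p0.
    by move: k1; rewrite /k /lt /le !gE.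
  by have := triv k a0 (g * y) Ak Dk; rewrite /k !gE.
pose Z := center_action.
have cZ k : A k -> D k -> Z k.
  move=> Ak Dk g y /=; apply: (same_trans (triv _ _ _ Ak Dk)); apply: same_sym.
  by have := triv k 1 (g * y) Ak Dk; rewrite !gE.
have c0Z : Z a0 by move=> g y; exact: c0.
have Zpow n a : positive A a -> a <~ a0 ^+ n -> Z a.
  elim: n a => [|n IH] a pa; first by rewrite expg0; case: pa => _ a1 /a1.
  move=> an; have [Aa a1] := pa; pose k := a0^-1 * a.
  have Ak : A k by apply: (subgroupM sA) => //; exact: subgroupV.
  have kn : k <~ a0 ^+ n by rewrite -(leM _ a0) mulVKg -expgS.
  rewrite -[a](mulVKg a0); apply: (subgroupM center_subgroup) => //.
  have [Dk|nDk] := pselect (D k); first exact: cZ.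
  apply: IH => //; split=> // k1; apply: nDk; rewrite -[k]mul1g -[1]invg1; apply/same_residue.
  by split=> //; rewrite -(leM _ a0) mulVKg mulg1; exact: min0.
have Zpos a : positive A a -> Z a.
  by move=> pa; have [n [/ltW an _]] := abelian_archimedean p0 a; exact: Zpow an.
move=> a Aa; have [pa|pa|Da] := ab_pos_cases sA Aa.
- exact: Zpos.
- by rewrite -[a]invgK; apply: (subgroupV center_subgroup); exact: Zpos.
- exact: cZ.
Qed.


End NormalAbelian.

Lemma center_normal : normal center_action.
Proof.
move=> h z cz g y; have e := cz (h^-1 * g * h) (h^-1 * y).
by rewrite -(sameM h) in e; move: e; rewrite !gE.
Qed.

Lemma center_abelian : abelian_action center_action.
Proof. by move=> a b _ cb y; have [] := cb a y. Qed.

Definition kernel : set G := [set k | forall g, D (g * k * g^-1)].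

Lemma kernel_subgroup : subgroup kernel.
Proof.
split=> [g|x y Kx Ky g|x Kx g]; rewrite ?gE; first exact: subgroup1.
  have -> : g * x * y * g^-1 = g * x * g^-1 * (g * y * g^-1) by rewrite !gE.
  exact: subgroupM.
have -> : g * x^-1 * g^-1 = (g * x * g^-1)^-1 by rewrite !gE.
exact: subgroupV.
Qed.

Lemma kernel_normal : normal kernel.
Proof. by move=> h k Kk g; have := Kk (g * h); rewrite !gE. Qed.

Lemma kernel_same k g y : kernel k -> same (g * k * y) (g * y).
Proof.
move=> Kk; rewrite -mulgA sameM; apply/same_sym; rewrite same_residue mulgA.
by have := Kk y^-1; rewrite invgK.
Qed.

Lemma abelian_mod_kernel A :
  (forall x y, A x -> A y -> kernel [~ x, y]) -> abelian_action A.
Proof.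
move=> cA a b Aa Ab y; have [+ _] := kernel_same (b * a) y (cA _ _ Aa Ab).
by rewrite /commg /conjg !gE.
Qed.

Section Solvable.
Hypothesis unb : forall B, subgroup B -> normal B -> abelian_action B ->
  (exists2 a, B a & ~ D a) -> exists2 b, positive B b & ~ bounded b.
Variable U : seq G.
Hypothesis UD : forall u, u \in U -> ~ D u.
(** Supplied by isolation of the order, with U made from the determining set,
    see [small_normalizes]. *)
Hypothesis fixU : forall A, subgroup A -> normal A -> abelian_action A ->
  forall a, A a -> 1 <~ a -> avoids U a ->
  forall d, D d -> D (a^-1 * d * a) /\ D (a * d * a^-1).

Lemma abelian_dichotomy A : subgroup A -> normal A -> abelian_action A ->
  (exists2 a, A a & ~ D a) ->
  D `<=` kernel \/ exists2 a0, positive A a0 & A `<=` center_action.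
Proof.
move=> sA nA abA AnD.
have [[a0 p0 min0]|nomin] := pselect (exists2 a0, positive A a0 &
    forall c, positive A c -> a0 <~ c).
  right; exists a0 => // a Aa g y.
  exact: (discrete_central sA nA abA AnD unb p0 min0 Aa).
left=> d Dd g; apply: (dense_trivial sA nA abA AnD unb _ UD) => //.
  move=> a pa; apply: contrapT => nc; apply: nomin; exists a => // c pc.
  by apply: contrapT => /lt_nle ca; apply: nc; exists c.
by move=> a Aa a1 aU; exact: (fixU sA nA abA Aa a1 aU).
Qed.

Hypothesis series : has_abelian_layers G.
Hypothesis DX : forall g m, D (g ^+ m.+1) -> D g.
Hypothesis DT : exists g, ~ D g.

Lemma not_sub_stab A : normal A -> (exists2 a, A a & ~ kernel a) ->
  exists2 a, A a & ~ D a.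
Proof.
move=> nA [a Aa /existsNP[g nD]]; exists (g * a * g^-1) => //; exact: nA.
Qed.

(** Take A normal in G, not in the kernel of the action, and abelian modulo the
    kernel. If A has no least positive element, then [dense_trivial] concludes.
    Otherwise A is central, so the center Z of the action is not trivial and
    contains cofinal elements. Now take B normal, not in Z, and abelian modulo
    Z. For b, c in B the commutator k = [b, c] is central, so moving b across
    c^m produces k^m. But b commutes with Z, whose orbit of 1 is cofinal, so b
    moves no point further than some w in Z does, and k^m <= w^2 for all m.
    Hence k acts trivially: B is abelian modulo the kernel, and it is not
    central, so the dense case applies to B. *)
Lemma stabilizer_sub_kernel : D `<=` kernel.
Proof.
have [pow|[A [sA nA AnK cA]]] := series kernel_subgroup kernel_normal.
  have [g nDg] := DT; have [m Km] := pow g.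
  by case: nDg; apply: (DX (m := m)); have := Km 1; rewrite !gE.
have abA := abelian_mod_kernel cA.
have [//|[a0 p0 AZ]] := abelian_dichotomy sA nA abA (not_sub_stab nA AnK).
have [A0 a01] := p0; have Z0 := AZ _ A0; have pZ0 : positive center_action a0 by [].
have sZ := center_subgroup; have nZ := center_normal; have abZ := center_abelian.
have nD1 a : 1 <! a -> ~ D a.
  by move=> a1 [_ Da]; apply: a1; rewrite /le mulg1.
have ZnD : exists2 a, center_action a & ~ D a by exists a0 => //; exact: nD1.
have archZ := abelian_archimedean sZ nZ abZ ZnD unb.
have [pow|[B [sB nB BnZ cB]]] := series sZ nZ.
  move=> d Dd g; have [m Zm] := pow d; apply: (DX (m := m)).
  rewrite conj_expg.
  exact: (abelian_trivial sZ nZ abZ ZnD unb Zm (subgroupX _ sD Dd)).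
have KZ : kernel `<=` center_action.
  move=> k Kk g y; apply: (same_trans (kernel_same _ _ Kk)); apply: same_sym.
  by have := kernel_same 1 (g * y) Kk; rewrite !gE.
have ZK z : center_action z -> D z -> kernel z.
  by move=> Zz Dz g; exact: abelian_trivial Zz Dz g.
have npos b c : B b -> B c -> ~ 1 <! [~ b, c].
  move=> Bb Bc; have Zk := cB _ _ Bb Bc.
  have bck y : b * c * y = c * b * [~ b, c] * y by rewrite /commg /conjg !gE.
  move: [~ b, c] Zk bck => k Zk bck k1.
  have [n0 [/ltW bn /ltW nb]] := archZ _ pZ0 b; set w := a0 ^+ n0.+1.
  have Zw : center_action w := subgroupX _ sZ Z0.
  have ZX n : center_action (a0 ^+ n) := subgroupX n sZ Z0.
  (* b moves no point by more than w: compare it with b at a nearby orbit point *)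
  have bw y : b * y <~ w * y /\ w^-1 * y <~ b * y.
    have [e [Ze ey /ltW ye]] := straddle sZ nZ abZ ZnD unb y pZ0.
    have comm z : center_action z -> same (b * z) (z * b).
      by move=> Zz; have := Zz b 1; rewrite !mulg1.
    have Zae := subgroupM sZ Z0 Ze; split.
      apply: (@le_trans (b * (a0 * e))); first by rewrite leM.
      apply: same_leL (same_sym (comm _ Zae)) _.
      apply: (@le_trans (a0 * e * a0 ^+ n0)); first by rewrite leM.
      have [+ _] := @ab_same1 _ abZ _ _ Zae (ZX n0) => /le_trans; apply.
      by rewrite mulgA -expgSr leM.
    apply: (@le_trans (b * e)); last by rewrite leM.
    apply: same_leR (same_sym (comm _ Ze)) _.
    apply: (@le_trans (e * a0 ^- n0)); last by rewrite leM.
    have [_ +] := @ab_same1 _ abZ _ _ Ze (subgroupV sZ (ZX n0)).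
    apply: le_trans; apply: (@le_trans (w^-1 * (a0 * e))); first by rewrite leM.
    by rewrite /w expgS; rewrite !gE; exact: le_refl.
  have conjX m y : same (b * c ^+ m * y) (c ^+ m * k ^+ m * b * y).
    elim: m y => [|m IH] y; first by rewrite !expg0 !gE; exact: same_refl.
    have Zkm : center_action (k ^+ m) := subgroupX m sZ Zk.
    have -> : b * c ^+ m.+1 * y = c * (b * k * (c ^+ m * y)).
      by rewrite expgS !mulgA bck.
    have -> : c ^+ m.+1 * k ^+ m.+1 * b * y = c * (c ^+ m * k * (k ^+ m * b * y)).
      by rewrite !expgS !mulgA.
    rewrite sameM; apply: (same_trans (Zk _ _)).
    apply: same_trans (same_sym (Zk _ _)).
    by rewrite -!mulgA sameM !mulgA; exact: IH.
  have kw m : k ^+ m <~ w * w.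
    have Zkm : center_action (k ^+ m) := subgroupX m sZ Zk.
    have [h1 h2] := conjX m 1; have [h3 _] := bw (c ^+ m).
    have kb : k ^+ m * b <~ w.
      rewrite -(leM _ (c ^+ m)) mulgA -[X in X <~ _]mulg1; apply: le_trans h2 _.
      rewrite mulg1; apply: le_trans h3 _.
      by have [_] := Zw (c ^+ m) 1; rewrite !mulg1.
    have kw1 : k ^+ m * w^-1 <~ w.
      apply: le_trans kb; rewrite leM; have [_] := bw 1; by rewrite !mulg1.
    have [_] := Zkm w w^-1; rewrite -mulgA mulgV mulg1 => h; apply: (le_trans h).
    by rewrite -mulgA leM.
  by have [n [kn _]] := archZ k (conj Zk k1) (w * w); exact: kn (kw n).
have abB : abelian_action B.
  apply: abelian_mod_kernel => b c Bb Bc; have Zk := cB _ _ Bb Bc; apply: ZK => //.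
  have [[_ k1]|[_ k1]|//] := ab_pos_cases sZ Zk; first by case: (npos _ _ Bb Bc).
  by move: k1; rewrite invgR => /npos [].
have BnK : exists2 a, B a & ~ kernel a by have [b Bb nZb] := BnZ; exists b => // /KZ.
have [//|[_ _ BZ]] := abelian_dichotomy sB nB abB (not_sub_stab nB BnK).
by have [b /BZ] := BnZ.
Qed.

End Solvable.
End Action.

(** * The largest proper convex subgroup is normal *)

Section Isolated.
Variables (G : groupType) (P D : set G) (F : seq G).
Hypotheses (oP : order_cone P) (dF : determines F P) (mD : maxconvex P D).
Implicit Types (f g h x y z a b c d u : G) (A : set G).

Let Q := P `|` D.
Let cP : precone P := oP.1.
Let cD : convex P D. Proof. by case: mD. Qed.
Let sD : subgroup D := cD.1.
Let cQ : precone Q := convex_precone cP cD.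
Let resQ : residue Q = D := convex_residue oP cD.

Local Notation "g <~ h" := (le Q g h) (at level 70).
Local Notation "g <! h" := (lt Q g h) (at level 70).

Let le_trans := @le_trans G Q cQ.
Let le_lt_trans := @le_lt_trans G Q cQ.
Let lt_le_trans := @lt_le_trans G Q cQ.
Let ltW := @ltW G Q cQ.

Lemma maxconvex_act V : subgroup V ->
  (forall x y, 1 <~ x -> x <~ y -> V y -> V x) ->
  forall x, V x -> ~ residue Q x -> forall g, V g.
Proof.
move=> sV cV x Vx nDx; apply: (maxconvex_full mD _ Vx); last by rewrite -resQ.
split=> // y z Py Pyz; apply: cV; first by rewrite /le !gE; left.
by left.
Qed.

Lemma out_lt f : P f -> ~ D f -> 1 <! f.
Proof.
move=> Pf nDf; rewrite /lt /le mulg1 => Qf'; apply: nDf; rewrite -resQ.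
by split=> //; left.
Qed.

(** The residue of R is convex, and D is the largest proper convex subgroup. *)
Lemma residue_dichotomy R : precone R -> (forall f, f \in F -> R f) ->
  residue R `<=` D \/ forall g, R g.
Proof.
move=> cR FR; have cvR := residue_convex cR (dF.2 _ cR FR).
have [_ _ /(_ _ cvR) [|e]] := mD; first by left.
by right=> g; have [] : residue R g by rewrite e.
Qed.

(** The preorder based at the point y has residue y D y^-1. *)
Lemma base_point y : (forall f, f \in F -> y <~ f * y) ->
  forall d, D d -> D (y * d * y^-1).
Proof.
move=> Fy d Dd; have [RD|RT] := residue_dichotomy (point_precone y cQ) Fy.
  apply: RD; rewrite /residue /= /le !gE.
  by split; right=> //; exact: subgroupV.
have [_ [g nDg] _] := mD; case: nDg; rewrite -resQ.
have H k : Q (y^-1 * k * y) by have := RT k; rewrite /= /le mulgA.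
have := H (y * g * y^-1); have := H (y * g^-1 * y^-1); rewrite !gE => h1 h2.
by split.
Qed.

Section Tame.
Variable E : seq G.
Hypothesis ED : forall g, g \in E -> D g.
(** The induction hypothesis for D: every order of D comes from the given one by
    conjugation with an element of a finite list and possibly reversal. *)
Hypothesis conjE : forall R, precone_on D R -> exists2 g, g \in E &
  (forall x, D x -> P x -> R (g^-1 * x * g)) \/
  (forall x, D x -> P x -> R (g^-1 * x^-1 * g)).

(** When a avoids these, the elements of F outside D still move the points g a
    and g a^-1 upwards, for g = 1 and for g in E. *)
Definition obstacles : seq G :=
  [seq g^-1 * f | g <- 1 :: E, f <- [seq f <- F | `[< ~ D f >]]] ++
  [seq g^-1 * f^-1 | g <- 1 :: E, f <- [seq f <- F | `[< ~ D f >]]].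

Let E1D g : g \in 1 :: E -> D g.
Proof. by rewrite inE => /orP[/eqP->|/ED//]; exact: subgroup1. Qed.

Lemma obstacles_out u : u \in obstacles -> ~ residue Q u.
Proof.
rewrite resQ mem_cat => /orP[] /allpairsP[[g f] /= [gE]];
  rewrite mem_filter => /andP[/asboolP nDf _] -> Du; apply: nDf.
  by apply: subgroupMl Du => //; apply: subgroupV => //; exact: E1D.
apply: (subgroupVE sD).
by apply: subgroupMl Du => //; apply: subgroupV => //; exact: E1D.
Qed.

Lemma avoids_near a g f : avoids Q obstacles a -> g \in 1 :: E -> f \in F -> ~ D f ->
  g * a <~ f /\ f^-1 <~ g * a^-1.
Proof.
move=> aU gE1 fF nDf; have Dg := E1D gE1.
have pf := out_lt (dF.1 _ fF) nDf.
have mem : f \in [seq f <- F | `[< ~ D f >]].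
  by rewrite mem_filter fF andbT; apply/asboolP.
have g1 : same Q g 1.
  by apply/same_residue; rewrite resQ mulg1; exact: subgroupV.
have [up _] : (1 <~ g^-1 * f -> a <~ g^-1 * f) /\ (g^-1 * f <~ 1 -> g^-1 * f <~ a^-1).
  by apply: aU; rewrite mem_cat; apply/orP; left; apply/allpairsP; exists (g, f).
have [_ dn] : (1 <~ g^-1 * f^-1 -> a <~ g^-1 * f^-1) /\
    (g^-1 * f^-1 <~ 1 -> g^-1 * f^-1 <~ a^-1).
  by apply: aU; rewrite mem_cat; apply/orP; right; apply/allpairsP; exists (g, f).
split.
  rewrite -(leM _ g^-1) mulKg; apply: up; rewrite -(leM _ g) mulg1 mulVKg.
  by have [h _] := g1; exact: le_trans h (ltW pf).
rewrite -(leM _ g^-1) mulKg; apply: dn; rewrite -(leM _ g) mulg1 mulVKg.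
have [_ h] := g1; apply: le_trans h; have := ltW pf; by rewrite /le !gE.
Qed.

(** Look at D with the order based at the point a. By [conjE] it is conjugate to
    the given order of D or to its reverse. In the first case every element of F
    in D moves the point g a upwards, for some g in E. So do the elements of F
    outside D, because a is small, and [base_point] applies to g a. In the
    second case use g a^-1: since A acts commutatively, passing to inverses
    reverses inequalities. *)
Lemma small_normalizes A : subgroup A -> normal A -> abelian_action Q A ->
  forall a, A a -> 1 <~ a -> avoids Q obstacles a ->
  forall d, D d -> D (a^-1 * d * a) /\ D (a * d * a^-1).
Proof.
move=> sA nA abA a Aa a1 aU.
(* an element of A moves 1 to a point fixed by D iff its inverse does *)
have swap x d : A x -> D d -> D (x * d * x^-1) -> D (x^-1 * d^-1 * x).
  move=> Ax Dd Dx; pose c := d * x * d^-1.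
  have Ac : A c by exact: nA.
  have Dxc : D (x * c^-1) by rewrite /c !gE; apply: subgroupM => //; exact: subgroupV.
  have [h1 h2] := @ab_same1 G Q A abA x c^-1 Ax (subgroupV sA Ac).
  have : D (c^-1 * x).
    have /same_residue : same Q (x * c^-1) (c^-1 * x) by [].
    by rewrite resQ => /(subgroupMl sD (subgroupV sD Dxc)).
  have -> : c^-1 * x = d * (x^-1 * d^-1 * x) by rewrite /c !gE.
  exact: subgroupMl sD Dd.
have fin x : A x -> (forall d, D d -> D (x * d * x^-1)) ->
    forall d, D d -> D (x^-1 * d * x) /\ D (x * d * x^-1).
  move=> Ax Dx d Dd; split; last exact: Dx.
  have Dd' := subgroupV sD Dd.
  by have := swap x _ Ax Dd' (Dx _ Dd'); rewrite invgK.
have strip g x : D g -> (forall d, D d -> D ((g * x) * d * (g * x)^-1)) ->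
    forall d, D d -> D (x * d * x^-1).
  move=> Dg H d /H; have -> : g * x * d * (g * x)^-1 = g * (x * d * x^-1 * g^-1) by rewrite !gE.
  by move=> /(subgroupMl sD Dg) /(subgroupMr sD (subgroupV sD Dg)).
have sameD g h : D h -> same Q (g * h) g.
  by move=> Dh; apply/same_residue; rewrite resQ !gE; exact: subgroupV.
have [g gin H] := conjE (precone_onT D (point_precone a cQ)).
have Dg := ED gin; have gE1 : g \in 1 :: E by rewrite inE gin orbT.
have near f := @avoids_near a g f aU gE1.
have g1 : same Q 1 g by apply: same_sym; have := sameD 1 g Dg; rewrite mul1g.
case: H => H.
  apply: fin => //; apply: (strip g) => //; apply: base_point => f fF.
  have Pf := dF.1 _ fF; have [Df|nDf] := pselect (D f).
    by have := H f Df Pf; rewrite /= -(leM _ g) !gE.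
  have [h _] := near f fF nDf; apply: (le_trans h).
  rewrite -{1}[f]mulg1 leM; apply: same_leL (same_sym g1) _ => //.
  by rewrite -{1}[g]mulg1 leM.
suff : forall d, D d -> D (a^-1 * d * a^-1^-1).
  move=> /(fin _ (subgroupV sA Aa)) H' d /H'; rewrite invgK => -[]; by split.
apply: (strip g) => //; apply: base_point => f fF.
have Pf := dF.1 _ fF; have [Df|nDf] := pselect (D f); last first.
  have [_ h] := near f fF nDf; apply: (@le_trans 1); last by rewrite -(leM _ f^-1) mulg1 mulKg.
  apply: same_leR (same_sym g1) _ => //.
  by rewrite -{2}[g]mulg1 leM; exact: neg_pos.
have {}H := H f Df Pf.
pose a' := g * a * g^-1; pose c := f^-1 * a' * f.
have Aa' : A a' by exact: nA.
have Ac : A c by have := nA f^-1 _ Aa'; rewrite invgK.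
have : a' <~ c.
  apply: same_leR (same_sym (sameD _ _ Df)) _ => //.
  apply: same_leL (same_sym (sameD _ _ (subgroupV sD Dg))) _ => //.
  rewrite /a' mulgA; apply: same_leR (same_sym (sameD _ _ (subgroupV sD Dg))) _ => //.
  by move: H; rewrite /= -(leM _ g) !gE.
move=> /(ab_leV cQ sA abA Aa' Ac) h.
have gV : same Q a'^-1 (g * a^-1).
  by rewrite /a' !gE; exact: sameD (subgroupV sD Dg).
rewrite -(leM _ f^-1) mulKg; apply: (same_leR cQ gV); apply: (same_leL cQ _ h).
have -> : c^-1 = f^-1 * a'^-1 * f by rewrite /c !gE.
by apply: (same_trans cQ (sameD _ _ Df)); rewrite sameM.
Qed.

Section Unbounded.
Variable A : set G.
Hypotheses (sA : subgroup A) (nA : normal A) (abA : abelian_action Q A).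
Hypothesis AnD : exists2 a, A a & ~ D a.

(** Let L be the lower set generated by the powers of b. The elements of F in D
    fix these powers, and the others exceed them. So F moves the cut L upwards,
    and so does b in both directions. Thus the residue of the precone of L
    contains b, and it is not G as an element of F lies above L. *)
Lemma no_small_orbit b : positive Q A b -> ~ (forall n, avoids Q obstacles (b ^+ n)).
Proof.
move=> [Ab b1] small; have b1' := ltW b1.
pose L : set G := [set h | exists n, h <~ b ^+ n].
have L1 : L 1 by exists 0; rewrite expg0; exact: le_refl.
have lowL g h : L h -> g <~ h -> L g.
  by move=> [n hn] gh; exists n; exact: le_trans gh hn.
have one_in : 1 \in 1 :: E by exact: mem_head.
have FL f : f \in F -> forall g, L g -> L (f^-1 * g).
  move=> fF g [n gn]; have [Df|nDf] := pselect (D f).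
    exists n; apply: (@le_trans (f^-1 * b ^+ n)); first by rewrite leM.
    have Abn : A (b ^+ n) by exact: subgroupX.
    have [Dfn _] := small_normalizes sA nA abA Abn (posX1 cQ _ b1') (@small n) Df.
    have [] // : same Q (b ^+ n) (f^-1 * b ^+ n).
    apply: same_sym; apply/same_residue; rewrite resQ; move: Dfn; by rewrite !gE.
  exists 0; rewrite expg0 -(leM _ f) mulVKg mulg1; apply: le_trans gn _.
  by have [+ _] := avoids_near (@small n) one_in fF nDf; rewrite mul1g.
have [f0 f0F nDf0] := determines_proper oP dF cD (let: And3 _ h _ := mD in h).
have [/(_ b) bD|RT] := residue_dichotomy (cut_precone cQ lowL) FL.
  have Db : D b.
    apply: bD; split=> g [n gn]; last by rewrite invgK; exists n.+1; rewrite expgS leM.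
    exists n; apply: (@le_trans (b^-1 * b ^+ n)); first by rewrite leM.
    by rewrite -(leM _ b) mulVKg -expgS; exact: posX_le.
  apply: b1; have [] // : same Q b 1.
  by apply/same_residue; rewrite resQ mulg1; exact: subgroupV.
have Lf : L (f0 * f0) by have := RT (f0 * f0)^-1 1 L1; rewrite invgK mulg1.
have [n fn] := Lf.
have [bf _] := avoids_near (@small n) one_in f0F nDf0; rewrite mul1g in bf.
have := out_lt (dF.1 _ f0F) nDf0; apply.
by rewrite -(leM _ f0) mulg1; exact: le_trans fn bf.
Qed.

Lemma dominates b c : positive Q A b -> positive Q A c ->
  (exists n, c <~ b ^+ n) \/ (forall n, b ^+ n <! c).
Proof.
move=> pb pc; have [?|/forallNP h] := pselect (exists n, c <~ b ^+ n); first by left.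
by right=> n; exact: h.
Qed.

Definition hull b : set G := [set y | exists n, b ^- n <~ y /\ y <~ b ^+ n].

Lemma hull_sub b c : positive Q A b -> positive Q A c ->
  (exists n, c <~ b ^+ n) -> hull c `<=` hull b.
Proof.
move=> [Ab b1] [Ac c1] [n cn] y [k [ky yk]]; exists (n * k)%N.
have ck := ab_leX cQ sA abA k Ac (subgroupX n sA Ab) cn; rewrite -expgnA in ck.
split; last exact: le_trans yk ck.
apply: le_trans ky; apply: (ab_leV cQ sA abA _ _ ck); exact: subgroupX.
Qed.

Lemma hull_total b c : positive Q A b -> positive Q A c ->
  hull b `<=` hull c \/ hull c `<=` hull b.
Proof.
move=> pb pc; have [bc|cb] := dominates pb pc; first by right; exact: hull_sub.
by left; apply: hull_sub => //; exists 1%N; rewrite expg1; have := cb 1%N; rewrite expg1; exact: ltW.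
Qed.

(** The hulls form a chain, with one member for each archimedean class of A.
    Their intersection is contained in D unless A has a smallest class. *)
Definition hull_intersection : set G := [set y | forall b, positive Q A b -> hull b y].

(** If the intersection were contained in D, then some single hull would miss
    the finitely many obstacles, contradicting [no_small_orbit]. *)
Lemma hull_intersection_large : (forall y, hull_intersection y -> D y) -> False.
Proof.
move=> coreD; have [b pb bU] : exists2 b, positive Q A b &
    forall u, u \in obstacles -> ~ hull b u.
  have : forall u, u \in obstacles -> ~ D u.
    by move=> u /obstacles_out; rewrite resQ.
  elim: obstacles => [|u U IH] UD.
    by have [|b pb] := exists_positive (Q := Q) sA; rewrite ?resQ //; exists b.
  have [|b pb bU] := IH; first by move=> v vU; apply: UD; rewrite inE vU orbT.
  have [c pc cu] : exists2 c, positive Q A c & ~ hull c u.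
    apply: contrapT => H; apply: (UD u (mem_head _ _)); apply: coreD => c pc.
    by apply: contrapT => nc; apply: H; exists c.
  have [bc|cb] := hull_total pb pc.
    exists b => // v; rewrite inE => /orP[/eqP-> /bc //|/bU //].
  exists c => // v; rewrite inE => /orP[/eqP-> //|/bU H /cb //].
apply: (no_small_orbit pb) => n u uU; have [Ab b1] := pb; have b1' := ltW b1; split=> u1.
  apply: contrapT => /lt_nle un; apply: (bU _ uU); exists n; split; last exact: ltW.
  exact: le_trans (negX1 cQ _ b1') u1.
apply: contrapT => /lt_nle un; apply: (bU _ uU); exists n; split; first exact: ltW.
exact: le_trans u1 (posX1 cQ _ b1').
Qed.


End Unbounded.

Hypothesis nrm : forall C, convex P C -> C `<=` D ->
  forall d x, D d -> C x -> C (d * x * d^-1).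

(** By [conjE] the residue of R in D is conjugate by an element of D to a convex
    subgroup, and [nrm] removes the conjugation. *)
Lemma residue_on_convex R : precone_on D R ->
  convex P [set x | [/\ D x, R x & R x^-1]].
Proof.
move=> cR; have [g gin H] := conjE cR; have Dg := ED gin; have [clR _] := cR.
have Dg' := subgroupV sD Dg.
have Dc x : D x -> D (g^-1 * x * g) by move=> Dx; do 2![apply: (subgroupM sD) => //].
pose C : set G := [set x | [/\ D x, R (g^-1 * x * g) & R (g^-1 * x^-1 * g)]].
have CD : C `<=` D by move=> x [].
have RM x y : D x -> D y -> R (g^-1 * x * g) -> R (g^-1 * y * g) -> R (g^-1 * (x * y) * g).
  move=> Dx Dy Rx Ry.
  have -> : g^-1 * (x * y) * g = (g^-1 * x * g) * (g^-1 * y * g) by rewrite !gE.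
  by apply: clR => //; exact: Dc.
have R1 : R 1 by have [] := cR.2 1 (subgroup1 sD); rewrite ?invg1.
have cC : convex P C.
  split; first split.
  - by split; rewrite ?gE //; exact: subgroup1.
  - move=> x y [Dx Rx Rx'] [Dy Ry Ry']; split; [exact: subgroupM|exact: RM|].
    by rewrite invgM; apply: RM => //; exact: subgroupV.
  - by move=> x [Dx Rx Rx']; split; rewrite ?invgK //; exact: subgroupV.
  - move=> x y Px Pxy [Dy Ry Ry']; have Dx : D x := cD.2 _ _ Px Pxy Dy.
    have Dxy : D (x^-1 * y) by apply: (subgroupM sD) => //; exact: subgroupV.
    have Dy' := subgroupV sD Dy; have Dxy' := subgroupV sD Dxy.
    case: H => H; split=> //; try exact: H.
    + have -> : x^-1 = (x^-1 * y) * y^-1 by rewrite !gE.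
      by apply: RM => //; exact: H.
    + have -> : x = y * (x^-1 * y)^-1 by rewrite !gE.
      by apply: RM => //; exact: H.
have CE x : D x -> C x <-> C (g * x * g^-1).
  move=> Dx; split=> [|/(nrm cC CD Dg')]; first exact: nrm.
  by rewrite !gE.
suff -> : [set x | [/\ D x, R x & R x^-1]] = C by [].
rewrite predeqE => x; split=> [[Dx Rx Rx']|Cx].
  apply/(CE _ Dx); split; rewrite ?gE //.
  by apply: (subgroupM sD) => //; exact: subgroupM.
have Dx := CD _ Cx; have /(CE _ Dx)[_] := Cx; by rewrite !gE.
Qed.

Section HullIntersection.
Variable A : set G.
Hypotheses (sA : subgroup A) (nA : normal A) (abA : abelian_action Q A).
Hypothesis AnD : exists2 a, A a & ~ D a.

(** The stabilizers in D of the points g^n are convex subgroups by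
    [residue_on_convex]. A proper inclusion between the first two, intersected
    with A, would propagate to an infinite descending chain. *)
Lemma stab_no_descent g : (forall b, A b -> D (g^-1 * b * g) -> D b) ->
  forall b, A b -> D b -> D (g^-1 * b * g).
Proof.
move=> sub b Ab Db; apply: contrapT => nDb.
pose C n : set G := [set x | [/\ D x, le Q (g ^+ n) (x * g ^+ n) & le Q (g ^+ n) (x^-1 * g ^+ n)]].
have cC n : convex P (C n) := residue_on_convex (precone_onT D (point_precone (g ^+ n) cQ)).
have CE n x : D x -> C n x <-> D (g ^- n * x * g ^+ n).
  move=> Dx; rewrite -resQ; split=> [[_]|[]].
    by rewrite /residue /= /le !gE.
  by rewrite /C /= /le !gE.
have AS n x : A x -> D (g ^- n.+1 * x * g ^+ n.+1) -> D (g ^- n * x * g ^+ n).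
  move=> Ax; have := sub (g ^- n * x * g ^+ n) (normalV _ nA Ax).
  by rewrite expgSr !gE.
have AD n x : A x -> D (g ^- n * x * g ^+ n) -> D x.
  by move=> Ax; elim: n => [|n IH /(AS _ _ Ax)//]; rewrite expg0 !gE.
have strict n : exists2 x, C n x & ~ C n.+1 x.
  pose x := g ^+ n * b * g ^- n.
  have Dnx : D (g ^- n * x * g ^+ n) by rewrite /x !gE.
  have Dx : D x by apply: AD Dnx; exact: nA.
  exists x; first by apply/CE.
  move=> /(CE _ _ Dx); rewrite /x expgSr !gE => /nDb //.
have CS n : C n.+1 `<=` C n.
  have [|CC] := convex_sub cP (cC n.+1) (cC n); first by [].
  by have [x /CC Cx] := strict n.
exact: (no_decreasing_convex oP dF cC CS strict).
Qed.

(** If a positive c in A fixed the point y, then applying its powers to c^-n <=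
    y would put y above every power of c, although y lies in the hull of c. *)
Lemma hull_intersection_stab y b : hull_intersection A y -> A b -> D (y^-1 * b * y) -> D b.
Proof.
move=> cy Ab Db; apply: contrapT => nDb.
have main c : positive Q A c -> D (y^-1 * c * y) -> False.
  move=> pc Dc; have [_ c1] := pc; have [n [ny yn]] := cy _ pc.
  have cky k : c ^+ k * y <~ y.
    elim: k => [|k IH]; first by rewrite expg0 mul1g; exact: le_refl.
    apply: le_trans IH; rewrite expgSr -mulgA leM.
    have : residue Q (y^-1 * c * y) by rewrite resQ.
    by move=> [_]; rewrite /le !gE.
  have := posXS (n := n) c1; apply; apply: le_trans yn.
  apply: le_trans (cky (n + n).+1).
  rewrite -(leM _ (c ^- n.+1)) mulVg mulgA.
  have -> : c ^- n.+1 * c ^+ (n + n).+1 = c ^+ n by rewrite -addSn expgnDr !gE.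
  by rewrite -(leM _ (c ^- n)) mulKg mulg1.
have [pb|pb|] := ab_pos_cases Q sA Ab; last by rewrite resQ.
  exact: main pb Db.
apply: main pb _; have := subgroupV sD Db; by rewrite !gE.
Qed.

Lemma hull_intersection_conj y b : hull_intersection A y -> A b -> ~ D b -> ~ D (y^-1 * b * y) /\ ~ D (y * b * y^-1).
Proof.
move=> cy Ab nDb; split; first by move=> /(hull_intersection_stab cy Ab).
move=> Db; apply: nDb; have := stab_no_descent (fun b => @hull_intersection_stab y b cy) (nA y Ab) Db.
by rewrite !gE.
Qed.

(** Let g be in the intersection and b positive in A. The conjugates of b by g
    and g^-1 remain outside D by [hull_intersection_conj], so they or their
    inverses are again positive and their hulls contain the intersection. This
    is what closure under products and inverses needs. *)
Lemma hull_intersection_subgroup : subgroup (hull_intersection A).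
Proof.
have twist b' h : A b' -> ~ D b' -> hull_intersection A h -> exists n,
    (b' ^- n <~ h /\ h <~ b' ^+ n) \/ (b' ^+ n <~ h /\ h <~ b' ^- n).
  move=> Ab' nDb' ch; have [pb|pb|] := ab_pos_cases Q sA Ab'; last by rewrite resQ.
    by have [n hn] := ch _ pb; exists n; left.
  by have [n hn] := ch _ pb; exists n; right; move: hn; rewrite expVgn invgK.
have nD b : positive Q A b -> ~ D b.
  move=> [_ b1]; rewrite -resQ => -[_ Qb]; apply: b1; by rewrite /le mulg1.
split.
- move=> b [Ab b1]; exists 0; rewrite expg0 invg1; split; exact: le_refl.
- move=> g h cg ch b pb; have [Ab b1] := pb; have b1' := ltW b1.
  have [nD' _] := hull_intersection_conj cg Ab (nD _ pb).
  have [m [mg gm]] := cg _ pb.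
  have Xg n : (g^-1 * b * g) ^+ n = g^-1 * b ^+ n * g.
    by have := conj_expg g^-1 b n; rewrite invgK.
  have up n : b ^+ n * g <~ b ^+ (n + m) by rewrite expgnDr leM.
  have dn n : b ^- (n + m) <~ b ^- n * g by rewrite addnC expgnDr invgM leM.
  have pn n : b ^- n <~ b ^+ n := le_trans (negX1 cQ n b1') (posX1 cQ n b1').
  have mono n : b ^- n * g <~ b ^+ (n + m).
    apply: (@le_trans (b ^- n * b ^+ m)); first by rewrite leM.
    rewrite -(leM _ (b ^+ n)) mulVKg -expgnDr; apply: posX_le => //.
    by rewrite addnA leq_addl.
  have mono' n : b ^- (n + m) <~ b ^+ n * g.
    apply: (@le_trans (b ^+ n * b ^- m)); last by rewrite leM.
    rewrite -(leM _ (b ^+ (n + m))) mulgV mulgA -expgnDr.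
    have -> : (n + m + n = n + n + m)%N by rewrite addnAC.
    by rewrite expgnDr !gE; exact: posX1.
  have [n] := twist _ h (normalV g nA Ab) nD' ch; rewrite Xg => H; exists (n + m).
  have E1 : g * (g^-1 * b ^+ n * g) = b ^+ n * g by rewrite !gE.
  have E2 : g * (g^-1 * b ^+ n * g)^-1 = b ^- n * g by rewrite !gE.
  case: H => -[h1 h2]; rewrite -(leM _ g) in h1; rewrite -(leM _ g) in h2;
    rewrite ?E1 ?E2 in h1 h2.
    by split; [exact: le_trans (dn n) h1|exact: le_trans h2 (up n)].
  by split; [exact: le_trans (mono' n) h1|exact: le_trans h2 (mono n)].
- move=> g cg b pb; have [Ab b1] := pb; have b1' := ltW b1.
  have [_ nD'] := hull_intersection_conj cg Ab (nD _ pb).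
  have pn n : b ^- n <~ b ^+ n := le_trans (negX1 cQ n b1') (posX1 cQ n b1').
  have [n] := twist _ g (nA g Ab) nD' cg; rewrite conj_expg => H; exists n.
  have H1 c : g <~ g * c * g^-1 -> c^-1 <~ g^-1 by rewrite /le !gE.
  have H2 c : g * c * g^-1 <~ g -> g^-1 <~ c^-1 by rewrite /le !gE.
  have EV : (g * b ^+ n * g^-1)^-1 = g * b ^- n * g^-1 by rewrite !gE.
  rewrite EV in H; case: H => -[/H2 h2 /H1 h1].
    by rewrite invgK in h2.
  rewrite invgK in h1; split; first exact: le_trans (pn n) h1.
  exact: le_trans h2 (pn n).
Qed.

(** The intersection of the hulls is a convex subgroup not contained in D, hence
    G: the powers of every positive element of A are cofinal. *)
Lemma exists_unbounded : exists2 b, positive Q A b & ~ bounded Q b.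
Proof.
have [coreD|/existsNP[z /not_implyP[cz nDz]]] := pselect (forall y, hull_intersection A y -> D y).
  by have := hull_intersection_large sA nA abA AnD coreD.
have ccore x y : 1 <~ x -> x <~ y -> hull_intersection A y -> hull_intersection A x.
  move=> x1 xy cy b pb; have [n [_ yn]] := cy _ pb; exists n.
  split; last exact: le_trans xy yn.
  have [_ b1] := pb; exact: le_trans (negX1 cQ n (ltW b1)) x1.
rewrite -resQ in nDz; have full := maxconvex_act hull_intersection_subgroup ccore cz nDz.
have [|b pb] := exists_positive (Q := Q) sA; first by rewrite resQ.
have [_ b1] := pb; exists b => // -[h bh]; have [n [_ hn]] := full h b pb.
by apply: (posXS (n := n) b1); exact: le_trans (bh n.+1) hn.
Qed.

End HullIntersection.

Hypothesis series : has_abelian_layers G.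

(** D turns out to be the kernel of the action of G on G/D. *)
Lemma maxconvex_normal : normal D.
Proof.
have [_ DT _] := mD.
have DK : residue Q `<=` kernel Q.
  apply: (stabilizer_sub_kernel cQ maxconvex_act _ obstacles_out).
  - by move=> A sA nA abA; rewrite resQ => AnD; exact: (exists_unbounded sA nA abA AnD).
  - move=> A sA nA abA a Aa a1 aU d; rewrite resQ; exact: (small_normalizes sA nA abA Aa a1 aU).
  - exact: series.
  - by move=> g m; rewrite resQ; exact: convex_root cP cD.
  - by rewrite resQ.
by move=> g d; rewrite -{1}resQ => /DK /(_ g); rewrite resQ.
Qed.

End Tame.
End Isolated.

(** * The top quotient is abelian *)

Section Congruence.
Variables (G : groupType) (N : set G).
Hypotheses (sN : subgroup N) (nN : normal N).
Implicit Types g h x y z : G.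

Definition eqm x y := N (x^-1 * y).

Lemma eqm_refl x : eqm x x.
Proof. by rewrite /eqm mulVg; exact: subgroup1. Qed.

Lemma eqm_sym x y : eqm x y -> eqm y x.
Proof. by move=> /(subgroupV sN); rewrite /eqm !gE. Qed.

Lemma eqm_trans y x z : eqm x y -> eqm y z -> eqm x z.
Proof. by move=> xy yz; have := subgroupM sN xy yz; rewrite /eqm !gE. Qed.

Lemma eqmM x x' y y' : eqm x x' -> eqm y y' -> eqm (x * y) (x' * y').
Proof.
move=> /(nN y^-1) xx yy; have := subgroupM sN xx yy; by rewrite /eqm !gE.
Qed.

Lemma eqmV x y : eqm x y -> eqm x^-1 y^-1.
Proof. by move=> /eqm_sym /(nN x); rewrite /eqm !gE. Qed.

Lemma eqmX x y n : eqm x y -> eqm (x ^+ n) (y ^+ n).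
Proof.
move=> xy; elim: n => [|n IH]; first exact: eqm_refl.
by rewrite !expgS; exact: eqmM.
Qed.

Lemma eqm1 x : eqm x 1 <-> N x.
Proof. by rewrite /eqm mulg1; split=> [/(subgroupVE sN)|/(subgroupV sN)]. Qed.

Lemma eqm_mem x y : eqm x y -> N x <-> N y.
Proof.
move=> xy; split=> [Nx|Ny]; first exact: (subgroupMl sN (subgroupV sN Nx) xy).
exact: (subgroupVE sN (subgroupMr sN Ny xy)).
Qed.

Definition centralizer_mod x : set G := [set g | eqm (g * x) (x * g)].

Lemma centralizer_mod_subgroup x : subgroup (centralizer_mod x).
Proof.
split.
- by rewrite /centralizer_mod /= mulg1 mul1g; exact: eqm_refl.
- move=> g h gx hx; apply: (@eqm_trans (g * x * h)).
    by rewrite -!mulgA; apply: eqmM hx; exact: eqm_refl.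
  by rewrite mulgA; apply: eqmM gx _; exact: eqm_refl.
- move=> g gx; apply: eqm_sym.
  have := eqmM (eqmM (eqm_refl g^-1) gx) (eqm_refl g^-1); by rewrite !gE.
Qed.

Lemma centralizer_mod_sub x : N `<=` centralizer_mod x.
Proof.
move=> g /eqm1 g1; apply: (@eqm_trans x).
  by have := eqmM g1 (eqm_refl x); rewrite mul1g.
by apply: eqm_sym; have := eqmM (eqm_refl x) g1; rewrite mulg1.
Qed.

Lemma eqm_commute_X x y n : eqm (x * y) (y * x) -> eqm ((x * y) ^+ n) (x ^+ n * y ^+ n).
Proof.
move=> xy; elim: n => [|n IH]; first by rewrite !expg0 mulg1; exact: eqm_refl.
have c : eqm (y * x ^+ n) (x ^+ n * y).
  by apply: eqm_sym; apply: (subgroupX n (centralizer_mod_subgroup y)).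
apply: (@eqm_trans (x * y * (x ^+ n * y ^+ n))).
  by rewrite expgS; apply: eqmM IH; exact: eqm_refl.
rewrite !expgS -!mulgA; apply: eqmM; first exact: eqm_refl.
rewrite !mulgA -mulgA in c *; rewrite -!mulgA.
by have := eqmM c (eqm_refl (y ^+ n)); rewrite !mulgA.
Qed.

Lemma eqm_commensurable x y z m k n l :
  eqm (x ^+ m.+1) (z ^+ k.+1) -> eqm (y ^+ n.+1) (z ^+ l.+1) ->
  exists i j, eqm (x ^+ i.+1) (y ^+ j.+1).
Proof.
move=> xz yz; exists (m.+1 * l.+1).-1, (n.+1 * k.+1).-1; rewrite !prednK // !expgnA.
apply: (eqm_trans (eqmX l.+1 xz)); apply: eqm_sym; apply: (eqm_trans (eqmX k.+1 yz)).
by rewrite -!expgnA mulnC; exact: eqm_refl.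
Qed.

End Congruence.

Section Quotient.
Variables (G : groupType) (P D : set G) (F : seq G).
Hypotheses (oP : order_cone P) (dF : determines F P) (mD : maxconvex P D).
Hypothesis nD : normal D.
Implicit Types (f g h x y z : G).

Let Q := P `|` D.
Let cP : precone P := oP.1.
Let cD : convex P D. Proof. by case: mD. Qed.
Let sD : subgroup D := cD.1.
Let cQ : precone Q := convex_precone cP cD.
Let resQ : residue Q = D := convex_residue oP cD.

Local Notation "g <~ h" := (le Q g h) (at level 70).
Local Notation "g <! h" := (lt Q g h) (at level 70).
Local Notation "g =~ h" := (eqm D g h) (at level 70).

Let le_trans := @le_trans G Q cQ.
Let le_lt_trans := @le_lt_trans G Q cQ.
Let lt_le_trans := @lt_le_trans G Q cQ.
Let ltW := @ltW G Q cQ.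
Let refl := eqm_refl sD.

Lemma eqm_same g h : g =~ h <-> same Q g h.
Proof. by rewrite same_residue resQ. Qed.

Lemma out_cases g : [\/ D g, 1 <! g | 1 <! g^-1].
Proof.
have [|nD1] := pselect (same Q 1 g); last have [|] := lt_total nD1.
- by rewrite same_residue resQ !gE; constructor 1.
- by constructor 2.
- by move=> H; constructor 3; move: H; rewrite /lt /le !gE.
Qed.

Lemma lt1_out g : 1 <! g <-> P g /\ ~ D g.
Proof.
split=> [g1|[Pg nDg]]; last exact: (out_lt oP mD).
have nDg : ~ D g by rewrite -resQ => -[_ Qg]; apply: g1; rewrite /le mulg1.
by split=> //; have := ltW g1; rewrite /le !gE => -[|//].
Qed.

Lemma exists_out : exists s, 1 <! s.
Proof.
have [_ [g nDg] _] := mD; have [//|?|?] := out_cases g; [by exists g|by exists g^-1].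
Qed.

Lemma interval_full_mod (T : set G) s : subgroup T -> D `<=` T -> 1 <! s ->
  (forall u, 1 <! u -> u <~ s -> T u) -> forall g, T g.
Proof.
move=> sT DT /lt1_out[Ps nDs] H; apply: (interval_full oP mD sT Ps nDs) => u Pu us.
have [/DT //|nDu] := pselect (D u); apply: H; first exact/lt1_out.
by left.
Qed.

(** There is only one coset between D and s, so a centralizer modulo D that
    contains s contains an interval that is not in D. *)
Lemma commute_full s : 1 <! s -> (forall u, 1 <! u -> u <~ s -> u =~ s) ->
  forall x y, x * y =~ y * x.
Proof.
move=> s1 min; have full x : centralizer_mod D x s -> forall g, centralizer_mod D x g.
  move=> xs; apply: (interval_full_mod (centralizer_mod_subgroup sD nD x) _ s1).
    exact: centralizer_mod_sub.
  move=> u u1 /(min _ u1) us; apply: (eqm_trans sD) (eqmM sD nD us (refl x)) _.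
  by apply: (eqm_trans sD) xs _; apply: eqmM => //; exact: eqm_sym.
have cs : forall g, centralizer_mod D s g by apply: full; exact: refl.
by move=> x y; apply: full; apply: eqm_sym => //; exact: cs.
Qed.

Section Dense.
Hypothesis dense : forall s, 1 <! s -> exists2 u, 1 <! u & u <! s.

(** Modulo the normal subgroup D there is no least positive element, so some s
    lies below all elements of F outside D. Based at a point u below s, the
    preorder still makes F positive, hence conjugation by u preserves Q. The set
    of all u with this property is a subgroup, and [interval_full] shows that it
    is G. *)
Lemma dense_conj g h : Q g -> Q (h^-1 * g * h).
Proof.
have [s s1 sF] : exists2 s, 1 <! s & forall f, f \in F -> ~ D f -> s <~ f.
  have := dF.1; elim: (F) => [|f F' IH] FP; first by have [s] := exists_out; exists s.
  have [|s s1 sF] := IH; first by move=> x xF; apply: FP; rewrite inE xF orbT.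
  have [Df|nDf] := pselect (D f).
    by exists s => // x; rewrite inE => /orP[/eqP->|]; [|exact: sF].
  have Pf := FP f (mem_head _ _).
  have [sf|fs] := le_total cQ s f.
    by exists s => // x; rewrite inE => /orP[/eqP->|]; [|exact: sF].
  exists f; first exact/lt1_out.
  move=> x; rewrite inE => /orP[/eqP-> _|xF nDx]; first exact: le_refl.
  exact: le_trans fs (sF _ xF nDx).
pose T h := forall g, Q g -> Q (h^-1 * g * h) /\ Q (h * g * h^-1).
have small u : 1 <! u -> u <~ s -> T u.
  move=> u1 us; have PR : P `<=` [set f | u <~ f * u].
    apply: dF.2; first exact: point_precone.
    move=> f fF /=; have [Df|nDf] := pselect (D f).
      have : D (u^-1 * f * u) by have := nD u^-1 Df; rewrite invgK.
      by rewrite /le mulgA; right.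
    apply: (le_trans us); apply: le_trans (sF _ fF nDf) _.
    by rewrite -{1}[f]mulg1 leM; exact: ltW.
  have Qu k : Q k -> Q (u^-1 * k * u).
    move=> [/PR|Dk]; first by rewrite /= /le mulgA.
    by right; have := nD u^-1 Dk; rewrite invgK.
  move=> k Qk; split; first exact: Qu.
  have [//|Qk'] := cQ.2 (u * k * u^-1).
  have := Qu _ Qk'; rewrite !gE => Qk''.
  have : residue Q k by split.
  by rewrite resQ => /(nD u); right.
have sT : subgroup T.
  split.
  - by move=> k Qk; rewrite !gE.
  - move=> x y Tx Ty k Qk; split.
      by have := (Ty _ (Tx _ Qk).1).1; rewrite !gE.
    by have := (Tx _ (Ty _ Qk).2).2; rewrite !gE.
  - by move=> x Tx k /Tx[]; rewrite invgK.
have DT : D `<=` T.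
  move=> d Dd k Qk; have Dd' := subgroupV sD Dd.
  by split; do 2?apply: cQ.1 => //; right.
by move=> Qg; have [] := interval_full_mod sT DT s1 small h g Qg.
Qed.

Lemma le_mulr g h k : g <~ h -> g * k <~ h * k.
Proof. by move=> /(dense_conj k); rewrite /le !gE. Qed.

(** By invariance on both sides, the elements bounded by powers of a form a
    convex subgroup. *)
Lemma dense_archimedean a b : 1 <! a -> exists n, b <~ a ^+ n.
Proof.
move=> a1; have a1' := ltW a1.
pose V : set G := [set g | exists n, a ^- n <~ g /\ g <~ a ^+ n].
suff [n [_ bn]] : V b by exists n.
apply: (@maxconvex_act _ _ _ oP mD V _ _ a) => [||| aD].
- split.
  + by exists 0; rewrite expg0 invg1; split; exact: le_refl.
  + move=> x y [n [nx xn]] [m [my ym]]; exists (n + m); split.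
      rewrite addnC expgnDr invgM; apply: (@le_trans (a ^- n * y)); first by rewrite leM.
      exact: le_mulr.
    rewrite expgnDr; apply: (@le_trans (x * a ^+ m)); first by rewrite leM.
    exact: le_mulr.
  + move=> x [n [nx xn]]; exists n; split.
      have := le_mulr (a ^- n) xn; rewrite mulgV -(leM _ x^-1) mulg1 mulKg; exact.
    by have := le_mulr (a ^+ n) nx; rewrite mulVg -(leM _ x^-1) mulg1 mulKg.
- move=> x y x1 xy [n [_ yn]]; exists n; split; last exact: le_trans xy yn.
  exact: le_trans (negX1 cQ n a1') x1.
- exists 1%N; rewrite expg1; split; last exact: le_refl.
  exact: le_trans (neg_pos a1') a1'.
- by move: a1 => /lt1_out[_]; rewrite -resQ.
Qed.

Lemma dense_floor e x : 1 <! e -> 1 <~ x -> exists m, e ^+ m <~ x /\ x <! e ^+ m.+1.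
Proof.
move=> e1 x1; have [n] := dense_archimedean x e1; elim: n => [|n IH] xn.
  exists 0; split; first by rewrite expg0.
  exact: le_lt_trans xn (posXS (n := 0) e1).
have [nx|/lt_nle xn'] := pselect (e ^+ n <~ x); last exact/IH/ltW.
have [e'x|/lt_nle] := pselect (e ^+ n.+1 <~ x); last by exists n.
exists n.+1; split=> //; exact: le_lt_trans xn (posXS (n := n.+1) e1).
Qed.

(** The argument of Hoelder: if the commutator c of x and y were positive,
    choose e with e^2 below c. Trapping x and y between consecutive powers of e
    shows that x y and y x differ by less than e^2. *)
Lemma dense_commute x y : 1 <! x -> 1 <! y -> ~ 1 <! (y * x)^-1 * (x * y).
Proof.
move=> x1 y1; set c := _ * _ => c1.
have [e e1 eec] : exists2 e, 1 <! e & e * e <~ c.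
  have [s s1 sc] := dense c1; have [ssc|css] := le_total cQ (s * s) c; first by exists s.
  exists (s^-1 * c); first by rewrite -(ltM _ s) mulg1 mulVKg.
  have es : s^-1 * c <~ s by rewrite -(leM _ s) mulVKg.
  by have := le_mulr (s^-1 * c) es; rewrite mulVKg.
have [m [em me]] := dense_floor e1 (ltW x1).
have [n [en ne]] := dense_floor e1 (ltW y1).
have up : x * y <! e ^+ (m.+1 + n.+1).
  rewrite expgnDr; apply: (@lt_le_trans (x * e ^+ n.+1)); first by rewrite ltM.
  exact/le_mulr/ltW.
apply: up; have -> : x * y = y * x * c by rewrite /c mulVKg.
have -> : e ^+ (m.+1 + n.+1) = e ^+ n * e ^+ m * (e * e).
  by rewrite -[e * e]/(e ^+ 2) -!expgnDr; congr (_ ^+ _); rewrite addSn addnS addn2 addnC.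
apply: (@le_trans (e ^+ n * e ^+ m * c)); first by rewrite leM.
apply: le_mulr; apply: (@le_trans (e ^+ n * x)); first by rewrite leM.
exact: le_mulr.
Qed.

End Dense.

Lemma quotient_abelian x y : x * y =~ y * x.
Proof.
have [[s [s1 min]]|nomin] := pselect (exists s, 1 <! s /\ forall u, 1 <! u -> s <~ u).
  apply: (commute_full s1) => u u1 us; apply/eqm_same; split=> //; exact: min.
have dense s : 1 <! s -> exists2 u, 1 <! u & u <! s.
  move=> s1; apply: contrapT => nu; apply: nomin; exists s; split=> // u u1.
  by apply: contrapT => /lt_nle us; apply: nu; exists u.
have pos a b : 1 <! a -> 1 <! b -> a * b =~ b * a.
  move=> a1 b1; have [H|H|H] := out_cases ((b * a)^-1 * (a * b)).
  - exact: (eqm_sym sD).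
  - by case: (dense_commute dense a1 b1).
  - by case: (dense_commute dense b1 a1); move: H; rewrite !gE.
have pos2 a b : 1 <! a -> a * b =~ b * a.
  move=> a1; have [Db|b1|b1] := out_cases b; last 2 first.
  - exact: pos.
  - rewrite -[b]invgK; apply: (eqm_sym sD).
    apply: (subgroupV (centralizer_mod_subgroup sD nD a)); exact: pos.
  - by apply: (eqm_sym sD); apply: centralizer_mod_sub.
have [Dx|x1|x1] := out_cases x; first exact: centralizer_mod_sub.
  exact: pos2.
rewrite -[x]invgK; apply: (subgroupV (centralizer_mod_subgroup sD nD y)); exact: pos2.
Qed.

End Quotient.

(** * Determined abelian quotients have rank one *)

Section RankOne.
Variables (G : groupType) (P N : set G) (F : seq G).
Hypotheses (oP : order_cone P) (dF : determines F P) (cN : convex P N).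
Hypothesis nN : normal N.
Local Notation "g =~ h" := (eqm N g h) (at level 70).
Hypothesis abN : forall x y : G, x * y =~ y * x.
Implicit Types (f g h p x y z : G) (W : set G) (s : seq G).

Let cP : precone P := oP.1.
Let sN : subgroup N := cN.1.
Let refl := eqm_refl sN.
Let trans := @eqm_trans G N sN.
Let sym := @eqm_sym G N sN.
Let mulm := @eqmM G N sN nN.

Definition submonoid W := N `<=` W /\ forall g h, W g -> W h -> W (g * h).

Lemma submonoid_eqm W g h : submonoid W -> g =~ h -> W g -> W h.
Proof. by move=> [NW WM] gh Wg; rewrite -[h](mulVKg g); apply: WM => //; exact: NW. Qed.

Lemma submonoidX W g n : submonoid W -> W g -> W (g ^+ n).
Proof.
move=> [NW WM] Wg; elim: n => [|n IH]; first by apply: NW; exact: subgroup1.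
by rewrite expgS; exact: WM.
Qed.

Lemma eqm_XM x y n : (x * y) ^+ n =~ x ^+ n * y ^+ n.
Proof. exact: eqm_commute_X. Qed.

Definition adjoin W h : set G := [set g | exists2 w, W w & exists k, g =~ w * h ^+ k].

Lemma adjoin_submonoid W h : submonoid W -> submonoid (adjoin W h).
Proof.
move=> [NW WM]; split=> [g Ng|x y [w Ww [k xk]] [v Wv [l yl]]].
  by exists g; [exact: NW|exists 0; rewrite expg0 mulg1].
exists (w * v); first exact: WM.
exists (k + l); apply: trans (mulm xk yl) _; rewrite expgnDr !mulgA.
apply: mulm (refl _); rewrite -!mulgA; apply: mulm (refl _) _; exact: abN.
Qed.

Lemma sub_adjoin W h : submonoid W -> W `<=` adjoin W h.
Proof. by move=> _ g Wg; exists g => //; exists 0; rewrite expg0 mulg1. Qed.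

Lemma adjoin_gen W h : submonoid W -> adjoin W h h.
Proof.
move=> [NW _]; exists 1; first by apply: NW; exact: subgroup1.
by exists 1%N; rewrite expg1 mul1g.
Qed.

(** A maximal submonoid V among those containing no positive power of p is
    total. Indeed if V admits neither h nor h^-1, then two powers of p have the
    form w h^i and v h^-j with v and w in V, and suitable powers of these two
    combine to a power of p in V. *)
Lemma submonoid_extend W p : submonoid W -> (forall m, ~ W (p ^+ m.+1)) ->
  exists2 Q, precone Q & W `<=` Q /\ ~ Q p.
Proof.
move=> mW nW.
pose good V := submonoid V /\ forall m, ~ V (p ^+ m.+1).
pose fam : set (set G) := [set V | (exists x, V x) -> good V /\ W `<=` V].
have [V [famV maxV]] : exists V, fam V /\ forall V', V `<` V' -> ~ fam V'.
  apply: Zorn_bigcup => C Cfam totC [x [V CV Vx]].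
  have ne V' : C V' -> forall y, V' y -> good V' /\ W `<=` V'.
    by move=> CV' y Vy; apply: Cfam => //; exists y.
  have [[mV nV] WV] := ne V CV x Vx.
  split; last by move=> y /WV Vy; exists V.
  split; first split.
  - by move=> y /mV.1 Vy; exists V.
  - move=> y z [Y CY Yy] [Z CZ Zz].
    have [[[_ mY] _] _] := ne Y CY _ Yy; have [[[_ mZ] _] _] := ne Z CZ _ Zz.
    have [YZ|ZY] := totC _ _ CY CZ.
      by exists Z => //; apply: mZ => //; exact: YZ.
    by exists Y => //; apply: mY => //; exact: ZY.
  - by move=> m [Y CY Yp]; have [[_ /(_ m)]] := ne Y CY _ Yp.
have Wfam : fam W by move=> _; split.
have W1 : W 1 by apply: mW.1; exact: subgroup1.
have neV : exists x, V x.
  apply: contrapT => /forallNP V0; apply: (maxV W) => //; split=> [x /V0 //|].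
  by move=> /(_ _ W1) /V0.
have [[mV nV] WV] := famV neV; have [NV VM] := mV.
have key h : ~ V h -> exists m, exists2 w, V w & exists k, p ^+ m.+1 =~ w * h ^+ k.
  move=> nVh; apply: contrapT => H; apply: (maxV (adjoin V h)).
    split; first exact: sub_adjoin.
    by move=> /(_ _ (adjoin_gen h mV)).
  move=> _; split; last by move=> x /WV; exact: sub_adjoin.
  split; first exact: adjoin_submonoid.
  by move=> m [w Vw [k pk]]; apply: H; exists m, w => //; exists k.
exists V; last by split=> //; have := nV 0; rewrite expg1.
split=> [|h]; first exact: VM.
apply: contrapT => /not_orP[/key[m [w Vw [i pw]]] /key[n [v Vv [j pv]]]].
have [i0|i0] := eqVneq i 0.
  move: pw; rewrite i0 expg0 mulg1 => pw; exact: (nV m (submonoid_eqm mV (sym pw) Vw)).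
(* p ^ ((m + 1) j + (n + 1) i) is a product of elements of V *)
have pij : p ^+ (m.+1 * j + n.+1 * i) =~ w ^+ j * v ^+ i.
  rewrite expgnDr !expgnA; apply: trans (mulm (eqmX sN nN j pw) (eqmX sN nN i pv)) _.
  apply: trans (mulm (eqm_XM _ _ _) (eqm_XM _ _ _)) _.
  rewrite -!expgnA [(j * i)%N]mulnC expVgn.
  apply: trans (_ : w ^+ j * (v ^+ i * h ^+ (i * j)) * h ^- (i * j) =~ _); last first.
    by rewrite !gE; exact: refl.
  rewrite !mulgA; apply: mulm (refl _); rewrite -!mulgA; apply: mulm (refl _) _.
  exact: abN.
have i1 : (0 < n.+1 * i)%N by rewrite muln_gt0 /= lt0n.
have mV' : V (w ^+ j * v ^+ i) by apply: VM; exact: submonoidX.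
apply: (nV (m.+1 * j + n.+1 * i).-1).
rewrite prednK; last by rewrite addn_gt0 i1 orbT.
exact: submonoid_eqm mV (sym pij) mV'.
Qed.

Fixpoint span_submonoid s : set G :=
  if s is f :: s' then adjoin (span_submonoid s') f else N.

Lemma gen_submonoid s : submonoid (span_submonoid s).
Proof.
by elim: s => [|f s IH]; [split=> // x y; exact: subgroupM|exact: adjoin_submonoid].
Qed.

Lemma mem_gen s f : f \in s -> span_submonoid s f.
Proof.
elim: s => [//|h s IH]; rewrite inE => /orP[/eqP ->|/IH fs].
  exact: adjoin_gen (gen_submonoid s).
exact: sub_adjoin (gen_submonoid s) _ fs.
Qed.

Lemma gen_min s W : submonoid W -> (forall f, f \in s -> W f) -> span_submonoid s `<=` W.
Proof.
move=> mW; elim: s => [|f s IH] sW; first exact: mW.1.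
move=> g [w /IH Ww [k gk]]; apply: (submonoid_eqm mW (sym gk)).
apply: mW.2; first by apply: Ww => x xs; apply: sW; rewrite inE xs orbT.
by apply: submonoidX => //; apply: sW; exact: mem_head.
Qed.

Definition spans s := forall p, P p -> exists m, span_submonoid s (p ^+ m.+1).

(** A positive p without powers in the submonoid would be omitted by some
    precone that contains F. *)
Lemma determines_spans : spans F.
Proof.
move=> p Pp; apply: contrapT => /forallNP H.
have [Q cQ [FQ nQp]] := submonoid_extend (gen_submonoid F) H.
by apply: nQp; apply: dF.2 Pp => // f /mem_gen/FQ.
Qed.

Let Q := P `|` N.
Let cQ : precone Q := convex_precone cP cN.
Let resQ : residue Q = N := convex_residue oP cN.

(** If a <= b, some power of a^-1 b is a product w b^k of the generators.
    Solving for b gives a power of b in the submonoid generated by the others,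
    unless the exponent k is too large; then a product of positive elements
    including a would be trivial. *)
Lemma spans_drop a b s : P a -> ~ N a -> (forall f, f \in s -> P f) ->
  P (a^-1 * b) -> spans [:: b, a & s] -> spans (a :: s).
Proof.
move=> Pa nNa sP Pab sp; set M := span_submonoid (a :: s); have mM : submonoid M := gen_submonoid _.
have MQ : M `<=` Q.
  apply: gen_min; first by split=> [g|g h]; [right|exact: cQ.1].
  by move=> f; rewrite inE => /orP[/eqP->|/sP]; left.
have Ma : M a by apply: mem_gen; exact: mem_head.
have mbs : submonoid (span_submonoid [:: b, a & s]) := gen_submonoid _.
suff [l Mbl] : exists l, M (b ^+ l.+1).
  move=> p Pp; have [m [w Mw [k pk]]] := sp p Pp.
  exists (m.+1 * l.+1).-1; rewrite prednK // expgnA.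
  apply: (submonoid_eqm mM (sym (eqmX sN nN l.+1 pk))).
  apply: (submonoid_eqm mM (sym (eqm_XM _ _ _))).
  apply: mM.2; first exact: submonoidX.
  by rewrite -expgnA mulnC expgnA; exact: submonoidX.
have [m [w Mw [k qk]]] := sp _ Pab.
(* (a^-1 b)^(m+1) = w b^k with w in M *)
have bw : b ^+ m.+1 =~ a ^+ m.+1 * w * b ^+ k.
  apply: trans (_ : _ =~ a ^+ m.+1 * (a^-1 * b) ^+ m.+1) _; last first.
    by rewrite -mulgA; apply: mulm (refl _) qk.
  have := eqm_XM a (a^-1 * b) m.+1; by rewrite mulVKg.
have Mw' : M (a ^+ m.+1 * w) by apply: mM.2 => //; exact: submonoidX.
have [km|mk] := ltnP k m.+1.
  exists (m - k)%N; apply: (submonoid_eqm mM _ Mw').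
  apply: sym; rewrite -subSn // expgnFr 1?ltnW //.
  by have := mulm bw (refl (b ^- k)); rewrite !gE.
(* otherwise a^(m+1) w b^(k-m-1) is trivial although a is positive *)
case: nNa; rewrite -resQ; split; first by left.
have Qb : Q b.
  have -> : b = a * (a^-1 * b) by rewrite mulVKg.
  by left; exact: cP.1.
have : N (a ^+ m.+1 * w * b ^+ (k - m.+1)).
  apply/(eqm1 sN)/sym; have := mulm bw (refl (b ^- m.+1)).
  by rewrite mulgV -mulgA -expgnFr.
rewrite -resQ => -[_]; rewrite expgS -!mulgA invgM => H.
have -> : a^-1 = (a ^+ m * (w * b ^+ (k - m.+1))) * ((a ^+ m * (w * b ^+ (k - m.+1)))^-1 * a^-1).
  by rewrite !gE.
apply: cQ.1 => //; apply: cQ.1; first by apply: preconeX => //; left.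
by apply: cQ.1; [exact: MQ|exact: preconeX].
Qed.

(** Drop the larger of two generators until only one is left outside N. *)
Lemma rank_one_of_spans s : (exists g, ~ N g) -> (forall f, f \in s -> P f) -> spans s ->
  exists f0, [/\ P f0, ~ N f0 &
    forall p, P p -> ~ N p -> exists m k, p ^+ m.+1 =~ f0 ^+ k.+1].
Proof.
move=> [g nNg]; have [n] := ubnP (size s); elim: n s => [//|n IH] s.
have [g' Pg nNg'] : exists2 g, P g & ~ N g.
  have [Pg|Pg] := cP.2 g; first by exists g.
  by exists g^-1 => // /(subgroupVE sN).
case: s => [|a s] sn sP sp.
  by have [m /= /(convex_root cP cN)] := sp _ Pg.
have [Pa sP'] : P a /\ forall f, f \in s -> P f.
  by split=> [|f fs]; apply: sP; rewrite inE ?eqxx ?fs ?orbT.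
have [Na|nNa] := pselect (N a).
  apply: (IH s) => // p Pp; have [m [w Mw [k pk]]] := sp _ Pp; exists m.
  have ms := gen_submonoid s.
  apply: (submonoid_eqm ms (sym pk)); apply: ms.2 => //.
  by apply: submonoidX => //; exact: ms.1.
case: s sn sP sp sP' => [|b s] sn sP sp sP'.
  exists a; split=> // p Pp nNp; have [m [w Nw [k pk]]] := sp _ Pp.
  exists m; case: k pk => [|k] pk; last first.
    exists k; apply: trans pk _; have /(eqm1 sN) w1 := Nw.
    by have := mulm w1 (refl (a ^+ k.+1)); rewrite mul1g.
  case: nNp; apply: (convex_root (n := m) cP cN).
  by apply/(eqm_mem sN pk); rewrite expg0 mulg1.
have Pb : P b by apply: sP'; exact: mem_head.
have [Nb|nNb] := pselect (N b).
  apply: (IH (a :: s)) => // [f|p Pp].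
    by rewrite inE => /orP[/eqP->//|fs]; apply: sP'; rewrite inE fs orbT.
  have [m H] := sp p Pp; exists m; apply: (gen_min _ _ H).
    exact: gen_submonoid.
  move=> f; rewrite !inE => /or3P[/eqP->|/eqP->|fs].
  - by apply: mem_gen; exact: mem_head.
  - by apply: (gen_submonoid _).1.
  - by apply: mem_gen; rewrite inE fs orbT.
have sP2 f : f \in s -> P f by move=> fs; apply: sP'; rewrite inE fs orbT.
have [ab|ba] := le_total cP a b.
  apply: (IH (a :: s)) => // [f|].
    by rewrite inE => /orP[/eqP->//|]; exact: sP2.
  apply: (spans_drop (b := b)) => // p Pp; have [m H] := sp p Pp; exists m.
  apply: (gen_min _ _ H); first exact: gen_submonoid.
  move=> f; rewrite !inE => fin; apply: mem_gen; rewrite !inE orbCA; exact: fin.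
by apply: (IH (b :: s)) => //; exact: (spans_drop Pb nNb sP2 ba sp).
Qed.

(** An order of an abelian group of higher rank is never isolated. *)
Lemma rank_one : (exists g, ~ N g) -> exists f0, [/\ P f0, ~ N f0 &
  forall p, P p -> ~ N p -> exists m k, p ^+ m.+1 =~ f0 ^+ k.+1].
Proof.
by move=> gN; apply: (rank_one_of_spans gN dF.1); exact: determines_spans.
Qed.

End RankOne.

Section TopCommensurable.
Variables (G : groupType) (P D : set G) (F : seq G).
Hypotheses (oP : order_cone P) (dF : determines F P) (mD : maxconvex P D).
Hypothesis nD : normal D.

Lemma top_generator : exists f0, [/\ P f0, ~ D f0 &
  forall p, P p -> ~ D p -> exists m k, eqm D (p ^+ m.+1) (f0 ^+ k.+1)].
Proof.
have [cD DT _] := mD; exact: rank_one oP dF cD nD (quotient_abelian oP dF mD nD) DT.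
Qed.

Lemma top_commensurable p q : P p -> ~ D p -> P q -> ~ D q ->
  exists i j, eqm D (p ^+ i.+1) (q ^+ j.+1).
Proof.
move=> Pp nDp Pq nDq; have [e [Pe nDe rke]] := top_generator.
have [m [k pe]] := rke _ Pp nDp; have [n [l qe]] := rke _ Pq nDq.
have [[sD _] _ _] := mD; exact: (eqm_commensurable sD nD pe qe).
Qed.

End TopCommensurable.

(** * Reversing the order of the second convex factor *)

Section Inverting.
Variables (G : groupType) (P D N : set G) (F : seq G) (f1 : G).
Hypotheses (oP : order_cone P) (dF : determines F P) (mD : maxconvex P D).
Hypotheses (nD : normal D) (cN : convex P N) (nN : normal N) (ND : N `<=` D).
Hypotheses (Pf1 : P f1) (Df1 : D f1) (nNf1 : ~ N f1).
Local Notation "g =~ h" := (eqm N g h) (at level 70).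
Hypothesis abD : forall x y, D x -> D y -> x * y =~ y * x.
Hypothesis rkD : forall p, P p -> D p -> ~ N p ->
  exists m k, p ^+ m.+1 =~ f1 ^+ k.+1.
Implicit Types (b c d f g h p t u v x y z : G).

Let Q := P `|` N.
Let cP : precone P := oP.1.
Let cD : convex P D. Proof. by case: mD. Qed.
Let sD : subgroup D := cD.1.
Let sN : subgroup N := cN.1.
Let cQ : precone Q := convex_precone cP cN.
Let resQ : residue Q = N := convex_residue oP cN.
Local Notation "g <~ h" := (le Q g h) (at level 70).
Local Notation "g <! h" := (lt Q g h) (at level 70).
Let le_trans := @le_trans G Q cQ.
Let le_lt_trans := @le_lt_trans G Q cQ.
Let lt_le_trans := @lt_le_trans G Q cQ.
Let ltW := @ltW G Q cQ.
Let refl := eqm_refl sN.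
Let trans := @eqm_trans G N sN.
Let sym := @eqm_sym G N sN.
Let mulm := @eqmM G N sN nN.

Let eqmE g h : g =~ h <-> same Q g h.
Proof. by rewrite same_residue resQ. Qed.

Let lt1E g : 1 <! g <-> P g /\ ~ N g.
Proof.
rewrite /lt /le mulg1; split=> [g1|[Pg nNg] Qg'].
  have nNg : ~ N g by move=> Ng; apply: g1; right; exact: subgroupV.
  by split=> //; case: (cP.2 g) => // Pg'; case: g1; left.
by apply: nNg; rewrite -resQ; split=> //; left.
Qed.

Let S b := D b /\ 1 <! b.

Let actD : abelian_action Q D.
Proof.
move=> a b Da Db y; have [] // : same Q (a * b * y) (b * a * y).
by apply/eqmE; apply: mulm (refl _); exact: abD.
Qed.

Lemma ab_ltX x y n : D x -> D y -> x <! y -> x ^+ n.+1 <! y ^+ n.+1.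
Proof.
move=> Dx Dy xy; rewrite !expgSr; apply: (@lt_le_trans (x ^+ n * y)); first by rewrite ltM.
apply: (ab_leMr cQ actD) => //; try exact: subgroupX.
by apply: (ab_leX cQ sD actD) => //; exact: ltW.
Qed.

Arguments ab_ltX {x y} n _ _ _ _.

Lemma D_cases g : D g -> [\/ N g, S g | S g^-1].
Proof.
move=> Dg; have [|nD1] := pselect (same Q 1 g); last have [|] := lt_total nD1.
- by rewrite same_residue resQ !gE; constructor 1.
- by constructor 2.
- move=> H; constructor 3; split; first exact: subgroupV.
  by move: H; rewrite /lt /le !gE.
Qed.

Lemma SX b n : S b -> S (b ^+ n.+1).
Proof.
move=> [Db b1]; split; first exact: subgroupX.
by have := ab_ltX n (subgroup1 sD) Db b1; rewrite expg1n.
Qed.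

Let Sf1 : S f1. Proof. by split=> //; apply/lt1E. Qed.

Lemma S_commensurable b c : S b -> S c -> exists m k, b ^+ m.+1 =~ c ^+ k.+1.
Proof.
move=> [Db /lt1E[Pb nNb]] [Dc /lt1E[Pc nNc]].
have [m [k bk]] := rkD Pb Db nNb; have [n [l cl]] := rkD Pc Dc nNc.
exact: (eqm_commensurable sN nN bk cl).
Qed.

Lemma S_archimedean u v : D u -> S v -> exists n, forall m, (n <= m)%N -> u <~ v ^+ m.
Proof.
move=> Du Sv; have [Dv v1] := Sv; have v1' := ltW v1.
suff [n un] : exists n, u <~ v ^+ n.
  by exists n => m nm; apply: le_trans un _; exact: posX_le.
have [Nu|Su|[_ u1]] := D_cases Du.
- exists 0; rewrite expg0; have [] // : same Q u 1.
  by apply/eqmE; apply/eqm1.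
- have [m [k uk]] := S_commensurable Su Sv; exists k.+1.
  have /eqmE[+ _] := uk; apply: le_trans.
  rewrite -{1}[u]expg1; apply: posX_le => //; exact: ltW Su.2.
- exists 0; rewrite expg0; apply: contrapT => /lt_nle H; apply: u1.
  by move: (ltW H); rewrite /le !gE.
Qed.

Section Preserving.
(** From here to [preserving_absurd]: conjugation by G preserves the order of
    D/N. As D/N has rank one, it is enough to say so for f1. *)
Hypothesis pres : forall g, P (g * f1 * g^-1).

Lemma S_conj g b : S b -> S (g * b * g^-1).
Proof.
move=> Sb; have [Db b1] := Sb; split; first exact: nD.
have Dgb := nD g Db.
have [Ngb|[]//|Sgb] := D_cases Dgb.
  have := nN g^-1 Ngb; rewrite !gE => Nb.
  by move: b1 => /lt1E[].
have [m [k bf]] := S_commensurable Sb Sf1.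
have [_ /lt1E[_]] := SX m Sgb.
have bf' : g * b ^+ m.+1 * g^-1 =~ g * f1 ^+ k.+1 * g^-1.
  by apply: mulm (refl _); apply: mulm (refl _) _.
case; rewrite expVgn; apply: (subgroupV sN); rewrite conj_expg -resQ; split.
  have : Q (g * f1 ^+ k.+1 * g^-1) by rewrite -conj_expg; left; exact: preconeX.
  move/eqmE: bf' => -[_ H1] H2.
  have := le_trans (_ : 1 <~ g * f1 ^+ k.+1 * g^-1) H1; rewrite /le !gE; exact.
have [_ /lt1E[+ _]] := SX m Sgb; rewrite expVgn conj_expg; by left.
Qed.

Lemma conj_le g x y : D x -> D y -> x <~ y -> g * x * g^-1 <~ g * y * g^-1.
Proof.
move=> Dx Dy xy; rewrite /le; have -> : (g * x * g^-1)^-1 * (g * y * g^-1) = g * (x^-1 * y) * g^-1.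
  by rewrite !gE.
have Dxy : D (x^-1 * y) by apply: (subgroupM sD) => //; exact: subgroupV.
have [Nxy|Sxy|[_ Sxy]] := D_cases Dxy.
- by right; exact: nN.
- by have [_ /ltW] := S_conj g Sxy; rewrite /le !gE.
- by case: Sxy; move: xy; rewrite /le !gE.
Qed.

Lemma conj_lt g x y : D x -> D y -> x <! y -> g * x * g^-1 <! g * y * g^-1.
Proof.
move=> Dx Dy xy H; apply: xy; have := conj_le g^-1 (nD g Dy) (nD g Dx) H; by rewrite !gE.
Qed.

Arguments conj_lt g {x y} _ _ _ _.

(** As the elements of D/N are commensurable, conjugation by g scales all of
    them by the same factor. *)
Lemma expand_uniform g b c : S b -> S c -> b <! g * b * g^-1 -> c <! g * c * g^-1.
Proof.
move=> Sb Sc bg; have [Db b1] := Sb; have [Dc c1] := Sc.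
move=> cg; have [m [k bc]] := S_commensurable Sb Sc.
have H1 := ab_ltX m Db (nD g Db) bg.
have H2 := ab_leX cQ sD actD k.+1 (nD g Dc) Dc cg.
rewrite conj_expg in H1; rewrite conj_expg in H2; apply: H1.
have bc' : g * b ^+ m.+1 * g^-1 =~ g * c ^+ k.+1 * g^-1.
  by apply: mulm (refl _); apply: mulm (refl _) _.
move/eqmE: bc => [_ H3]; move/eqmE: bc' => [H4 _].
exact: le_trans H4 (le_trans H2 H3).
Qed.

Definition expands g := forall b, S b -> b <! g * b * g^-1.

Lemma expands_X g n b : expands g -> S b -> b <! g ^+ n.+1 * b * g ^- n.+1.
Proof.
move=> eg Sb; elim: n => [|n IH]; first by rewrite expg1; exact: eg.
apply: (@lt_le_trans (g * b * g^-1)); first exact: eg.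
have [Db _] := Sb; apply: ltW; have := conj_lt g Db (nD (g ^+ n.+1) Db) IH.
have -> : g * (g ^+ n.+1 * b * (g ^+ n.+1)^-1) * g^-1 = g ^+ n.+2 * b * g ^- n.+2.
  by rewrite [g ^+ n.+2]expgS !gE.
exact.
Qed.

(** The factor by which g scales D/N is greater than 1, less than 1, or 1. *)
Lemma expands_or g : [\/ expands g, expands g^-1 | forall b, D b -> g * b =~ b * g].
Proof.
have [H|H] := pselect (f1 <! g * f1 * g^-1).
  by constructor 1 => b Sb; exact: expand_uniform H.
have [H'|H'] := pselect (g * f1 * g^-1 <! f1).
  constructor 2 => b Sb; apply: (expand_uniform Sf1 Sb).
  by have := conj_lt g^-1 (nD g Df1) Df1 H'; rewrite !gE.
constructor 3 => b Db.
have fix_S c : S c -> g * c =~ c * g.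
  move=> Sc; have [Dc _] := Sc; have : same Q c (g * c * g^-1).
    split; apply: contrapT => /lt_nle Hc.
      apply: H'; have Hc' : c <! g^-1 * c * g^-1^-1.
        by have := conj_lt g^-1 (nD g Dc) Dc Hc; rewrite !gE.
      have := conj_lt g Df1 (nD g^-1 Df1) (expand_uniform Sc Sf1 Hc'); by rewrite !gE.
    by apply: H; exact: expand_uniform Hc.
  move=> /eqmE /sym e; have := mulm e (refl g); by rewrite !gE.
have [Nb|Sb|Sb] := D_cases Db; [|exact: fix_S|].
- have /(eqm1 sN) b1 := Nb; apply: (@trans g).
    by have := mulm (refl g) b1; rewrite mulg1.
  by apply: sym; have := mulm b1 (refl g); rewrite mul1g.
- have e := fix_S _ Sb.
  have := mulm (mulm (refl b) (sym e)) (refl b); rewrite !gE => e'.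
  exact: e'.
Qed.


Let abG x y : eqm D (x * y) (y * x) := quotient_abelian oP dF mD nD x y.

Let Dcomm x y : D (x * y * x^-1 * y^-1).
Proof. by have := abG y^-1 x^-1; rewrite /eqm !gE. Qed.

(** If D is central modulo N, then [x^m, y] = [x, y]^m modulo N, so elements
    with commuting powers commute modulo N. As G/D has rank one, G/N is abelian,
    hence of rank one by [rank_one]: impossible, because D/N is a proper
    nontrivial convex subgroup of it. *)
Lemma not_central : ~ forall g b, D b -> g * b =~ b * g.
Proof.
move=> cent; have [f0 [Pf0 nDf0 rk0]] := top_generator oP dF mD nD.
have root x y m : x ^+ m.+1 * y =~ y * x ^+ m.+1 -> x * y =~ y * x.
  move=> xmy; have [z [xyz Dz]] : exists z, x * y = z * y * x /\ D z.
    by exists (x * y * x^-1 * y^-1); rewrite !gE; split=> //; exact: Dcomm.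
  have zX n : x ^+ n * y =~ z ^+ n * (y * x ^+ n).
    elim: n => [|n IH]; first by rewrite !expg0 !gE; exact: refl.
    rewrite expgSr -mulgA xyz; apply: (@trans (z * (x ^+ n * y) * x)).
      rewrite !mulgA; apply: (mulm _ (refl _)); apply: (mulm _ (refl _)); exact: cent.
    apply: (@trans (z * (z ^+ n * (y * x ^+ n)) * x)).
      by apply: (mulm _ (refl _)); apply: (mulm (refl _) IH).
    by rewrite [z ^+ n.+1]expgS !mulgA; exact: refl.
  have Nz : N z.
    apply: (convex_root (n := m) cP cN); apply/eqm1 => //.
    have := mulm (trans (sym (zX m.+1)) xmy) (refl (y * x ^+ m.+1)^-1).
    by rewrite mulgV mulgK.
  have /(eqm1 sN) z1 := Nz; have := mulm z1 (refl (y * x)).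
  by rewrite mul1g mulgA -xyz.
have c0 x : f0 * x =~ x * f0.
  suff pos p : P p -> f0 * p =~ p * f0.
    have [Px|Px] := cP.2 x; first exact: pos.
    apply: sym; rewrite -[x]invgK.
    by apply: (subgroupV (centralizer_mod_subgroup sN nN f0)); apply: sym; exact: pos.
  move=> Pp; have [Dp|nDp] := pselect (D p); first exact: cent.
  have [m [k pk]] := rk0 _ Pp nDp; apply: sym; apply: (root _ _ m).
  pose d := f0 ^- k.+1 * p ^+ m.+1.
  have Dd : D d by apply: (eqm_sym cD.1) pk.
  have -> : p ^+ m.+1 = f0 ^+ k.+1 * d by rewrite /d mulVKg.
  apply: (subgroupM (centralizer_mod_subgroup sN nN f0)).
    by rewrite /centralizer_mod /= -expgS -expgSr; exact: refl.
  by apply: sym; exact: cent.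
have abN x y : x * y =~ y * x.
  suff pos p : P p -> p * y =~ y * p.
    have [Px|Px] := cP.2 x; first exact: pos.
    rewrite -[x]invgK; apply: (subgroupV (centralizer_mod_subgroup sN nN y)); exact: pos.
  move=> Pp; have [Dp|nDp] := pselect (D p); first by apply: sym; exact: cent.
  have [m [k pk]] := rk0 _ Pp nDp; apply: (root _ _ m).
  pose d := f0 ^- k.+1 * p ^+ m.+1.
  have Dd : D d by apply: (eqm_sym cD.1) pk.
  have -> : p ^+ m.+1 = f0 ^+ k.+1 * d by rewrite /d mulVKg.
  apply: (subgroupM (centralizer_mod_subgroup sN nN y)).
    apply: (subgroupX k.+1 (centralizer_mod_subgroup sN nN y)); exact: c0.
  by apply: sym; exact: cent.
have [|e [Pe nNe rke]] := rank_one oP dF cN nN abN; first by exists f1.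
have [m [k fk]] := rke _ Pf1 nNf1.
have De : D e.
  apply: (convex_root (n := k) cP cD); rewrite -[e ^+ _](mulVKg (f1 ^+ m.+1)).
  by apply: (subgroupM sD); [exact: subgroupX|exact: ND].
have nNf0 : ~ N f0 by move=> /ND.
have [n [l fl]] := rke _ Pf0 nNf0; apply: nDf0; apply: (convex_root (n := n) cP cD).
rewrite -[f0 ^+ _](mulVKg (e ^+ l.+1)).
by apply: (subgroupM sD); [exact: subgroupX|apply: ND; exact: sym].
Qed.

(** The commutator of t and g. As a function of g it is a cocycle with values in
    D/N, on which G acts by conjugation. *)
Let kappa t g := t * g * t^-1 * g^-1.

(** When t expands D/N, the group G acts by affine maps on a line containing D/N
    and t has a single fixed point there. This precone is the preorder based at
    that fixed point, written without the line. *)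
Lemma kappa_precone t : precone [set g | 1 <~ kappa t g].
Proof.
have conj1 g x : D x -> 1 <~ x -> 1 <~ g * x * g^-1.
  by move=> Dx x1; have := conj_le g (subgroup1 sD) Dx x1; rewrite mulg1 mulgV.
split=> [g h tg th|g] /=.
  have -> : kappa t (g * h) = kappa t g * (g * kappa t h * g^-1) by rewrite /kappa !gE.
  apply: (le_trans tg); rewrite -{1}[kappa t g]mulg1 leM; apply: conj1 => //; exact: Dcomm.
have [|H] := le_total cQ 1 (kappa t g); first by left.
right; have -> : kappa t g^-1 = g^-1 * (kappa t g)^-1 * g^-1^-1 by rewrite /kappa !gE.
apply: conj1; first by apply: subgroupV => //; exact: Dcomm.
by move: H; rewrite /le !gE.
Qed.

(** The factors of f and u have positive powers in common, as D acts trivially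
    on D/N. *)
Lemma expands_commensurable u f i j : expands u ->
  eqm D (f ^+ i.+1) (u ^+ j.+1) -> expands f.
Proof.
move=> eu fu b Sb fb; have [Db _] := Sb.
have down n : f ^+ n * b * f ^- n <~ b.
  elim: n => [|n IH]; first by rewrite expg0 !gE; exact: le_refl.
  apply: le_trans fb; have := conj_le f (nD (f ^+ n) Db) Db IH.
  have -> // : f * (f ^+ n * b * (f ^+ n)^-1) * f^-1 = f ^+ n.+1 * b * f ^- n.+1.
  by rewrite expgS !gE.
apply: (expands_X (n := j) eu Sb); apply: le_trans (down i.+1).
pose d := u ^- j.+1 * f ^+ i.+1.
have Dd : D d by apply: (eqm_sym sD) fu.
have -> : f ^+ i.+1 = u ^+ j.+1 * d by rewrite /d mulVKg.
have /eqmE[_ +] : (u ^+ j.+1 * d) * b * (u ^+ j.+1 * d)^-1 =~ u ^+ j.+1 * b * u ^- j.+1.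
  have -> : (u ^+ j.+1 * d) * b * (u ^+ j.+1 * d)^-1 = u ^+ j.+1 * (d * b * d^-1) * u ^- j.+1.
    by rewrite !gE.
  apply: (mulm _ (refl _)); apply: (mulm (refl _)).
  by have := mulm (abD Dd Db) (refl d^-1); rewrite !gE.
exact.
Qed.

(** Conjugating t by D moves its fixed point along D/N. The elements of F in D
    move any point upwards or fix it. Those outside D are commensurable with t
    or t^-1 by [top_commensurable], so all of them expand or all of them
    contract, and they all move points upwards that are far enough on one side.
    So for w = c^n t, with c pointing to that side and n large, F is contained
    in the precone of [kappa_precone]. Its residue fixes the fixed point of w:
    it contains w and not f1, so it is not convex. *)
Lemma not_expands t : ~ expands t.
Proof.
move=> et.
have conjD d b : D d -> D b -> d * b * d^-1 =~ b.
  by move=> Dd Db; have := mulm (abD Dd Db) (refl d^-1); rewrite !gE.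
have nDt : ~ D t.
  by move=> Dt; have /eqmE[+ _] := conjD t f1 Dt Df1; exact: et.
(* c moves the fixed point of t towards the side on which the elements of P
   that are not in D become positive *)
have [c [Dc cS]] : exists c, D c /\
    forall f, P f -> ~ D f -> S (c * (f * c^-1 * f^-1)).
  have [Pt|Pt] := cP.2 t.
    exists f1^-1; split; first exact: subgroupV.
    move=> f Pf nDf; rewrite invgK; have [i [j fu]] := top_commensurable oP dF mD nD Pf nDf Pt nDt.
    have ef := expands_commensurable et fu; split.
      by apply: subgroupM => //; [exact: subgroupV|exact: nD].
    by rewrite -(ltM _ f1) mulg1 mulVKg; exact: ef.
  exists f1; split=> // f Pf nDf.
  have nDt' : ~ D t^-1 by move=> /(subgroupVE sD).
  have [i [j fu]] := top_commensurable oP dF mD nD Pf nDf Pt nDt'.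
  have ef : expands f^-1.
    apply: (expands_commensurable (i := i) (j := j) et).
    by have := eqmV sD nD fu; rewrite !expVgn invgK.
  have Dff := nD f Df1; split.
    by apply: subgroupM => //; apply: nD; exact: subgroupV.
  have H : f * f1 * f^-1 <! f1.
    have := conj_lt f Df1 (nD f^-1 Df1) (ef _ Sf1); by rewrite !gE.
  have : 1 <! (f * f1 * f^-1)^-1 * f1.
    by rewrite -(ltM _ (f * f1 * f^-1)) mulg1 mulVKg.
  have /eqmE[e _] := abD (subgroupV sD Dff) Df1.
  move=> /lt_le_trans/(_ e); by rewrite !gE.
pose v f := c * (f * c^-1 * f^-1).
have [n vn] : exists n, forall f, f \in F -> ~ D f -> (kappa t f)^-1 <~ v f ^+ n.
  suff [n H] : exists n, forall f, f \in F -> ~ D f ->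
      forall m, (n <= m)%N -> (kappa t f)^-1 <~ v f ^+ m.
    by exists n => f fF nDf; exact: H.
  have := dF.1; elim: (F) => [|f s IH] sP; first by exists 0.
  have [|n H] := IH; first by move=> g gs; apply: sP; rewrite inE gs orbT.
  have [Df|nDf] := pselect (D f).
    by exists n => g; rewrite inE => /orP[/eqP->|]; [|exact: H].
  have Sv := cS f (sP _ (mem_head _ _)) nDf.
  have [k Hk] := S_archimedean (subgroupV sD (Dcomm t f)) Sv.
  exists (maxn n k) => g; rewrite inE => /orP[/eqP-> _ m|gs nDg m]; rewrite geq_max => /andP[nm km].
    exact: Hk.
  exact: H.
pose w := c ^+ n * t.
have Dcn : D (c ^+ n) by exact: subgroupX.
have Fk f : f \in F -> 1 <~ kappa w f.
  move=> fF; have Pf := dF.1 _ fF; have [Df|nDf] := pselect (D f).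
    have : kappa w f =~ t * f * t^-1 * f^-1.
      have -> : kappa w f = c ^+ n * (t * f * t^-1) * c ^- n * f^-1 by rewrite /kappa /w !gE.
      by apply: (mulm _ (refl _)); apply: conjD => //; exact: nD.
    move=> /eqmE[_]; apply: le_trans; have [Nf|Sf|[_ Sf]] := D_cases Df.
    - have : N (t * f * t^-1 * f^-1) by apply: subgroupM => //; [exact: nN|exact: subgroupV].
      by rewrite /le !gE; right.
    - have /eqmE[+ _] := abD (subgroupV sD Df) (nD t Df); apply: le_trans.
      rewrite -(leM _ f) mulg1 mulVKg; apply: ltW; exact: et.
    - by case: Sf; rewrite /le !gE; left.
  have : kappa w f =~ kappa t f * v f ^+ n.
    have -> : kappa w f = c ^+ n * kappa t f * (f * c^-1 * f^-1) ^+ n.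
      have -> : (f * c^-1 * f^-1) ^+ n = f * c ^- n * f^-1.
        by rewrite conj_expg expVgn.
      by rewrite /kappa /w !gE.
    apply: (@trans (kappa t f * (c ^+ n * (f * c^-1 * f^-1) ^+ n))).
      rewrite (mulgA (kappa t f) (c ^+ n)); apply: (mulm _ (refl _)); apply: abD => //; exact: Dcomm.
    apply: (mulm (refl _)); apply: sym; apply: eqm_commute_X => //.
    by apply: abD => //; apply: nD; exact: subgroupV.
  move=> /eqmE[_]; apply: le_trans.
  by rewrite -(leM _ (kappa t f)^-1) mulg1 mulKg; exact: vn.
(* the residue of this precone is convex and contains w, hence f1 *)
have cw := kappa_precone w.
have cvR := residue_convex cw (dF.2 _ cw Fk).
have ww : residue [set g | 1 <~ kappa w g] w.
  by split=> /=; rewrite /kappa !gE; exact: le_refl.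
have nDw : ~ D w by move=> /(subgroupMl sD Dcn).
have [/= h1 h2] := maxconvex_full mD cvR ww nDw f1.
have kf : kappa w f1 =~ t * f1 * t^-1 * f1^-1.
  have -> : kappa w f1 = c ^+ n * (t * f1 * t^-1) * c ^- n * f1^-1 by rewrite /kappa /w !gE.
  by apply: (mulm _ (refl _)); apply: conjD => //; exact: nD.
have Nk : N (kappa w f1).
  rewrite -resQ; split; first by move: h1; rewrite /le invg1 mul1g.
  have e : f1 * kappa w f1^-1 * f1^-1 = (kappa w f1)^-1 by rewrite /kappa !gE.
  have := conj_le f1 (subgroup1 sD) (Dcomm w f1^-1) h2.
  by rewrite e mulg1 mulgV /le invg1 mul1g.
have : N (t * f1 * t^-1 * f1^-1) by apply/(eqm_mem sN kf).
move=> /(nN f1^-1); rewrite !gE => Nf.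
have /eqmE[_] : f1 =~ t * f1 * t^-1 by rewrite /eqm !gE.
exact: et.
Qed.

Lemma preserving_absurd : False.
Proof.
apply: not_central => g; have [/not_expands//|/not_expands//|] := expands_or g.
exact.
Qed.

End Preserving.

(** Otherwise conjugation preserves the order of D/N, and each element of G
    either expands or contracts D/N or centralizes it. *)
Lemma exists_inverting : exists t, forall b, P b -> D b -> ~ N b -> P (t * b^-1 * t^-1).
Proof.
have [t nPt] : exists t, ~ P (t * f1 * t^-1).
  by apply: contrapT => /forallNP H; apply: preserving_absurd => g; apply: contrapT; exact: H.
exists t => b Pb Db nNb.
have Pt : P (t * f1^-1 * t^-1) by case: (cP.2 (t * f1 * t^-1)); rewrite ?gE.
have nNt x : ~ N x -> ~ N (t * x * t^-1) by move=> nNx /(nN t^-1); rewrite !gE.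
have Dtb := nD t Db; have [Ntb|Stb|[_ /lt1E[]]] := D_cases Dtb; last by rewrite !gE.
  by case: (nNt _ nNb).
have St : S (t * f1^-1 * t^-1).
  split; first by apply: nD; exact: subgroupV.
  by apply/lt1E; split=> //; apply: nNt => /(subgroupVE sN).
have [m [k bf]] := S_commensurable (conj Db (proj2 (lt1E b) (conj Pb nNb))) Sf1.
have [_ H1] := SX m Stb; have [_ H2] := SX k St.
have [] : False; apply: H2; rewrite conj_expg expVgn.
have bf' : t * b ^+ m.+1 * t^-1 =~ t * f1 ^+ k.+1 * t^-1.
  by apply: (mulm _ (refl _)); apply: (mulm (refl _)).
rewrite conj_expg in H1; move/eqmE: bf' => [+ _] => /(le_trans (ltW H1)).
by rewrite /le !gE.
Qed.

End Inverting.

(** * All left orders of the group *)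

(** Lets a statement cover an order and its reverse at once. *)
Definition sgn (G : groupType) (s : bool) (x : G) := if s then x else x^-1.

Section Signs.
Variable G : groupType.
Implicit Types (g x y : G) (C : set G).

Lemma sgnJ s g x : g * sgn s x * g^-1 = sgn s (g * x * g^-1).
Proof. by case: s => //=; rewrite !gE. Qed.

Lemma sgnVJ s g x : g^-1 * sgn s x * g = sgn s (g^-1 * x * g).
Proof. by case: s => //=; rewrite !gE. Qed.

Lemma sgn_mem C s x : subgroup C -> C (sgn s x) <-> C x.
Proof.
by move=> sC; case: s => //=; split=> [/(subgroupVE sC)|/(subgroupV sC)].
Qed.

Lemma sgnX s x n : sgn s (x ^+ n) = sgn s x ^+ n.
Proof. by case: s => //=; rewrite expVgn. Qed.

Lemma sgn_neg s x : (sgn s x)^-1 = sgn (~~ s) x.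
Proof. by case: s => //=; rewrite invgK. Qed.

Lemma sgnV s x : sgn s x^-1 = (sgn s x)^-1.
Proof. by case: s. Qed.

Lemma sgnNK s x : sgn s (sgn (~~ s) x) = x^-1.
Proof. by case: s => //=; rewrite invgK. Qed.

Lemma sgnK s x : sgn s (sgn s x) = x.
Proof. by case: s => //=; rewrite invgK. Qed.

End Signs.

Section Extension.
Variables (G : groupType) (P D : set G) (F : seq G).
Hypotheses (oP : order_cone P) (dF : determines F P) (mD : maxconvex P D).
Hypothesis nD : normal D.
Implicit Types (b c d e f g h p t x y z : G) (C : set G).
Variable E : seq G.
Hypothesis ED : forall g, g \in E -> D g.
Hypothesis conjE : forall R, precone_on D R -> exists2 g, g \in E &
  exists s, forall x, D x -> P x -> R (g^-1 * sgn s x * g).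
Hypothesis nrm : forall C, convex P C -> C `<=` D ->
  forall d x, D d -> C x -> C (d * x * d^-1).

Let cP : precone P := oP.1.
Let cD : convex P D. Proof. by case: mD. Qed.
Let sD : subgroup D := cD.1.

Lemma eqmD_conj g x : eqm D (g * x * g^-1) x.
Proof.
have := quotient_abelian oP dF mD nD x g => xg.
have := eqmM sD nD (eqm_sym sD xg) (eqm_refl sD g^-1); by rewrite !gE.
Qed.

Section Normal.
Definition order_conj k := exists s, forall x, D x -> P x -> P (k^-1 * sgn s x * k).

Lemma order_conjV k : order_conj k -> order_conj k^-1.
Proof.
move=> [s H]; exists s => x Dx Px; rewrite invgK sgnJ.
have [//|Pn] := cP.2 (sgn s (k * x * k^-1)).
have Dk : D (sgn (~~ s) (k * x * k^-1)) by apply/sgn_mem => //; exact: nD.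
rewrite sgn_neg in Pn; have := H _ Dk Pn; rewrite sgnVJ.
have -> : k^-1 * sgn (~~ s) (k * x * k^-1) * k = sgn (~~ s) x by rewrite sgnVJ !gE.
rewrite sgnNK => Px'; rewrite (oP.2 _ Px Px') !gE; case: (s) => /=; rewrite ?invg1; exact: precone1.
Qed.

Lemma order_conj_convex k C : order_conj k -> convex P C -> C `<=` D ->
  convex P [set x | C (k^-1 * x * k)].
Proof.
move=> [s H] cC CD; have sC := cC.1; split; first split.
- by rewrite /= !gE; exact: subgroup1.
- move=> x y Cx Cy /=; have -> : k^-1 * (x * y) * k = (k^-1 * x * k) * (k^-1 * y * k).
    by rewrite !gE.
  exact: subgroupM.
- move=> x Cx /=; have -> : k^-1 * x^-1 * k = (k^-1 * x * k)^-1 by rewrite !gE.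
  exact: subgroupV.
- move=> x y Px Pxy /= Cy.
  have Dy : D y by have := nD k (CD _ Cy); rewrite !gE.
  have Dx := cD.2 _ _ Px Pxy Dy.
  have Dxy : D (x^-1 * y) by apply: (subgroupM sD) => //; exact: subgroupV.
  have H1 := H _ Dx Px; have H2 := H _ Dxy Pxy; case: s {H} H1 H2 => /= H1 H2.
    apply: (cC.2 _ _ H1 _ Cy); move: H2; by rewrite !gE.
  apply: (convex_between cC (a := k^-1 * y * k) (b := 1)) => //; last exact: subgroup1.
    by move: H2; rewrite /le !gE.
  by move: H1; rewrite /le !gE.
Qed.

(** The sets of the x with k^n x k^-n in C form a chain of convex subgroups. If
    the second did not contain the first, they would descend strictly. *)
Lemma order_conj_normal k C : order_conj k -> convex P C -> C `<=` D ->
  forall x, C x -> C (k * x * k^-1).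
Proof.
move=> ok cC CD; have ok' := order_conjV ok.
pose Cn n : set G := [set x | C (k ^+ n * x * k ^- n)].
have CnD n : Cn n `<=` D.
  move=> x /CD; rewrite -{1}[k ^+ n]invgK; move=> /(nD (k ^- n)); by rewrite !gE.
have cCn n : convex P (Cn n).
  elim: n => [|n IH].
    suff -> : Cn 0 = C by [].
    by rewrite predeqE => x; rewrite /Cn /= expg0 !gE.
  have := order_conj_convex ok' IH (CnD n).
  suff -> : Cn n.+1 = [set x | Cn n (k^-1^-1 * x * k^-1)] by [].
  by rewrite predeqE => x; rewrite /Cn /= expgSr !gE.
have C0 x : Cn 0 x <-> C x by rewrite /Cn /= expg0 !gE.
have [C01|C10] := convex_sub cP (cCn 0) (cCn 1%N).
  by move=> x /C0 /C01; rewrite /Cn /= expg1.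
move=> x Cx; apply: contrapT => nCk.
have dec n : Cn n.+1 `<=` Cn n.
  move=> y; have := C10 (k ^+ n * y * k ^- n).
  by rewrite /Cn /= expg1 expg0 expgS !gE.
apply: (no_decreasing_convex oP dF cCn dec) => n.
exists (k ^- n * x * k ^+ n); first by rewrite /Cn /= !gE.
by rewrite /Cn /= expgS !gE.
Qed.

(** By [conjE] the order of D and its conjugate by g differ by an element e of
    D, so that e g preserves or reverses the order of D. *)
Lemma sub_convex_normal C : convex P C -> C `<=` D -> normal C.
Proof.
move=> cC CD g x Cx.
have cR : precone_on D [set x | P (g^-1 * x * g)].
  split=> [a b _ _ Pa Pb|a _] /=.
    have -> : g^-1 * (a * b) * g = (g^-1 * a * g) * (g^-1 * b * g) by rewrite !gE.
    exact: cP.1.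
  by have := cP.2 (g^-1 * a * g); rewrite !gE.
have [e eE [s H]] := conjE cR; have De := ED eE.
have ok : order_conj (e * g).
  by exists s => y Dy Py; have := H y Dy Py; rewrite /= !gE.
have := order_conj_normal ok cC CD Cx.
move=> /(nrm cC CD (subgroupV sD De)); by rewrite !gE.
Qed.

End Normal.

Lemma all_convex_normal C : convex P C -> normal C.
Proof.
move=> cC; have [_ _ /(_ _ cC) [|->//]] := mD; exact: sub_convex_normal.
Qed.


Let P_out_coset x y : P x -> ~ D x -> eqm D x y -> P y.
Proof.
move=> Px nDx xy; have cQ := convex_precone cP cD.
have : (P `|` D) (x * (x^-1 * y)) by apply: cQ.1; [left|right].
by rewrite mulVKg => -[//|/(eqm_mem sD xy)].
Qed.

(** G/D has rank one, so the sign of a single element fixes an order of it. *)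
Lemma top_sign R : order_cone R -> convex R D ->
  exists s, forall p, P p -> ~ D p -> R (sgn s p).
Proof.
move=> [cR aR] cDR; have [f0 [Pf0 nDf0 rk0]] := top_generator oP dF mD nD.
have main r : R (sgn r f0) -> forall p, P p -> ~ D p -> R (sgn r p).
  move=> Rf p Pp nDp; have [//|Rp] := cR.2 (sgn r p).
  have [m [k pk]] := rk0 _ Pp nDp; case: nDp.
  apply: (convex_root (n := m) cP cD); apply/(sgn_mem r (p ^+ m.+1) sD); apply: (subgroupVE sD).
  apply: (cDR.2 _ ((sgn r (p ^+ m.+1))^-1 * sgn r (f0 ^+ k.+1))).
  - by rewrite sgnX -expVgn; exact: preconeX.
  - by rewrite invgK mulVKg sgnX; exact: preconeX.
  - case: (r) => //=; apply: (eqmV sD nD) pk.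
have [Rf|Rf] := cR.2 f0; first by exists true; exact: (main true).
by exists false; exact: (main false).
Qed.

Section Bottom.
Variables (N : set G) (f1 t : G).
Hypotheses (cN : convex P N) (ND : N `<=` D) (Pf1 : P f1) (Df1 : D f1) (nNf1 : ~ N f1).
Hypothesis abD : forall x y, D x -> D y -> eqm N (x * y) (y * x).
Hypothesis rkD : forall p, P p -> D p -> ~ N p ->
  exists m k, eqm N (p ^+ m.+1) (f1 ^+ k.+1).
Hypothesis invt : forall b, P b -> D b -> ~ N b -> P (t * b^-1 * t^-1).
Variable R : set G.
Hypothesis oR : order_cone R.

Let cR : precone R := oR.1.
Let sN : subgroup N := cN.1.
Let nN : normal N := sub_convex_normal cN ND.

(** N is convex in D for R as well: by [conjE], R is on D a conjugate of P or of
    its reverse. *)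
Let RN x y : R x -> R y -> D x -> D y -> N (x * y) -> N x.
Proof.
have [e eE [s H]] := conjE (precone_onT D cR); have De := ED eE.
have key z : D z -> R (e^-1 * z * e) -> P (sgn s z).
  move=> Dz Rz; have [//|Pz] := cP.2 (sgn s z).
  rewrite sgn_neg in Pz; have Dz' : D (sgn (~~ s) z) by apply/sgn_mem.
  have := H _ Dz' Pz; rewrite sgnNK.
  have -> : e^-1 * z^-1 * e = (e^-1 * z * e)^-1 by rewrite !gE.
  move=> Rz'; have : e * (e^-1 * z * e) * e^-1 = 1 by rewrite (oR.2 _ Rz Rz') !gE.
  by rewrite !gE => ->; case: (s) => /=; rewrite ?invg1; exact: precone1.
move=> Rx Ry Dx Dy Nxy.
have De' z : D z -> D (e * z * e^-1) by exact: nD.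
have Kx : P (sgn s (e * x * e^-1)) by apply: key; [exact: De'|rewrite !gE].
have Ky : P (sgn s (e * y * e^-1)) by apply: key; [exact: De'|rewrite !gE].
suff : N (e * x * e^-1) by move=> /(nN e^-1); rewrite !gE.
have Nxy' := nN e Nxy.
case: (s) Kx Ky => /= Kx Ky.
  by apply: (cN.2 _ (e * (x * y) * e^-1) Kx) => //; rewrite !gE.
suff : N (e * y * e^-1).
  move=> Ny; apply: (subgroupMr sN Ny); by rewrite !gE; move: Nxy'; rewrite !gE.
apply: (subgroupVE sN); apply: (cN.2 _ (e * (x * y) * e^-1)^-1 Ky).
  by move: Kx; rewrite !gE.
exact: subgroupV.
Qed.

Let bottom_sign : exists s, forall b, P b -> D b -> ~ N b -> R (sgn s b).
Proof.
have main r : R (sgn r f1) -> forall b, P b -> D b -> ~ N b -> R (sgn r b).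
  move=> Rf b Pb Db nNb; have [//|Rb] := cR.2 (sgn r b).
  have [m [k bk]] := rkD Pb Db nNb.
  have Dm : D (sgn r (b ^+ m.+1)) by apply/sgn_mem => //; exact: subgroupX.
  have Dk : D (sgn r (f1 ^+ k.+1)) by apply/sgn_mem => //; exact: subgroupX.
  have : N (sgn r (b ^+ m.+1))^-1.
    apply: (@RN _ (sgn r (f1 ^+ k.+1))) => //.
    - by rewrite sgnX -expVgn; exact: preconeX.
    - by rewrite sgnX; exact: preconeX.
    - exact: subgroupV.
    - case: (r) => //=; exact: (eqmV sN nN bk).
  move=> /(subgroupVE sN)/(sgn_mem _ _ sN) Nb; case: nNb; apply: (cN.2 _ (b ^+ m.+1)) => //.
  by rewrite expgS mulKg; exact: preconeX.
have [Rf|Rf] := cR.2 f1; first by exists true; exact: (main true).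
by exists false; exact: (main false).
Qed.

Let flips h := forall b, D b -> ~ N b -> R b -> R (h * b^-1 * h^-1).

Let exists_positive_out : exists b, [/\ D b, ~ N b & R b].
Proof.
have [Rf|Rf] := cR.2 f1; first by exists f1.
exists f1^-1; split=> //; first exact: subgroupV.
by move=> /(subgroupVE sN).
Qed.

Let flips_t : flips t.
Proof.
have [s Hs] := bottom_sign.
have PR b : D b -> ~ N b -> R (sgn s b) -> P b.
  move=> Db nNb Rb; have [//|Pb] := cP.2 b; have Db' := subgroupV sD Db.
  have nNb' : ~ N b^-1 by move=> /(subgroupVE sN).
  have := Hs _ Pb Db' nNb'; rewrite sgnV => Rb'; case: nNb; apply/(sgn_mem s b sN); rewrite (oR.2 _ Rb Rb').
  exact: subgroup1.
move=> b Db nNb Rb.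
have nNs : ~ N (sgn s b) by move=> /(sgn_mem _ _ sN).
have Ds : D (sgn s b) by apply/sgn_mem.
have Pb : P (sgn s b) by apply: PR => //; rewrite sgnK.
have := invt Pb Ds nNs; rewrite -sgnV sgnJ => Ptb.
have nNt : ~ N (sgn s (t * b^-1 * t^-1)).
  move=> /(sgn_mem _ _ sN) /(nN t^-1); rewrite !gE; by move=> /(subgroupVE sN).
have Dt : D (sgn s (t * b^-1 * t^-1)).
  by apply/sgn_mem => //; apply: nD; exact: subgroupV.
by have := Hs _ Ptb Dt nNt; rewrite sgnK.
Qed.

Let Rconj d b : D d -> D b -> ~ N b -> R b -> R (d * b * d^-1).
Proof.
move=> Dd Db nNb Rb; have [//|Rd] := cR.2 (d * b * d^-1); case: nNb.
have Dd' := subgroupV sD Dd.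
apply: (RN Rb Rd Db); first by apply: (subgroupV sD); exact: nD.
by have := nN (d * b) (abD Dd Db); rewrite !gE.
Qed.

Let flips_mul d h : D d -> flips h -> flips (d * h).
Proof.
move=> Dd fh b Db nNb Rb; have := fh b Db nNb Rb => Rh.
have -> : d * h * b^-1 * (d * h)^-1 = d * (h * b^-1 * h^-1) * d^-1 by rewrite !gE.
apply: Rconj => //; first by apply: nD; exact: subgroupV.
by move=> /(nN h^-1); rewrite !gE; move=> /(subgroupVE sN).
Qed.

Let flipsV h : flips h -> flips h^-1.
Proof.
move=> fh b Db nNb Rb; rewrite invgK; have [//|Rh] := cR.2 (h^-1 * b^-1 * h).
have Rh' : R (h^-1 * b * h) by move: Rh; rewrite !gE.
have Dh : D (h^-1 * b * h) by have := nD h^-1 Db; rewrite invgK.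
have nNh : ~ N (h^-1 * b * h) by move=> /(nN h); rewrite !gE.
have := fh _ Dh nNh Rh'; rewrite !gE => Rb'.
by case: nNb; rewrite (oR.2 _ Rb Rb'); exact: subgroup1.
Qed.

Let flips1 : ~ flips 1.
Proof.
move=> f; have [b [Db nNb Rb]] := exists_positive_out; apply: (nNb).
have := f _ Db nNb Rb; rewrite !gE => Rb'.
by rewrite (oR.2 _ Rb Rb'); exact: subgroup1.
Qed.

Let archR c d : D c -> D d -> ~ N d -> R d -> exists n, R (c^-1 * d ^+ n).
Proof.
move=> Dc Dd nNd Rd; have Dc' := subgroupV sD Dc.
have small z : N z -> R (z * d).
  move=> Nz; have [//|Rz] := cR.2 (z * d); case: nNd.
  rewrite invgM in Rz; apply: (RN Rd Rz Dd).
    by apply: (subgroupM sD); apply: (subgroupV sD) => //; exact: ND.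
  by rewrite mulVKg; exact: subgroupV.
have [Nc|nNc] := pselect (N c).
  by exists 1%N; rewrite expg1; apply: small; exact: subgroupV.
have [Rc|Rc] := cR.2 c; last by exists 0; rewrite expg0 mulg1.
have [m [k ck]] : exists m k, eqm N (c ^+ m.+1) (d ^+ k.+1).
  have [s Hs] := bottom_sign.
  have PR b : D b -> ~ N b -> R b -> P (sgn s b).
    move=> Db nNb Rb; have [//|Pb] := cP.2 (sgn s b); rewrite sgn_neg in Pb.
    have nNb' : ~ N (sgn (~~ s) b) by move=> /(sgn_mem _ _ sN).
    have Db' : D (sgn (~~ s) b) by apply/sgn_mem.
    have := Hs _ Pb Db' nNb'.
    by rewrite sgnNK => Rb'; case: nNb; rewrite (oR.2 _ Rb Rb'); exact: subgroup1.
  have rk b : D b -> ~ N b -> R b -> exists m k, eqm N (b ^+ m.+1) (sgn s (f1 ^+ k.+1)).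
    move=> Db nNb Rb; have nNs : ~ N (sgn s b) by move=> /(sgn_mem _ _ sN).
    have Ds : D (sgn s b) by apply/sgn_mem.
    have [m [k bk]] := rkD (PR b Db nNb Rb) Ds nNs; exists m, k.
    rewrite -sgnX in bk; case: (s) bk => //= bk.
    by have := eqmV sN nN bk; rewrite invgK.
  have [m [k ck]] := rk c Dc nNc Rc; have [n [l dl]] := rk d Dd nNd Rd.
  by rewrite !sgnX in ck dl; exact: (eqm_commensurable sN nN ck dl).
exists k.+2; pose z := c ^- m.+1 * d ^+ k.+1.
have -> : c^-1 * d ^+ k.+2 = c ^+ m * (z * d).
  by rewrite /z [d ^+ k.+2]expgSr [c ^+ m.+1]expgS !gE.
by apply: cR.1; [exact: preconeX|apply: small].
Qed.

(** With b positive outside N and d = h b^-1 h^-1, which is positive too, h =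
    d^n h b^n is above d^n for every n, and the powers of d are cofinal in D. *)
Let flips_above h c : flips h -> R h -> D c -> R (c^-1 * h).
Proof.
move=> fh Rh Dc.
have [b [Db nNb Rb]] := exists_positive_out.
pose d := h * b^-1 * h^-1.
have Rd : R d by exact: fh.
have Dd : D d by apply: nD; exact: subgroupV.
have nNd : ~ N d by move=> /(nN h^-1); rewrite /d !gE => /(subgroupVE sN).
have [n Rn] := archR Dc Dd nNd Rd.
have hb : h * b ^+ n = d ^- n * h.
  elim: n {Rn} => [|n IH]; first by rewrite !expg0 !gE.
  rewrite expgSr mulgA IH -!mulgA expgS invgM.
  have -> : h * b = d^-1 * h by rewrite /d !gE.
  by rewrite !mulgA.
have -> : c^-1 * h = (c^-1 * d ^+ n) * (h * b ^+ n) by rewrite hb !gE.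
by apply: cR.1 => //; apply: cR.1 => //; exact: preconeX.
Qed.

Let flips_below h c : flips h -> R h^-1 -> D c -> R (h^-1 * c).
Proof.
move=> fh Rh Dc; have [|H] := cR.2 (h^-1 * c); first by [].
have Dc' := subgroupV sD Dc.
have Rch : R (c^-1 * h) by move: H; rewrite !gE.
have := flips_above (flips_mul Dc' fh) Rch Dc'; rewrite !gE => Rh'.
by case: flips1; rewrite -(oR.2 _ Rh' Rh).
Qed.

(** Let x lie between 1 and an element of D. If x is not in D, some power of x
    is congruent modulo D to a power of t or t^-1, hence lies above or below the
    whole of D by [flips_above]. But x is positive and its powers are bounded by
    elements of D. *)
Lemma order_convex : convex R D.
Proof.
split=> // x y Rx Rxy Dy; apply: contrapT => nDx.
have nDt : ~ D t.
  move=> Dt; have [b [Db nNb Rb]] := exists_positive_out.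
  have := flips_t Db nNb Rb; have := Rconj Dt Db nNb Rb => R1.
  have -> : t * b^-1 * t^-1 = (t * b * t^-1)^-1 by rewrite !gE.
  move=> R2; case: nNb; have := congr1 (fun z => t^-1 * z * t) (oR.2 _ R1 R2).
  by rewrite !gE => ->; exact: subgroup1.
(* some positive power of x is, modulo D, a positive power of u = t or u = t^-1 *)
have [u [fu [m [k xu]]]] : exists u, flips u /\ exists m k, eqm D (x ^+ m.+1) (u ^+ k.+1).
  have PT z : P z \/ P z^-1 := cP.2 z.
  have com p q : ~ D p -> ~ D q -> P p -> P q ->
      exists m k, eqm D (p ^+ m.+1) (q ^+ k.+1).
    by move=> nDp nDq Pp Pq; exact: (top_commensurable oP dF mD nD).
  have nV p : ~ D p -> ~ D p^-1 by move=> nDp /(subgroupVE sD).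
  have V p q m k : eqm D (p^-1 ^+ m) (q ^+ k) -> eqm D (p ^+ m) (q^-1 ^+ k).
    by move=> /(eqmV sD nD); rewrite !expVgn invgK.
  case: (PT x) (PT t) => [Px|Px] [Pt|Pt].
  - by exists t; split=> //; exact: com.
  - by exists t^-1; split; [exact: flipsV|exact: com (nV _ nDt) Px Pt].
  - exists t^-1; split; first exact: flipsV.
    by have [m [k /V]] := com _ _ (nV _ nDx) nDt Px Pt; exists m, k.
  - exists t; split=> //.
    have [m [k /V]] := com _ _ (nV _ nDx) (nV _ nDt) Px Pt; rewrite invgK.
    by exists m, k.
pose d := x ^+ m.+1 * u ^- k.+1.
have Dd : D d.
  have := eqmM sD nD xu (eqm_refl sD (u ^- k.+1)); rewrite mulgV -/d.
  by move/(eqm1 sD).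
have xd : x ^+ m.+1 = d * u ^+ k.+1 by rewrite /d mulgVK.
(* the powers of x are bounded by elements of D *)
have bnd n : exists2 c, D c & R (x ^- n * c).
  elim: n => [|n [c Dc Rc]]; first by exists 1; [exact: subgroup1|rewrite expg0 !gE; exact: precone1].
  exists (x * c * x^-1 * y); first by apply: (subgroupM sD) => //; exact: nD.
  have -> : x ^- n.+1 * (x * c * x^-1 * y) = (x ^- n * c) * (x^-1 * y).
    by rewrite expgS !gE.
  exact: cR.1.
have Rxm : R (x ^+ m.+1) by exact: preconeX.
have [Ru|Ru] := cR.2 u.
  have above c : D c -> R (c^-1 * x ^+ m.+1).
    move=> Dc; have -> : c^-1 * x ^+ m.+1 = ((d^-1 * c)^-1 * u) * u ^+ k.
      by rewrite xd expgS !gE.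
    apply: cR.1; last exact: preconeX.
    by apply: flips_above => //; apply: subgroupM => //; exact: subgroupV.
  have [c Dc Rc] := bnd m.+1.
  have R1 z : D z -> R z^-1.
    move=> Dz; have := above (c * z) (subgroupM sD Dc Dz).
    by move=> H; have := cR.1 _ _ H Rc; rewrite !gE.
  have R1f := R1 _ Df1; have := R1 _ (subgroupV sD Df1); rewrite invgK => R2f.
  by apply: nNf1; rewrite (oR.2 _ R2f R1f); exact: subgroup1.
have Rxm' : R (x ^- m.+1).
  have -> : x ^- m.+1 = u^-1 ^+ k * (u^-1 * d^-1).
    by rewrite xd expVgn expgS !gE.
  apply: cR.1; first exact: preconeX.
  by apply: flips_below => //; exact: subgroupV.
by apply: nDx; apply: (convex_root (n := m) cP cD); rewrite (oR.2 _ Rxm Rxm'); exact: subgroup1.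
Qed.

(** R is known from its restriction to D and from its sign on G/D. Conjugation
    by t changes the sign on D and not the sign on G/D, so with the conjugators
    e and e t all combinations of signs are reached. *)
Lemma order_conj_top : exists2 g, g \in E ++ [seq e * t | e <- E] &
  exists s, forall x, P x -> R (g^-1 * sgn s x * g).
Proof.
have [r Hr] := top_sign oR order_convex.
have out g x : P x -> ~ D x -> R (g^-1 * sgn r x * g).
  move=> Px nDx; rewrite sgnVJ; apply: Hr.
    apply: (P_out_coset Px nDx); apply: (eqm_sym sD).
    by have := eqmD_conj g^-1 x; rewrite invgK.
  by move=> /(nD g); rewrite !gE.
have [e eE [s He]] := conjE (precone_onT D cR).
have [rs|rs] := eqVneq r s.
  exists e; first by rewrite mem_cat eE.
  exists s => x Px; have [Dx|nDx] := pselect (D x); first exact: He.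
  by rewrite -rs; exact: out.
have cR2 : precone [set x | R (t^-1 * x * t)].
  split=> [a b Ra Rb|a] /=.
    have -> : t^-1 * (a * b) * t = (t^-1 * a * t) * (t^-1 * b * t) by rewrite !gE.
    exact: cR.1.
  by have := cR.2 (t^-1 * a * t); rewrite !gE.
have [e' eE' [s' He']] := conjE (precone_onT D cR2).
exists (e' * t); first by rewrite mem_cat; apply/orP; right; apply/mapP; exists e'.
exists r => x Px; have [Dx|nDx] := pselect (D x); last exact: out.
have [rs'|rs'] := eqVneq r s'.
  by have := He' x Dx Px; rewrite rs' /= invgM !mulgA.
(* both conjugators cannot have the same sign, as t reverses D/N *)
have ss : s' = s by case: (r) (s) (s') rs rs' => [] [] [].
subst s'; exfalso.
pose a := sgn s f1; have Da : D a by apply/sgn_mem.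
have nNa : ~ N a by move=> /(sgn_mem _ _ sN).
have De := ED eE; have De' := ED eE'.
have R1 : R (e^-1 * a * e) := He _ Df1 Pf1.
have R2 : R (t^-1 * (e'^-1 * a * e') * t) := He' _ Df1 Pf1.
have conjN d : D d -> eqm N (d^-1 * a * d) a.
  move=> Dd; have := eqmM sN nN (eqm_refl sN d^-1) (abD Da Dd); by rewrite !gE.
have D1 : D (e^-1 * a * e) by have := nD e^-1 Da; rewrite invgK.
have nN1 : ~ N (e^-1 * a * e) by move=> /(eqm_mem sN (conjN _ De)).
have R3 := flipsV flips_t D1 nN1 R1; rewrite invgK in R3.
have D' x' : D x' -> D (t^-1 * x' * t) by move=> /(nD t^-1); rewrite invgK.
have D2 : D (e'^-1 * a * e') by have := nD e'^-1 Da; rewrite invgK.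
have : N (t^-1 * (e'^-1 * a * e') * t).
  apply: (RN R2 R3); [exact: D'|apply: D'; exact: subgroupV|].
  have : N ((e'^-1 * a * e') * (e^-1 * a * e)^-1).
    have := eqmM sN nN (eqm_trans sN (conjN _ De') (eqm_sym sN (conjN _ De))) (eqm_refl sN (e^-1 * a * e)^-1).
    by rewrite mulgV => /(eqm1 sN).
  by move=> /(nN t^-1); rewrite !gE.
move=> /(nN t); rewrite !gE => H; apply: nNa; apply/(eqm_mem sN (conjN _ De')).
exact: H.
Qed.

End Bottom.

Lemma order_conj_trivial R : (forall x, D x -> x = 1) -> order_cone R ->
  exists s, forall x, P x -> R (1^-1 * sgn s x * 1).
Proof.
move=> D1 oR; have cDR : convex R D.
  split=> // x y Rx + Dy; rewrite (D1 _ Dy) mulg1 => Rx'.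
  by rewrite (oR.2 _ Rx Rx'); exact: subgroup1.
have [s Hs] := top_sign oR cDR; exists s => x Px; rewrite !gE.
have [/D1 ->|nDx] := pselect (D x); last exact: Hs.
by case: (s) => /=; rewrite ?invg1; exact: precone1 oR.1.
Qed.

End Extension.

Section Tame.
Variables (G : groupType) (P : set G).

(** An order cone that contains another one is equal to it. So this leaves
    finitely many orders on G; stated for precones, it can be applied to the
    order of D induced from any base point of G/D. *)
Definition finitely_conjugate := exists E : seq G, forall R, precone R ->
  exists2 g, g \in E & exists s, forall x, P x -> R (g^-1 * sgn s x * g).

Definition rank_one_over (D N : set G) := exists f1,
  [/\ P f1 /\ D f1, ~ N f1, forall x y, D x -> D y -> eqm N (x * y) (y * x) &
      forall p, P p -> D p -> ~ N p -> exists m k, eqm N (p ^+ m.+1) (f1 ^+ k.+1)].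

(** The step from D to G needs the topmost factor D/N of D, to find an element
    that reverses it. There is no such factor when D is trivial. *)
Definition top_rank_one (D : set G) := (forall x, D x -> x = 1) \/
  exists N, [/\ convex P N, N `<=` D & rank_one_over D N].

End Tame.

Section Step.
Variables (G : groupType) (P D : set G) (F : seq G).
Hypotheses (oP : order_cone P) (dF : determines F P) (mD : maxconvex P D).
Variable E : seq G.
Hypothesis ED : forall g, g \in E -> D g.
Hypothesis conjE : forall R, precone_on D R -> exists2 g, g \in E &
  exists s, forall x, D x -> P x -> R (g^-1 * sgn s x * g).
Hypothesis nrm : forall C, convex P C -> C `<=` D ->
  forall d x, D d -> C x -> C (d * x * d^-1).
Hypothesis topD : top_rank_one P D.
Hypothesis series : has_abelian_layers G.

Lemma tame_step : [/\ finitely_conjugate P, forall C, convex P C -> normal C &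
  top_rank_one P setT].
Proof.
have nD : normal D.
  apply: (maxconvex_normal oP dF mD ED _ nrm series) => R /conjE[g gE [[] H]].
    by exists g => //; left.
  by exists g => //; right.
have cD : convex P D by case: mD.
split.
- have [E' HE] : exists E' : seq G, forall R, order_cone R -> exists2 g, g \in E' &
      exists s, forall x, P x -> R (g^-1 * sgn s x * g).
    case: topD => [D1|[N [cN ND [f1 [[Pf1 Df1] nNf1 abD rkD]]]]].
      exists [:: 1] => R oR; exists 1; first exact: mem_head.
      exact: (order_conj_trivial oP dF mD nD D1).
    have nN := sub_convex_normal oP dF mD nD ED conjE nrm cN ND.
    have [t invt] := exists_inverting oP dF mD nD cN nN ND Pf1 Df1 nNf1 abD rkD.
    exists (E ++ [seq e * t | e <- E]) => R oR.
    exact: (order_conj_top oP dF mD nD ED conjE nrm cN ND Pf1 Df1 nNf1 abD rkD invt oR).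
  exists E' => R cR; have [g gE [s H]] := HE _ (tiebreak_order_cone cR oP).
  by exists g => //; exists s => x /H [].
- by move=> C; exact: (all_convex_normal oP dF mD nD ED conjE nrm).
- right; exists D; split=> //.
  have [f0 [Pf0 nDf0 rk]] := top_generator oP dF mD nD.
  exists f0; split=> // [x y _ _|p Pp _ nDp]; first exact: quotient_abelian oP dF mD nD x y.
  exact: rk.
Qed.

End Step.

(** * Induction over the size of the determining set *)

Section SubgroupType.
Variables (G : groupType) (D : set G).

Definition in_subgroup : pred G := fun x => `[< D x >].

(** The proof is a parameter of the type so that the group structure can be
    inferred from it. *)
Definition subgroup_type & subgroup D : Type := {x : G | in_subgroup x}.

Variable sD : subgroup D.

Lemma in_subgroup_closed : group_closed in_subgroup.
Proof.
split=> [|x y].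
  by rewrite unfold_in; apply/asboolP; exact: subgroup1.
rewrite !unfold_in => /asboolP Dx /asboolP Dy; apply/asboolP.
by apply: subgroupM => //; exact: subgroupV.
Qed.

HB.instance Definition _ := SubChoice.on (subgroup_type sD).
HB.instance Definition _ :=
  SubChoice_isSubGroup.Build G in_subgroup (subgroup_type sD) in_subgroup_closed.

End SubgroupType.

Section Restriction.
Variables (G : groupType) (D : set G) (sD : subgroup D).
Let T : groupType := subgroup_type sD.
Let v : T -> G := val.

Lemma val_mem (x : T) : D (v x).
Proof. by have := valP x => /asboolP. Qed.

Definition lift_sub x (Dx : D x) : T := Sub x (asboolT Dx).

Lemma val_lift_sub x (Dx : D x) : v (lift_sub Dx) = x.
Proof. exact: SubK. Qed.

Lemma sub_val1 : v 1 = 1. Proof. exact: gmulf1. Qed.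
Lemma sub_valM x y : v (x * y) = v x * v y. Proof. exact: gmulfM. Qed.
Lemma sub_valV x : v x^-1 = (v x)^-1. Proof. exact: gmulfV. Qed.
Lemma sub_valX x n : v (x ^+ n) = v x ^+ n. Proof. exact: gmulfXn. Qed.
Lemma sub_val_inj : injective v. Proof. exact: val_inj. Qed.

Let pull (R : set G) : set T := [set x | R (v x)].
Let push (R : set T) : set G := [set x | exists2 y, R y & v y = x].

Lemma pull_precone R : precone_on D R -> precone (pull R).
Proof.
move=> [RM RV]; split=> [x y Rx Ry|x]; rewrite /pull /= ?sub_valM ?sub_valV.
  by apply: RM => //; exact: val_mem.
by apply: RV; exact: val_mem.
Qed.

Lemma push_val R x : push R (v x) <-> R x.
Proof. by split=> [[y Ry /sub_val_inj <-]|Rx]; last exists x. Qed.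

Lemma push_mem R x : push R x -> D x.
Proof. by move=> [y _ <-]; exact: val_mem. Qed.

Lemma push_precone_on R : precone R -> precone_on D (push R).
Proof.
move=> [RM RV]; split=> [g h _ _ [x Rx <-] [y Ry <-]|x Dx].
  by exists (x * y); [exact: RM|rewrite sub_valM].
rewrite -(val_lift_sub Dx) -sub_valV; have [H|H] := RV (lift_sub Dx); [left|right]; exact/push_val.
Qed.

Lemma pull_convex P C : convex P C -> convex (pull P) (pull C).
Proof.
move=> [sC cC]; split; first split.
- by rewrite /pull /= sub_val1; exact: subgroup1.
- by move=> x y Cx Cy; rewrite /pull /= sub_valM; exact: subgroupM.
- by move=> x Cx; rewrite /pull /= sub_valV; exact: subgroupV.
- by move=> x y Px Pxy Cy; apply: (cC _ (v y)) => //; move: Pxy; rewrite /pull /= sub_valM sub_valV.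
Qed.

Lemma push_convex P C : convex P D -> convex (pull P) C -> convex P (push C).
Proof.
move=> cD [sC cC]; split; first split.
- by exists 1; [exact: subgroup1|exact: sub_val1].
- by move=> _ _ [x Cx <-] [y Cy <-]; exists (x * y); [exact: subgroupM|rewrite sub_valM].
- by move=> _ [x Cx <-]; exists x^-1; [exact: subgroupV|rewrite sub_valV].
- move=> x z Px Pxy [y Cy yz]; rewrite -{}yz in Pxy; have Dx := cD.2 _ _ Px Pxy (val_mem y).
  exists (lift_sub Dx); last exact: val_lift_sub.
  by apply: (cC _ y); rewrite // /pull /= ?sub_valM ?sub_valV val_lift_sub.
Qed.

Section Determined.
Variables (P : set G) (F : seq G).
Hypotheses (oP : order_cone P) (dF : determines F P) (cD : convex P D).

Definition pull_seq : seq T := pmap insub F.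

Lemma mem_pull_seq x : (x \in pull_seq) = (v x \in F).
Proof. exact: mem_pmap_sub. Qed.

Lemma size_pull_seq f : f \in F -> ~ D f -> (size pull_seq < size F)%N.
Proof.
move=> fF nDf; rewrite size_pmap_sub ltn_neqAle count_size andbT.
rewrite -all_count; apply/negP => /allP /(_ _ fF); by move=> /asboolP.
Qed.

Lemma pull_order_cone : order_cone (pull P).
Proof.
split; first exact: pull_precone (precone_onT D oP.1).
move=> x Px Px'; apply: sub_val_inj; rewrite sub_val1; apply: oP.2 => //; by rewrite -sub_valV.
Qed.

Lemma pull_determines : determines pull_seq (pull P).
Proof.
split=> [f|R cR FR x Px]; first by rewrite mem_pull_seq => /dF.1.
apply/push_val; apply: (determines_on oP.1 dF cD (push_precone_on cR)) => //.
  move=> f fF Df; rewrite -(val_lift_sub Df); apply/push_val; apply: FR.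
  by rewrite mem_pull_seq val_lift_sub.
exact: val_mem.
Qed.

End Determined.

Lemma push_finitely_conjugate P : finitely_conjugate (pull P) ->
  exists2 E : seq G, forall g, g \in E -> D g &
  forall R, precone_on D R -> exists2 g, g \in E &
    exists s, forall x, D x -> P x -> R (g^-1 * sgn s x * g).
Proof.
move=> [E HE]; exists (map v E) => [g /mapP[x _ ->]|R cR]; first exact: val_mem.
have [g gE [s H]] := HE _ (pull_precone cR); exists (v g); first exact: map_f.
exists s => x Dx Px; have := H (lift_sub Dx); rewrite /pull /= val_lift_sub => /(_ Px).
have vs y : v (sgn s y) = sgn s (v y) by case: (s) => //=; exact: sub_valV.
by rewrite !sub_valM sub_valV vs val_lift_sub.
Qed.

Lemma push_normal P : (forall C, convex (pull P) C -> normal C) ->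
  forall C, convex P C -> C `<=` D -> forall d x, D d -> C x -> C (d * x * d^-1).
Proof.
move=> H C cC CD d x Dd Cx; have := H _ (pull_convex cC) (lift_sub Dd) (lift_sub (CD _ Cx)).
by rewrite /pull /= !sub_valM sub_valV !val_lift_sub; exact.
Qed.

Lemma push_top_rank_one P : convex P D -> top_rank_one (pull P) setT -> top_rank_one P D.
Proof.
move=> cD [T1|[N [cN _ [f1 [[Pf1 _] nNf1 abN rkN]]]]].
  by left=> x Dx; rewrite -(val_lift_sub Dx) (T1 (lift_sub Dx)) // sub_val1.
have eqmP x y : eqm N x y -> eqm (push N) (v x) (v y).
  by move=> xy; rewrite /eqm -sub_valV -sub_valM; exact/push_val.
right; exists (push N); split; first exact: push_convex.
  by move=> x /push_mem.
exists (v f1); split; first by split=> //; exact: val_mem.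
- by move/push_val.
- move=> x y Dx Dy; have := eqmP _ _ (abN (lift_sub Dx) (lift_sub Dy) I I).
  by rewrite !sub_valM !val_lift_sub.
- move=> p Pp Dp nNp; have [|||m [k pk]] := rkN (lift_sub Dp) => //.
  + by move=> Nl; apply: nNp; rewrite -(val_lift_sub Dp); exact/push_val.
  + by exists m, k; have := eqmP _ _ pk; rewrite !sub_valX val_lift_sub.
Qed.

End Restriction.

(** A series of normal subgroups of G with abelian factors, such that G is
    torsion modulo its first term. All of this passes to subgroups by
    restriction, as the induction requires. *)
Definition virtually_polyabelian (G : groupType) := exists (N : nat -> set G) n,
  [/\ forall i, subgroup (N i) /\ normal (N i), forall g, exists m, N 0 (g ^+ m.+1),
      forall i x y, N i x -> N i y -> N i.+1 [~ x, y] & forall x, N n x -> x = 1].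

(** Take the last term of the series that is not contained in K. *)
Lemma polyabelian_layers (G : groupType) :
  virtually_polyabelian G -> has_abelian_layers G.
Proof.
move=> [N [n [sN powN comN N1]]] K sK nK.
have [N0K|/existsNP[a /not_implyP[Na nKa]]] := pselect (N 0 `<=` K).
  by left=> g; have [m /N0K] := powN g; exists m.
right; have : N n `<=` K by move=> x /N1 ->; exact: subgroup1.
elim: n {N1} => [/(_ a Na)//|n IH NnK].
have [/IH //|/existsNP[b /not_implyP[Nb nKb]]] := pselect (N n `<=` K).
exists (N n); split; [exact: (sN n).1|exact: (sN n).2|by exists b|].
by move=> x y Nx Ny; apply: NnK; exact: comN.
Qed.

Lemma polyabelian_subgroup (G : groupType) (D : set G) (sD : subgroup D) :
  virtually_polyabelian G -> virtually_polyabelian (subgroup_type sD).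
Proof.
move=> [N [n [sN powN comN N1]]].
exists (fun i => [set x | N i (val x)]), n; split=> [i|g|i x y Nx Ny|x /N1].
- have [sNi nNi] := sN i; split; first split.
  + exact: (subgroup1 sNi).
  + by move=> x y Nx Ny; exact: (subgroupM sNi Nx Ny).
  + by move=> x Nx; exact: (subgroupV sNi Nx).
  + by move=> g x Nx; exact: (nNi (val g) _ Nx).
- by have [m Nm] := powN (val g); exists m; rewrite /mkset sub_valX.
- exact: (comN i _ _ Nx Ny).
- by move=> x1; apply: sub_val_inj; rewrite sub_val1.
Qed.

(** The largest proper convex subgroup D misses an element of F, so the order of
    D is determined by fewer elements. *)
Theorem determined_tame (G : groupType) (P : set G) (F : seq G) :
  virtually_polyabelian G -> order_cone P -> determines F P ->
  [/\ finitely_conjugate P, forall C, convex P C -> normal C & top_rank_one P setT].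
Proof.
have [n] := ubnP (size F); elim: n G P F => [//|n IH] G P F sF pG oP dF.
have [nontriv|triv] := pselect (exists g : G, g <> 1); last first.
  have G1 (x : G) : x = 1 by apply: contrapT => x1; apply: triv; exists x.
  split.
  - exists [:: 1] => R cR; exists 1; first exact: mem_head.
    by exists true => x _; rewrite (G1 (_ * _)); exact: precone1.
  - by move=> C _ g x; rewrite (G1 (_ * _)) (G1 x).
  - by left=> x _; exact: G1.
have [D mD] := exists_maxconvex oP dF nontriv.
have [cD DT _] := mD; have sD := cD.1.
have [f fF nDf] := determines_proper oP dF cD DT.
have sF' : (size (pull_seq sD F) < n)%N.
  by apply: leq_trans (size_pull_seq sD fF nDf) _; rewrite -ltnS.
have [fc nc tc] := IH _ _ _ sF' (polyabelian_subgroup sD pG)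
  (pull_order_cone sD oP) (pull_determines sD oP dF cD).
have [E ED conjE] := push_finitely_conjugate fc.
apply: (tame_step oP dF mD ED conjE (push_normal nc) (push_top_rank_one cD tc)).
exact: polyabelian_layers.
Qed.

(** * Virtually solvable groups *)

Section VirtuallySolvable.
Variable G : groupType.
Implicit Types (g h x y : G) (H : set G).

Lemma derived_subgroup_subgroup H : subgroup (derived_subgroup H).
Proof.
split.
- by move=> M [sM _]; exact: subgroup1.
- by move=> x y Hx Hy M sM; apply: (subgroupM sM.1); [exact: Hx|exact: Hy].
- by move=> x Hx M sM; apply: (subgroupV sM.1); exact: Hx.
Qed.

(** For a fixed x, two of the cosets g^i x H coincide, which gives an exponent
    for x. It depends only on the coset of x, and the product of the exponents
    over all cosets works for every x. *)
Lemma finite_index_power H : subgroup H -> finite_index H ->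
  forall g, exists m, forall x, H (x^-1 * g ^+ m.+1 * x).
Proof.
move=> sH fH g; pose coset x := [set x * h | h in H].
have cosetP x y : coset x = coset y -> H (x^-1 * y).
  move=> xy; have : coset x y by rewrite xy; exists 1; [exact: subgroup1|rewrite mulg1].
  by move=> [h Hh <-]; rewrite mulKg.
have cosetP' x y : H (x^-1 * y) -> coset x = coset y.
  move=> xy; rewrite predeqE => z; split=> [[h Hh <-]|[h Hh <-]].
    exists (y^-1 * x * h); last by rewrite !gE.
    by apply: subgroupM => //; have := subgroupV sH xy; rewrite !gE.
  by exists (x^-1 * y * h); [exact: subgroupM|rewrite !gE].
have single x : exists k, H (x^-1 * g ^+ k.+1 * x).
  apply: contrapT => /forallNP nH.
  apply: infinite_nat; rewrite (_ : setT = (fun i => coset (g ^+ i * x)) @^-1` range coset).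
    apply: finite_preimage => // i j _ _ /=.
    wlog: i j / (i <= j)%N.
      by move=> W e; have [ij|/ltnW ji] := leqP i j; [exact: W|apply/esym/W].
    rewrite leq_eqVlt => /predU1P[//|ij] /cosetP; rewrite invgM.
    have -> : x^-1 * (g ^+ i)^-1 * (g ^+ j * x) = x^-1 * g ^+ (j - i).-1.+1 * x.
      rewrite prednK ?subn_gt0 // -{1}(subnKC (ltnW ij)) expgnDr !gE; by [].
    by move=> /nH.
  by rewrite predeqE => i; split=> // _; exists (g ^+ i * x).
have [s sE] := (finite_seqP _).1 fH.
suff [m Hm] : exists m, forall x, coset x \in s -> H (x^-1 * g ^+ m.+1 * x).
  exists m => x; apply: Hm; have : range coset (coset x) by exists x.
  by rewrite -[range coset]/(range (fun x => coset x)) sE.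
elim: (s) => [|c s' [m Hm]]; first by exists 0.
have powH x k n : H (x^-1 * g ^+ k * x) -> H (x^-1 * g ^+ (k * n) * x).
  move=> Hk; rewrite expgnA; have -> : x^-1 * (g ^+ k) ^+ n * x = (x^-1 * g ^+ k * x) ^+ n.
    by have := conj_expg x^-1 (g ^+ k) n; rewrite invgK.
  exact: subgroupX.
have [[z zc]|nz] := pselect (exists z, coset z = c); last first.
  exists m => x; rewrite inE => /predU1P[xc|]; last exact: Hm.
  by case: nz; exists x.
have [k Hk] := single z; exists (m.+1 * k.+1).-1 => x.
rewrite prednK // inE => /predU1P[|/Hm/powH //].
rewrite -zc => /cosetP xz; rewrite mulnC; apply: powH.
have -> : x^-1 * g ^+ k.+1 * x = (x^-1 * z) * (z^-1 * g ^+ k.+1 * z) * (x^-1 * z)^-1.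
  by rewrite !gE.
by apply: subgroupM => //; [exact: subgroupM|exact: subgroupV].
Qed.

(** The series consists of the normal cores of the derived subgroups of H. *)
Lemma virtually_solvable_polyabelian : virtually_solvable G -> virtually_polyabelian G.
Proof.
move=> [H [sH [n Hn] fH]]; pose S i := iter i (@derived_subgroup G) H.
have sS i : subgroup (S i) by case: i => [//|i]; exact: derived_subgroup_subgroup.
exists (fun i => [set x | forall g, S i (g^-1 * x * g)]), n; split=> [i|g|i x y Nx Ny g|x Nx].
- split; first split=> [g|x y Nx Ny g|x Nx g].
  + by rewrite !gE; exact: subgroup1.
  + have -> : g^-1 * (x * y) * g = (g^-1 * x * g) * (g^-1 * y * g) by rewrite !gE.
    exact: subgroupM.
  + have -> : g^-1 * x^-1 * g = (g^-1 * x * g)^-1 by rewrite !gE.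
    exact: subgroupV.
  + by move=> h x Nx g; have := Nx (h^-1 * g); rewrite !gE.
- by have [m Hm] := finite_index_power sH fH g; exists m.
- move=> M [sM]; apply; exists (g^-1 * x * g); first exact: Nx.
  exists (g^-1 * y * g); first exact: Ny.
  by rewrite /commg /conjg !gE.
- by have := Nx 1; rewrite /S Hn !gE.
Qed.

End VirtuallySolvable.

(** * The space of left orders *)

Section OrderSpace.
Variable G : groupType.
Implicit Types (g h x y : G) (P : set G) (o : left_ordering G).

Definition cone o : set G := [set g | o 1 g].

Lemma cone_order_cone o : order_cone (cone o).
Proof.
have [r a t tot inv] := lo_leP o; rewrite /cone; split; first split.
- move=> g h /= g1 h1; apply: (t g) => //; have := inv _ _ g h1; by rewrite mulg1.
- move=> g /=; have /orP[|g1] := tot 1 g; first by left.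
  by right; have := inv _ _ g^-1 g1; rewrite mulVg mulg1.
- move=> g /= g1 g1'; apply: a; apply/andP; split=> //.
  by have := inv _ _ g g1'; rewrite mulgV mulg1.
Qed.

Lemma cone_le o g h : o g h <-> cone o (g^-1 * h).
Proof.
have [_ _ _ _ inv] := lo_leP o; split=> [gh|H].
  by have := inv _ _ g^-1 gh; rewrite mulVg.
by have := inv _ _ g H; rewrite mulg1 mulVKg.
Qed.

Lemma cone_inj : injective cone.
Proof.
move=> o o' e; apply: left_ordering_inj; apply/funext => g; apply/funext => h.
by apply/idP/idP => /cone_le; [rewrite e|rewrite -e]; move=> H; apply/cone_le.
Qed.

Lemma cone_surj P : order_cone P -> exists o, cone o = P.
Proof.
move=> oP; have [cP aP] := oP; pose r : rel G := fun g h => `[< P (g^-1 * h) >].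
have rP : is_left_ordering r.
  split.
  - by move=> g; apply/asboolP; rewrite mulVg; exact: precone1.
  - move=> g h /andP[/asboolP gh /asboolP hg].
    have := aP _ gh; rewrite invgM invgK => /(_ hg) e.
    by rewrite -[h](mulVKg g) e mulg1.
  - move=> h g k /asboolP gh /asboolP hk; apply/asboolP.
    by have := cP.1 _ _ gh hk; rewrite !gE.
  - move=> g h; apply/orP; have := cP.2 (g^-1 * h); rewrite invgM invgK.
    by move=> [H|H]; [left|right]; apply/asboolP.
  - by move=> g h k /asboolP gh; apply/asboolP; rewrite !gE.
exists (LeftOrdering rP); rewrite predeqE => g; rewrite /cone /= /r invg1 mul1g.
by split=> [/asboolP|H] //; apply/asboolP.
Qed.

Lemma cone1 o : cone o 1. Proof. exact: precone1 (cone_order_cone o).1. Qed.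

(** Comparable order cones are equal, so an order is fixed by the conjugator and
    the sign that embed P in its cone. *)
Lemma finitely_conjugate_finite P : order_cone P -> finitely_conjugate P ->
  finite_set [set: left_ordering G].
Proof.
move=> oP [E HE]; have [o0 _] := cone_surj oP.
pose S := [set gs : G * bool | gs.1 \in E].
pose phi (gs : G * bool) := xget o0 [set o | forall x, P x -> cone o (gs.1^-1 * sgn gs.2 x * gs.1)].
have fS : finite_set S.
  apply: (sub_finite_set _ (finite_setX (finite_seq E) (@finite_finset bool setT))).
  by move=> [g s].
apply: (sub_finite_set _ (finite_image phi fS)) => o _.
have [g gin [s H]] := HE _ (cone_order_cone o).1; exists (g, s) => //.
rewrite /phi; case: xgetP => [o' _ /= H'|/(_ o)]; last by case.
have key (q q' : left_ordering G) :
    (forall x, P x -> cone q (g^-1 * sgn s x * g)) ->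
    (forall x, P x -> cone q' (g^-1 * sgn s x * g)) -> cone q `<=` cone q'.
  move=> Hq Hq' x qx; pose z := sgn s (g * x * g^-1).
  have zx : g^-1 * sgn s z * g = x by rewrite /z sgnK !gE.
  have [Pz|Pz] := oP.1.2 z; first by have := Hq' _ Pz; rewrite zx.
  have := Hq _ Pz; rewrite sgnV.
  have -> : g^-1 * (sgn s z)^-1 * g = (g^-1 * sgn s z * g)^-1 by rewrite !gE.
  by rewrite zx => qx'; rewrite ((cone_order_cone q).2 _ qx qx'); exact: cone1.
by apply: cone_inj; rewrite eqEsubset; split; exact: key.
Qed.

Lemma lo_basic_open (F : {fset G}) : open (lo_basic F).
Proof.
exists [set F] => //; rewrite predeqE => o; split=> [[K ->]|Fo] //.
by exists F.
Qed.

Lemma open_lo_basic (A : set (left_ordering G)) o : open A -> A o ->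
  exists F : {fset G}, lo_basic F o /\ lo_basic F `<=` A.
Proof.
move=> [D _ <-] [F DF Fo]; exists F; split=> // o' Fo'; by exists F.
Qed.

(** A precone Q containing F gives the order that compares by Q first and breaks
    ties by the isolated order. It also makes F positive, hence is the isolated
    order, whose cone is then contained in Q. *)
Lemma isolated_determines o : open [set o] -> exists F, determines F (cone o).
Proof.
move=> oo; have [F [Fo FA]] := open_lo_basic oo erefl.
exists (enum_fset F); split=> [f fF|Q cQ FQ]; first exact: Fo.
have [o' e] := cone_surj (tiebreak_order_cone cQ (cone_order_cone o)).
suff q : o' = o by rewrite -q e => g [].
apply: FA => f fF; have : cone o' f by rewrite e; split=> [|_]; [exact: FQ|exact: Fo].
by [].
Qed.

Definition positive_at g : set (left_ordering G) := [set o | cone o g].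

Lemma positive_at_open g : open (positive_at g).
Proof.
suff -> : positive_at g = lo_basic [fset g]%fset by exact: lo_basic_open.
rewrite predeqE => o; split=> [H f|]; first by rewrite inE => /eqP ->.
by apply; rewrite inE.
Qed.

Lemma positive_at_clopen g : clopen (positive_at g).
Proof.
split; first exact: positive_at_open.
rewrite -openC; have [->|g1] := pselect (g = 1).
  rewrite (_ : ~` _ = set0); first exact: open0.
  by rewrite predeqE => o; split=> // /(_ (cone1 o)).
rewrite (_ : ~` _ = positive_at g^-1); first exact: positive_at_open.
rewrite predeqE => o; have [[_ tot] a] := cone_order_cone o; split=> [ng|g' gg].
  by have [/ng//|] := tot g.
exact/g1/(a g).
Qed.

Lemma positive_at_separates o o' : o <> o' -> exists g, positive_at g o /\ ~ positive_at g o'.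
Proof.
move=> oo'; apply: contrapT => /forallNP H; apply: oo'; apply: cone_inj.
have sub : cone o `<=` cone o' by move=> g og; apply: contrapT => ng; exact: (H g).
rewrite eqEsubset; split=> // g o'g; have [[_ tot] _] := cone_order_cone o.
have [//|/sub g'] := tot g; rewrite ((cone_order_cone o').2 _ o'g g'); exact: cone1.
Qed.

Lemma left_ordering_hausdorff : hausdorff_space (left_ordering G).
Proof.
rewrite open_hausdorff => x y /eqP /positive_at_separates[g [xg yg]].
have [og cg] := positive_at_clopen g.
exists (positive_at g, ~` positive_at g); first by rewrite !inE.
by split=> //=; [rewrite openC|rewrite setICr].
Qed.

(** An ultrafilter of orders converges to the order that makes g positive when
    the ultrafilter does. *)
Lemma left_ordering_compact : compact [set: left_ordering G].
Proof.
rewrite compact_ultra => F UF _.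
pose P : set G := [set g | F (positive_at g)].
have oP : order_cone P.
  split; first split=> [g h Pg Ph|g].
  - apply: filterS (filterI Pg Ph) => o [og oh]; exact: (cone_order_cone o).1.1.
  - have [|ng] := in_ultra_setVsetC (positive_at g) UF; first by left.
    right; apply: filterS ng => o ng; by have [] := (cone_order_cone o).1.2 g.
  - move=> g Pg Pg'; have [o [og og']] := filter_ex (filterI Pg Pg').
    exact: (cone_order_cone o).2 og og'.
have [o oE] := cone_surj oP; exists o; split=> // A.
rewrite nbhsE => -[B [oB Bo] BA]; apply: filterS BA _.
have [K [Ko KB]] := open_lo_basic oB Bo; apply: filterS KB _.
have -> : lo_basic K = \bigcap_(g in [set` K]) positive_at g.
  by rewrite predeqE => q; split.
apply: filter_bigI => g gK; have : cone o g by exact: Ko.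
by rewrite oE.
Qed.

End OrderSpace.

(** * Perfect compact spaces with a countable separating family of clopen sets *)

Section CantorCharacterization.
Variables (X : ptopologicalType) (U : nat -> set X).
Hypotheses (cptX : compact [set: X]) (hsdfX : hausdorff_space X).
Hypothesis clopenU : forall n, clopen (U n).
Hypothesis sepU : forall x y : X, x <> y -> exists n, U n x /\ ~ U n y.
Hypothesis perfX : forall x : X, ~ open [set x].

Let splits n (V : set X) := U n `&` V !=set0 /\ ~` U n `&` V !=set0.

(** At level n of the tree V is divided by [U n] whenever this is possible. So
    each set of the family is used on every branch, and the branches separate
    points. When [U n] does not divide V, another set of the family does,
    because V is not a single point. *)
Let cut n V := if pselect (splits n V) then n else xget 0 [set k | splits k V].

Let refine n V (e : bool) := (if e then U (cut n V) else ~` U (cut n V)) `&` V.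

Let invar (V : set X) := clopen V /\ V !=set0.

Lemma exists_splits V : open V -> V !=set0 -> exists k, splits k V.
Proof.
move=> oV [x Vx]; have [y Vy yx] : exists2 y, V y & y <> x.
  apply: contrapT => H; apply: (@perfX x); suff -> : [set x] = V by [].
  rewrite eqEsubset; split=> [_ -> //|y Vy]; apply: contrapT => yx; apply: H.
  by exists y.
by have [n [Uy nUx]] := sepU yx; exists n; split; [exists y|exists x].
Qed.

Lemma cut_splits n V : invar V -> splits (cut n V) V.
Proof.
move=> [[oV _] V0]; rewrite /cut; case: pselect => [//|b] /=.
by case: xgetP => // H; have [k] := exists_splits oV V0; case/(H k).
Qed.

(** Cutting X repeatedly in two nonempty clopen pieces gives a map to the space
    of binary sequences that is continuous, onto and injective; it is closed as
    X is compact. *)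
Lemma homeomorphic_cantor : homeomorphic X cantor_space.
Proof.
have [||||||f [cf sf injf]] := @tree_map_props (fun=> bool) X refine invar cptX hsdfX.
- move=> n V; rewrite eqEsubset; split=> x; last by case=> e _; case.
  move=> Vx; have [Ux|nUx] := pselect (U (cut n V) x); [by exists true|by exists false].
- move=> n V e iV; have [[oV cV] V0] := iV; have [H1 H2] := cut_splits n iV.
  split; last by case: e.
  apply: clopenI; last by [].
  by case: e; [|apply: clopenC].
- by move=> V [].
- by split; [exact: clopenT|exists point].
- by move=> V [[]].
- move=> x y /eqP /sepU[n [Ux nUy]]; exists n => V e [Hx Vx] [Hy Vy].
  have sp : splits n V by split; [exists x|exists y].
  by move: Hx Hy; rewrite /cut; case: pselect => [a|//] /=; case: e.
have {}injf : injective f.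
  move=> x y fxy; apply: injf; rewrite ?inE //.
  by move=> n V [] [] _ _ // [z [[? _] [? _]]].
have fK (y : X) : {x | f x = y} by apply: cid; have [x _] := sf y I; exists x.
pose g y := projT1 (fK y).
have gK : cancel g f by move=> y; exact: projT2 (fK y).
have fgK : cancel f g by move=> x; apply: injf; exact: gK.
exists g, f; split=> //.
rewrite continuous_closedP => A cA.
have -> : g @^-1` A = f @` A.
  rewrite eqEsubset; split=> [y Ay|_ [x Ax <-]]; first by exists (g y).
  by rewrite /preimage /= fgK.
apply: (compact_closed hsdfX); apply: continuous_compact.
  exact: continuous_subspaceT.
exact: subclosed_compact cA cantor_space_compact _.
Qed.

End CantorCharacterization.

(** Carries the base point, which the space of orders of an arbitrary group does
    not have. *)
Definition pointed_orders (G : groupType) (o0 : left_ordering G) : Type := left_ordering G.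
HB.instance Definition _ G (o0 : left_ordering G) := Topological.on (pointed_orders o0).
HB.instance Definition _ G (o0 : left_ordering G) := isPointed.Build (pointed_orders o0) o0.

Theorem theorem1p1 (Gamma : groupType) :
  countable [set: Gamma] -> virtually_solvable Gamma ->
  finite_set [set: left_ordering Gamma] \/
  homeomorphic (left_ordering Gamma) cantor_space.
Proof.
move=> cG vG; have [[o0 _]|/forallNP no] := pselect (exists o : left_ordering Gamma, True); last first.
  by left; rewrite (_ : setT = set0) // predeqE => o; split=> // _; exact: (no o).
have [[o oo]|perf] := pselect (exists o : left_ordering Gamma, open [set o]).
  left; have [F dF] := isolated_determines oo.
  have [fc _ _] := determined_tame (virtually_solvable_polyabelian vG) (cone_order_cone o) dF.
  exact: finitely_conjugate_finite (cone_order_cone o) fc.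
right; have [e eT] : exists e : nat -> Gamma, range e = setT.
  have /countable_injP[f injf] := cG; exists (fun n => xget 1%g [set g | f g = n]).
  rewrite predeqE => g; split=> // _; exists (f g) => //.
  case: xgetP => [h _ /= fh|/(_ g) []//]; by apply: injf; rewrite ?in_setT.
apply: (@homeomorphic_cantor (pointed_orders o0) (fun n => positive_at (e n))).
- exact: left_ordering_compact.
- exact: left_ordering_hausdorff.
- by move=> n; exact: positive_at_clopen.
- move=> x y /positive_at_separates[g H]; have [n _ en] : range e g by rewrite eT.
  by exists n; rewrite en.
- by move=> x ox; apply: perf; exists x.
Qed.
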